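(* For every $\varepsilon>0$ there exists $\delta>0$ such that, for all sufficiently large primes $p$, the bound $$|S_p(N)|\le (1-\delta)N$$ holds for all integers $N$ in the range $p^{1/(4\sqrt{e})+\varepsilon}\le N\le p$.
   Context: For an odd prime $p$, $(\cdot|p)$ denotes the Legendre symbol modulo $p$ (with $(n|p)=0$ if $p\mid n$), and for real $x\ge 1$, $$S_p(x)=\sum_{n\le x}(n|p),$$ where the sum runs over positive integers $n\le x$. Here $e$ is the base of the natural logarithm. ''For all sufficiently large primes $p$'' means for all primes $p\ge p_0$, where $p_0$ may depend on $\varepsilon$. *)

(* Defs.v *)
From mathcomp Require Import all_boot all_order all_algebra.
From mathcomp Require Import all_classical all_reals all_analysis.

Set Implicit Arguments.
Unset Strict Implicit.
Unset Printing Implicit Defensive.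

Import Order.TTheory GRing.Theory Num.Theory.

Local Open Scope ring_scope.

(* The Legendre symbol (n|p); meaningful when p is an odd prime. *)
Definition legendre (p n : nat) : int :=
  if (p %| n)%N then 0
  else if [exists x : 'I_p, (x ^ 2 == n %[mod p])%N] then 1
  else -1.

Definition legendre_sum (R : realType) (p : nat) (x : R) : int :=
  \sum_(1 <= n < (Num.truncn x).+1) legendre p n.

(* Main.v *)
Require Import Defs.
From mathcomp Require Import all_boot all_order all_algebra.
From mathcomp Require Import all_classical all_reals all_analysis.
From mathcomp Require Import fingroup cyclic all_field ring lra zify.

(* The proof combines Burgess' method with Vinogradov's trick. Stepanov's
   polynomial method bounds complete sums of the quadratic character chi over
   values of a polynomial having a root of odd multiplicity; by the usual
   moment argument chi then has mean value o(1) on [1, x] as soon as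
   x >= p^(1/4 + eps).

   Suppose |S_p(N)| >= (1 - delta) N for a smaller N, with sign sigma. Since
   log n is the sum of log q over the prime powers q^j dividing n, chi(q) is
   close to sigma S_p(N/q) / (N/q) for most primes q <= N, weighted by
   (log q)/q; iterating, the sign e(t) of sigma S_p(N e^-t) satisfies
   e(t + u) = e(t) e(u) for most t, u, which forces e(2t) = 1. So sigma chi has
   mean value close to 1 at most scales below N. If chi is replaced by 1 at the
   primes q > N, this persists at X = p^(1/4 + eps'), and restoring these
   primes costs at most 2 sum_(N < q <= X) 1/q, about
   2 log (log X / log N) < 1, because log X / log N < sqrt e. Hence
   |S_p(X)| >= c X with c > 0, contrary to Burgess. *)

Set Implicit Arguments.
Unset Strict Implicit.
Unset Printing Implicit Defensive.

Import Order.TTheory GRing.Theory Num.Theory.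

Local Open Scope ring_scope.

(** * Stepanov's method *)

(** Closeness to a sign tau is measured by [deficiency], the sum D(tau, n) of 1 - tau f(m) over m <=
    n. It is nonnegative, monotone in n, and D(-tau, n) = 2n - D(tau, n), so a small value survives
    a bounded change of scale and excludes the opposite sign. Signs are available only at most
    scales, so scales are discretised by powers of a fixed C: the primes between consecutive powers
    have Mertens mass at least 1, and an exceptional scale costs a bounded mass. A small proportion
    of exceptional scales is therefore harmless, which dictates the order of choice: C, then
    [kappa], then delta. Beyond N, the recursion in x for the twisted function closes because the
    scales x/q >= N take only the mass log(x/N) out of the full log x; the difference log N pays for
    the errors. *)

Lemma additive_kernel (U V : finZmodType) (phi : U -> V) :
  (forall x y, phi (x - y) = phi x - phi y) -> (#|V| < #|U|)%N ->
  exists2 x, x != 0 & phi x = 0.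
Proof.
move=> phiB ltVU.
have /injectivePn [x [y neq_xy eq_phi]] : ~~ injectiveb phi.
  by apply/negP => /injectiveP /leq_card; rewrite leqNgt ltVU.
by exists (x - y); rewrite ?subr_eq0 // phiB eq_phi subrr.
Qed.

(** In characteristic p ordinary derivatives detect a root of multiplicity l as long as l <= p: each
    step of the induction divides by some k with 0 < k < l. *)
Lemma dvdp_XsubC_exp_derivn (F : fieldType) (x : F) (l : nat) (q : {poly F}) :
  (forall k, (0 < k < l)%N -> k%:R != 0 :> F) ->
  (forall k, (k < l)%N -> root q^`(k) x) -> ('X - x%:P) ^+ l %| q.
Proof.
elim: l q => [|[|l] IHl] q nzF rq; first by rewrite expr0 dvd1p.
  by rewrite expr1 dvdp_XsubCl; have := rq 0%N isT; rewrite derivn0.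
have /dvdpP[u Dq]: ('X - x%:P) ^+ l.+1 %| q.
  by apply: IHl => k lek; [apply: nzF; lia | apply: rq; lia].
have : ('X - x%:P) ^+ l.+1 %| q^`().
  apply: IHl => k lek; first by apply: nzF; lia.
  by rewrite -derivSn; apply: rq.
rewrite Dq derivM dvdp_addr; last exact: dvdp_mull.
rewrite deriv_exp derivXsubC mul1r /=.
rewrite mulrnAr -mulrnAl [_ ^+ l.+1]exprS dvdp_mul2r; last first.
  by rewrite expf_neq0 // polyXsubC_eq0.
rewrite -scaler_nat dvdpZr; last by apply: nzF; lia.
by move=> /dvdpP[v ->]; rewrite -mulrA -!exprS dvdp_mulIr.
Qed.

Lemma prod_XsubC_exp_dvdp (F : fieldType) (l : nat) (s : seq F) (q : {poly F}) :
  uniq s -> (forall x, x \in s -> ('X - x%:P) ^+ l %| q) ->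
  \prod_(x <- s) ('X - x%:P) ^+ l %| q.
Proof.
elim: s => [|x s IHs] /=; first by rewrite big_nil dvd1p.
move=> /andP[xNs us] dq; rewrite big_cons Gauss_dvdp.
  rewrite dq ?mem_head //=; apply: IHs => // y ys.
  by apply: dq; rewrite in_cons ys orbT.
elim: s xNs {IHs us dq} => [|y s IHs]; first by rewrite big_nil coprimep1.
rewrite in_cons negb_or => /andP[neq_xy xNs].
rewrite big_cons coprimepMr IHs // andbT.
by apply/coprimep_expl/coprimep_expr; rewrite coprimep_XsubC2 // subr_eq0 eq_sym.
Qed.

Lemma leq_card_root_exp (F : fieldType) (l : nat) (s : seq F) (q : {poly F}) :
  q != 0 -> uniq s -> (forall x, x \in s -> ('X - x%:P) ^+ l %| q) ->
  (size s * l < size q)%N.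
Proof.
move=> nz_q us dq; have := dvdp_leq nz_q (prod_XsubC_exp_dvdp us dq).
apply: leq_trans.
rewrite -(big_map (fun x => ('X - x%:P) ^+ l) xpredT id) /=.
elim: {us dq} s => [|x s IHs]; first by rewrite big_nil size_poly1.
rewrite /= big_cons size_mul ?expf_neq0 ?polyXsubC_eq0 //.
  by rewrite size_exp_XsubC /= mulSn -addnS leq_add2l.
rewrite big_seq; elim/big_ind: _ => [||i /mapP[y _ ->]].
- exact: oner_neq0.
- by move=> a b *; rewrite mulf_neq0.
- by rewrite expf_neq0 // polyXsubC_eq0.
Qed.

(* The k-th derivative of [H ^+ l * r] is [H ^+ (l - k) * iter_twist H l%:R k r];
   the parameter is a field element so that [l + p./2] can be used as well. *)
Fixpoint iter_twist (F : fieldType) (H : {poly F}) (t : F) (k : nat)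
    (r : {poly F}) : {poly F} :=
  if k is k'.+1 then
    let u := iter_twist H t k' r in (t - k'%:R) *: (H^`() * u) + H * u^`()
  else r.

Lemma iter_twistB (F : fieldType) (H : {poly F}) t k :
  {morph iter_twist H t k : r s / r - s}.
Proof.
move=> r s; elim: k => //= k ->; rewrite derivB !mulrBr scalerBr.
by rewrite opprD addrACA.
Qed.

Lemma size_iter_twist (F : fieldType) (H r : {poly F}) t k m D :
  (size H <= m.+1)%N -> (size r <= D)%N ->
  (size (iter_twist H t k r) <= D + k * m)%N.
Proof.
move=> sH sr; elim: k => [|k IHk] /=; first by rewrite addn0.
have sH' : (size H^`() <= m)%N.
  have [->|/lt_size_deriv] := eqVneq H 0; first by rewrite deriv0 size_poly0.
  by lia.
apply: leq_trans (size_polyD _ _) _; rewrite geq_max; apply/andP; split.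
  by apply: leq_trans (size_scale_leq _ _) _; apply: leq_trans (size_polyMleq _ _) _; lia.
have [->|nz] := eqVneq (iter_twist H t k r) 0; first by rewrite deriv0 mulr0 size_poly0.
apply: leq_trans (size_polyMleq _ _) _.
have := lt_size_deriv nz. lia.
Qed.

Lemma expFp (p : nat) (p_pr : prime p) (x : 'F_p) : x ^+ p = x.
Proof. by have := expf_card x; rewrite card_Fp. Qed.

(** Over the prime field H^p is H(X^p), by Frobenius, so only the constant term survives modulo
    X^p. *)
Lemma dvdp_Xn_exp_pchar (p : nat) (p_pr : prime p) (H : {poly 'F_p}) :
  'X^p %| H ^+ p - (H.[0])%:P.
Proof.
have pcharP : p \in [pchar {poly 'F_p}] by rewrite (pchar_lalg {poly 'F_p}) pchar_Fp.
have /factor_theorem[Q DQ] : root (H - (H.[0])%:P) 0.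
  by rewrite rootE !hornerE subrr.
have -> : H = Q * 'X + (H.[0])%:P by rewrite -['X]subr0 -polyC0 -DQ subrK.
rewrite !hornerE ?mulr0 ?add0r -!(pFrobenius_autE pcharP) pFrobenius_autD_comm;
  last exact: mulrC.
rewrite !pFrobenius_autE -polyC_exp expFp // addrK exprMn.
exact: dvdp_mulIr.
Qed.

(* Squaring [r = - s H^((p-1)/2)] modulo [X^p] and multiplying by [H] gives
   [r^2 H = H(0) s^2] modulo [X^p], hence exactly, for degree reasons. *)
Lemma stepanov_free1 (p : nat) (p_pr : prime p) (p_odd : odd p)
    (H r s : {poly 'F_p}) (D m : nat) (alpha : 'F_p) :
  size H = m.+1 -> H.[0] != 0 -> odd (mup alpha H) ->
  (0 < D)%N -> (2 * D + m <= p.+1)%N -> (size r <= D)%N -> (size s <= D)%N ->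
  'X^p %| r + s * H ^+ p./2 -> r = 0 /\ s = 0.
Proof.
move=> sH H0 oddH D_gt0 leDp sr ss dvdXp.
have nzH : H != 0 by rewrite -size_poly_eq0 sH.
have nzc : (H.[0])%:P != 0 :> {poly 'F_p} by rewrite polyC_eq0.
have pE : p = (p./2 + p./2).+1 by rewrite -[LHS]odd_double_half p_odd -addnn.
have : 'X^p %| r ^+ 2 * H - s ^+ 2 * (H.[0])%:P.
  have -> : r ^+ 2 * H - s ^+ 2 * (H.[0])%:P =
      (r + s * H ^+ p./2) * ((r - s * H ^+ p./2) * H)
      + s ^+ 2 * (H ^+ p - (H.[0])%:P).
    have -> : H ^+ p = H ^+ (p./2 + p./2).+1 by congr (_ ^+ _); exact: pE.
    by rewrite [H ^+ _.+1]exprS exprD; ring.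
  by apply: dvdp_add; [exact: dvdp_mulr|apply: dvdp_mull; exact: dvdp_Xn_exp_pchar].

set E := _ - _ => dvdE.
have size_sqr (q : {poly 'F_p}) : (size q <= D -> size (q ^+ 2) <= 2 * D - 1)%N.
  by move=> sq; rewrite expr2; apply: leq_trans (size_polyMleq _ _) _; lia.
have aux (q u : {poly 'F_p}) : (size q <= D -> size u <= m.+1 -> size (q ^+ 2 * u)%R <=
  p)%N.
  move=> /size_sqr sq su; apply: leq_trans (size_polyMleq _ _) _.
  by move: (size _) (size _) sq su => a b; lia.
have E0 : E = 0.
  apply/eqP; apply: contraTT dvdE => nzE.
  apply/negP => /(dvdp_leq nzE); rewrite size_polyXn leqNgt => /negP[]; rewrite ltnS.
  apply: leq_trans (size_polyD _ _) _; rewrite size_polyN geq_max; apply/andP; split.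
    by apply: aux; rewrite ?sH.
  by apply: aux; rewrite // size_polyC H0.
move/eqP: E0; rewrite subr_eq0 => /eqP E0.
have [r0|nzr] := eqVneq r 0.
  split=> //; apply/eqP; move/eqP: E0.
  by rewrite r0 expr2 !mul0r eq_sym mulf_eq0 (negPf nzc) orbF expf_eq0.
have [s0|nzs] := eqVneq s 0.
  move/eqP: E0; rewrite s0 [0 ^+ 2]expr2 !mul0r mulf_eq0 (negPf nzH) orbF expf_eq0.
  by rewrite (negPf nzr) andbF.
(* The multiplicity of [alpha] is odd in r^2 H and even in H(0) s^2. *)
have := congr1 (mup alpha) E0.
rewrite !expr2 !mupM ?mulf_neq0 // (@mupNroot _ _ (H.[0])%:P) ?rootC //.
by move=> /(congr1 odd); rewrite !oddD oddH !addbb.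
Qed.

(** Modulo X^p only the term j = 0 is left; [stepanov_free1] kills it, and division by X^p lowers J
    by one. *)
Lemma stepanov_free (p : nat) (p_pr : prime p) (p_odd : odd p)
    (H : {poly 'F_p}) (D m : nat) (alpha : 'F_p) :
  size H = m.+1 -> H.[0] != 0 -> odd (mup alpha H) -> (0 < D)%N ->
  (2 * D + m <= p.+1)%N ->
  forall (J : nat) (r s : nat -> {poly 'F_p}),
  (forall j, size (r j) <= D)%N -> (forall j, size (s j) <= D)%N ->
  \sum_(j < J) (r j + s j * H ^+ p./2) * 'X^(j * p) = 0 ->
  forall j, (j < J)%N -> r j = 0 /\ s j = 0.
Proof.
move=> sH H0 oddH D_gt0 leDp; elim=> [//|J IHJ] r s sr ss.
rewrite big_ord_recl mul0n expr0 mulr1 /=.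
set T := \sum_(i < J) _.
have DT : T = (\sum_(i < J) (r i.+1 + s i.+1 * H ^+ p./2) * 'X^(i * p)) * 'X^p.
  rewrite mulr_suml; apply: eq_bigr => i _.
  by rewrite /bump /= add1n mulSn addnC exprD mulrA.
move=> E0.
have [r0 s0] : r 0%N = 0 /\ s 0%N = 0.
  apply: (stepanov_free1 p_pr p_odd sH H0 oddH D_gt0 leDp) => //.
  by move/eqP: E0; rewrite addr_eq0 => /eqP ->; rewrite DT dvdpNr dvdp_mulIr.
move/eqP: E0; rewrite r0 s0 mul0r !add0r DT mulf_eq0 (negPf (monic_neq0 (monicXn _ _)))
  orbF => /eqP E0.
by case=> [//|j] ltj; apply: (IHJ (fun j => r j.+1) (fun j => s j.+1)).
Qed.

(** The factors X^(jp) have derivative 0, so up to l differentiations keep the shape of the sum; the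
    factor H^(p./2) merely shifts the exponent seen by [iter_twist] to l + p./2. *)
Lemma derivn_stepanov (p : nat) (p_pr : prime p) (H : {poly 'F_p}) (l J : nat)
    (r s : nat -> {poly 'F_p}) (k : nat) : (k <= l)%N ->
  (H ^+ l * \sum_(j < J) (r j + s j * H ^+ p./2) * 'X^(j * p))^`(k) =
  H ^+ (l - k) * \sum_(j < J) (iter_twist H l%:R k (r j) +
     iter_twist H (l + p./2)%:R k (s j) * H ^+ p./2) * 'X^(j * p).
Proof.
elim: k => [|k IHk] lekl; first by rewrite subn0 derivn0.
rewrite derivnS IHk ?(ltnW lekl) // !mulr_sumr (raddf_sum (@deriv _));
  apply: eq_bigr => j _.
have dX : ('X^(j * p) : {poly 'F_p})^`() = 0.
  have pcharP : p \in [pchar {poly 'F_p}] by rewrite (pchar_lalg {poly 'F_p}) pchar_Fp.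
  by rewrite derivXn -mulr_natr natrM (pcharf0 pcharP) !mulr0.
rewrite /= -(subnSK lekl); set u := iter_twist _ _ k _; set v := iter_twist _ _ k _.
set a := (l - k.+1)%N.
have -> : l%:R = a%:R + k.+1%:R :> 'F_p by rewrite -natrD /a subnK.
have -> : (l + p./2)%:R = a%:R + k.+1%:R + (p./2)%:R :> 'F_p.
  by rewrite -!natrD /a subnK.
have Hg : H * (H ^+ p./2)^`() = (p./2)%:R * (H^`() * H ^+ p./2).
  rewrite deriv_exp; case: (p./2) => [|P]; first by rewrite mulr0n !mulr0 mul0r.
  by rewrite /= exprS -mulr_natl; ring.
have Ha : (H ^+ a.+1)^`() = a.+1%:R * H^`() * H ^+ a by rewrite deriv_exp /= -mulr_natl
  mulrA.
move: (H ^+ p./2) Hg => g Hg; move: ('X^(j * p)) dX => X dX.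
rewrite !(derivM, derivD) dX Ha exprS -!mul_polyC.
rewrite !(polyCB, polyCD) !polyC_natr.
apply/eqP; rewrite -subr_eq0; apply/eqP.
transitivity (H ^+ a * v * X * (H * g^`() - (p./2)%:R * (H^`() * g))).
  rewrite -[a.+1]addn1 -[k.+1]addn1 !natrD; ring.
by rewrite Hg subrr mulr0.
Qed.

(** The auxiliary polynomial F is H^l times the sum of (r_j + s_j H^(p./2)) X^(jp). Where
    H(x)^(p./2) = a, the identity x^p = x turns its derivative of order k < l into a power of H(x)
    times the value of a polynomial of degree below D + lm + J. Making these polynomials vanish is l
    (D + lm + J) linear conditions on 2JD coefficients, so some nonzero choice gives F a zero of
    order l at every counted x, and the degree of F bounds their number. *)
Lemma stepanov_count (p : nat) (p_pr : prime p) (p_odd : odd p)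
    (H : {poly 'F_p}) (D m l J : nat) (alpha a : 'F_p) :
  size H = m.+1 -> H.[0] != 0 -> odd (mup alpha H) ->
  (0 < D)%N -> (2 * D + m <= p.+1)%N -> (l <= p)%N ->
  (l * (D + l * m + J) < 2 * J * D)%N ->
  (#|[set x : 'F_p | H.[x] ^+ p./2 == a]| * l <=
     l * m + D + p./2 * m + J * p)%N.
Proof.
move=> sH H0 oddH D_gt0 leDp lelp.
case: J => [|J] ltE; first by move: ltE; rewrite muln0 mul0n.
set E := (D + l * m + J.+1)%N in ltE.
pose U : finZmodType := 'M['F_p]_(J.+1 + J.+1, D).
pose V : finZmodType := 'M['F_p]_(l, E).
pose r (A : 'M['F_p]_(J.+1, D)) j := rVpoly (row (inord j) A).
have rB A B j : r (A - B) j = r A j - r B j by rewrite /r !linearB.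
have size_r A j : (size (r A j) <= D)%N by apply: size_poly.
(* The bracket in the k-th derivative of F at a counted point, with a in place of H^(p./2); X^(jp)
   will become X^j. *)
pose T (u : U) k j := iter_twist H l%:R k (r (usubmx u) j)
   + a *: iter_twist H (l + p./2)%:R k (r (dsubmx u) j).
have TB u v k j : T (u - v) k j = T u k j - T v k j.
  by rewrite /T !linearB !rB !iter_twistB scalerBr opprD addrACA.
have size_T u k j : (k < l)%N -> (j < J.+1)%N -> (size (T u k j * 'X^j)%R <= E)%N.
  move=> ltkl ltjJ; have [->|nzT] := eqVneq (T u k j) 0; first by rewrite mul0r size_poly0.
  rewrite size_mulXn // /E addnC leq_add //; last exact: ltnW.
  apply: leq_trans (size_polyD _ _) _; rewrite geq_max; apply/andP; split.
    apply: leq_trans (@size_iter_twist _ _ _ _ _ m D _ (size_r _ _)) _; rewrite ?sH //.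
    by rewrite leq_add2l leq_mul2r (ltnW ltkl) orbT.
  apply: leq_trans (size_scale_leq _ _) _.
  apply: leq_trans (@size_iter_twist _ _ _ _ _ m D _ (size_r _ _)) _; rewrite ?sH //.
  by rewrite leq_add2l leq_mul2r (ltnW ltkl) orbT.
pose phi (u : U) : V := \matrix_(k < l, e < E) (\sum_(j < J.+1) T u k j * 'X^j)`_e.
have [||AB nzAB phi0] := @additive_kernel U V phi.
- move=> u v; apply/matrixP => k e; rewrite !mxE -coefB -sumrB; congr (nth 0 (polyseq _) e).
  by apply: eq_bigr => j _; rewrite TB mulrBl.
- rewrite !card_mx card_Fp // ltn_exp2l ?prime_gt1 //.
  by rewrite addnn -mul2n.
have T0 k : (k < l)%N -> \sum_(j < J.+1) T AB k j * 'X^j = 0.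
  move=> ltkl; apply/polyP => e; rewrite coef0.
  have [lteE|leEe] := ltnP e E.
    by have /matrixP/(_ (Ordinal ltkl) (Ordinal lteE)) := phi0; rewrite !mxE.
  rewrite nth_default //; apply: leq_trans leEe.
  elim/big_ind: _ => [|x y sx sy|j _]; rewrite ?size_poly0 ?size_T //.
  by apply: leq_trans (size_polyD _ _) _; rewrite geq_max sx.
pose A := usubmx AB; pose B := dsubmx AB;
  pose F := H ^+ l * \sum_(j < J.+1) (r A j + r B j * H ^+ p./2) * 'X^(j * p).
have nzH : H != 0 by rewrite -size_poly_eq0 sH.
(* [stepanov_free] is what turns a nonzero vector of coefficients into a nonzero polynomial. *)
have nzF : F != 0.
  rewrite mulf_neq0 ?expf_neq0 //; apply: contra nzAB => /eqP F0.
  have AB0 := stepanov_free p_pr p_odd sH H0 oddH D_gt0 leDp (size_r A) (size_r B) F0.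
  rewrite -[AB]vsubmxK -/A -/B -[0]vsubmxK !linear0; apply/eqP.
  congr (col_mx _ _); apply/row_matrixP => j; rewrite row0 -[row _ _]rVpolyK.
    by have [+ _] := AB0 j (ltn_ord j); rewrite /r inord_val => ->; rewrite linear0.
  by have [_] := AB0 j (ltn_ord j); rewrite /r inord_val => ->; rewrite linear0.
have := @leq_card_root_exp _ l (enum [set x : 'F_p | H.[x] ^+ p./2 == a]) F nzF (enum_uniq
  _).
rewrite -cardE => ltF.
have {}ltF : (#|[set x : 'F_p | H.[x] ^+ p./2 == a]| * l < size F)%N.
  apply: ltF => x; rewrite mem_enum inE => /eqP Hxa; apply: dvdp_XsubC_exp_derivn.
    move=> k /andP[k_gt0 ltkl]; rewrite -(dvdn_pcharf (pchar_Fp p_pr)).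
    by rewrite gtnNdvd //; apply: leq_trans ltkl _.
  move=> k ltkl; rewrite rootE derivn_stepanov ?(ltnW ltkl) // hornerM.
  have /(congr1 (fun q => q.[x])) := T0 k ltkl; rewrite horner0.
  rewrite !horner_sum => T0x; rewrite [X in _ * X](_ : _ = 0) ?mulr0 //.
  rewrite -[RHS]T0x; apply: eq_bigr => j _.
  rewrite !hornerE Hxa mulnC exprM.
  by rewrite [x ^+ p]expFp // [a * _]mulrC.
suff : (size F <= (l * m + D + p./2 * m + J.+1 * p).+1)%N by move=> leF; rewrite -ltnS;
  apply: leq_trans ltF leF.
apply: leq_trans (size_polyMleq _ _) _.
have sHn n : (size (H ^+ n) <= (n * m).+1)%N.
  by apply: leq_trans (size_poly_exp_leq _ _) _; rewrite sH mulnC.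
have sS : (size (\sum_(j < J.+1) (r A j + r B j * H ^+ p./2) * 'X^(j * p))%R <=
    D + p./2 * m + J.+1 * p)%N.
  elim/big_ind: _ => [|u v su sv|j _]; first by rewrite size_poly0.
    by apply: leq_trans (size_polyD _ _) _; rewrite geq_max su.
  apply: leq_trans (size_polyMleq _ _) _; rewrite size_polyXn addnS /=.
  apply: leq_add; last by rewrite leq_mul2r (ltnW (ltn_ord j)) orbT.
  apply: leq_trans (size_polyD _ _) _; rewrite geq_max; apply/andP; split.
    by apply: leq_trans (size_r _ _) _; apply: leq_addr.
  apply: leq_trans (size_polyMleq _ _) _.
  by have := size_r B j; have := sHn p./2; move: (size _) (size _) => x y; lia.
by have := sHn l; move: (size _) (size _) sS => x y; lia.
Qed.

(** * The quadratic character and its complete sums *)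

(** Euler's criterion taken as definition; the link with squares is made in [legendreE]. *)
Definition qchar (p : nat) (x : 'F_p) : int :=
  if x == 0 then 0 else if x ^+ p./2 == 1 then 1 else -1.

Lemma oneN_neq1_Fp (p : nat) : prime p -> odd p -> (-1 : 'F_p) == 1 = false.
Proof.
move=> p_pr p_odd; rewrite eq_sym -subr_eq0 opprK -(natrD _ 1 1) -(dvdn_pcharf (pchar_Fp
  p_pr)).
by rewrite gtnNdvd // odd_prime_gt2.
Qed.

Lemma exp_half_Fp (p : nat) (p_pr : prime p) (p_odd : odd p) (x : 'F_p) :
  x != 0 -> x ^+ p./2 = 1 \/ x ^+ p./2 = -1.
Proof.
move=> nzx; have : (x ^+ p./2) ^+ 2 == 1.
  rewrite -exprM muln2; apply/eqP/(mulfI nzx); rewrite mulr1 -exprS.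
  by rewrite -[in RHS](expFp p_pr x); congr (_ ^+ _); rewrite -[RHS]odd_double_half p_odd.
by rewrite sqrf_eq1 => /orP[] /eqP; [left|right].
Qed.

Lemma qcharM (p : nat) (p_pr : prime p) (p_odd : odd p) (x y : 'F_p) :
  qchar (x * y) = qchar x * qchar y.
Proof.
rewrite /qchar mulf_eq0; case: eqVneq => [|nzx]; first by rewrite mul0r.
case: eqVneq => [|nzy] /=; first by rewrite mulr0.
rewrite exprMn; have N1 := oneN_neq1_Fp p_pr p_odd.
by case: (exp_half_Fp p_pr p_odd nzx) => ->; case: (exp_half_Fp p_pr p_odd nzy) => ->;
  rewrite ?mulrNN ?mulr1 ?mul1r ?eqxx ?N1 ?mulrNN ?mulr1 ?mul1r.
Qed.

Lemma qchar_prod (p : nat) (p_pr : prime p) (p_odd : odd p) (I : finType) (F : I -> 'F_p) :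
  \prod_i qchar (F i) = qchar (\prod_i F i).
Proof.
have q1 : qchar (1 : 'F_p) = 1 by rewrite /qchar oner_eq0 expr1n eqxx.
by rewrite (big_morph _ (qcharM p_pr p_odd) q1).
Qed.

Lemma qchar_norm (p : nat) (x : 'F_p) : x != 0 -> `|qchar x| = 1.
Proof. by rewrite /qchar => /negPf->; case: ifP; rewrite ?normrN normr1. Qed.

Lemma qchar_norm_le1 (p : nat) (x : 'F_p) : `|qchar x| <= 1.
Proof.
by have [->|/qchar_norm->//] := eqVneq x 0; rewrite /qchar eqxx normr0.
Qed.

(** Here [l] is the integer part of sqrt p, so the count is at most p/2 + O(m sqrt p). *)
Lemma stepanov_bound (p : nat) (p_pr : prime p) (p_odd : odd p)
    (H : {poly 'F_p}) (m l : nat) (alpha a : 'F_p) :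
  size H = m.+1 -> H.[0] != 0 -> odd (mup alpha H) ->
  (l ^ 2 <= p < l.+1 ^ 2)%N -> (4 * m + 6 <= l)%N ->
  (2 * #|[set x : 'F_p | H.[x] ^+ p./2 == a]| * l <= l * p + (7 * m + 8) * p)%N.
Proof.
move=> sH H0 oddH /andP[lelp ltpl] leml.
have p2 : (p./2 * 2 <= p)%N by rewrite -[leqRHS]odd_double_half -muln2 leq_addl.
have l2 : (l <= l ^ 2)%N by rewrite -[leqLHS]muln1 expnS expn1 leq_mul //; lia.
(* D is the largest value allowed by [stepanov_free]. As 2J exceeds l by at least 4m + 5, the number
   2JD of unknowns exceeds lD by (4m + 5) D, more than the l^2 m + lJ <= p (m + 1) remaining
   conditions. *)
pose D := (p.+1 - m)./2; pose J := (l./2 + 2 * m + 3)%N.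
have DE : (2 * D <= p.+1 - m <= 2 * D + 1)%N by rewrite /D; lia.
have JE : (l + 4 * m + 5 <= 2 * J <= l + 4 * m + 6)%N by rewrite /J; lia.
have := @stepanov_count p p_pr p_odd H D m l J alpha a sH H0 oddH.
move: #|_| => n; move: DE JE; clearbody D J => DE JE /(_ _ _ _ _)/wrap[].
- nia.
- lia.
- lia.
- have h1 : (l * l * m + l * J <= p * (m + 1))%N by nia.
  have h2 : (2 * p * (m + 1) < (4 * m + 5) * (p - m))%N by nia.
  have h3 : ((l + 4 * m + 5) * D <= 2 * J * D)%N by rewrite leq_mul2r; lia.
  have h4 : ((4 * m + 5) * (p - m) <= (4 * m + 5) * (2 * D))%N by rewrite leq_mul2l; lia.
  lia.
have h1 : (l * m <= p * m)%N by rewrite leq_mul2r; lia.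
have h2 : (p./2 * 2 * m <= p * m)%N by rewrite leq_mul2r p2 orbT.
have h3 : (2 * J * p <= (l + 4 * m + 6) * p)%N by rewrite leq_mul2r; lia.
lia.
Qed.

(** The sum is the difference of the counts for a = 1 and a = -1. Together with the at most m roots
    of H they add up to p, so an upper bound for each is also a lower bound for the other. *)
Lemma qchar_sum_bound (p : nat) (p_pr : prime p) (p_odd : odd p)
    (H : {poly 'F_p}) (m l : nat) (alpha : 'F_p) :
  size H = m.+1 -> H.[0] != 0 -> odd (mup alpha H) ->
  (l ^ 2 <= p < l.+1 ^ 2)%N -> (4 * m + 6 <= l)%N ->
  `|\sum_(y : 'F_p) qchar H.[y]| * l%:Z <= ((8 * m + 8) * p)%:Z.
Proof.
move=> sH H0 oddH lep lem.
have N1 := oneN_neq1_Fp p_pr p_odd.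
have half_gt0 : (0 < p./2)%N by have := odd_prime_gt2 p_odd p_pr; lia.
have z0 : (0 : 'F_p) ^+ p./2 = 0 by rewrite expr0n -[_ == _]negbK -lt0n half_gt0.
have qE (z : 'F_p) : qchar z = (z ^+ p./2 == 1)%:Z - (z ^+ p./2 == -1)%:Z.
  rewrite /qchar; case: eqVneq => [->|nz].
    by rewrite z0 eq_sym oner_eq0 eq_sym oppr_eq0 oner_eq0.
  by case: (exp_half_Fp p_pr p_odd nz) => ->; rewrite ?eqxx ?N1 // eq_sym N1.
have oneE (z : 'F_p) : 1%N = ((z ^+ p./2 == 1)%R + (z ^+ p./2 == -1)%R + (z == 0)%R)%N.
  case: (eqVneq z 0) => [->|nz].
    by rewrite z0 eq_sym oner_eq0 eq_sym oppr_eq0 oner_eq0.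
  by case: (exp_half_Fp p_pr p_odd nz) => ->; rewrite ?eqxx ?N1 // eq_sym N1.
pose n a := #|[set x : 'F_p | H.[x] ^+ p./2 == a]|.
have nE a : n a = (\sum_(y : 'F_p) (H.[y] ^+ p./2 == a)%R)%N.
  by rewrite /n -sum1_card big_mkcond /=; apply: eq_bigr => y _; rewrite inE; case: ifP.
have -> : \sum_(y : 'F_p) qchar H.[y] = (n 1)%:Z - (n (-1))%:Z.
  by rewrite !nE !(big_morph Posz PoszD (erefl _)) -sumrB; apply: eq_bigr => y _;
    rewrite qE.
have nzH : H != 0 by rewrite -size_poly_eq0 sH.
have n0 : (#|[set y | root H y]| <= m)%N.
  rewrite -ltnS -sH cardE; apply: max_poly_roots => //; last exact: enum_uniq.
  by apply/allP => y; rewrite mem_enum inE.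
have pE : p = (n 1%R + n (-1)%R + #|[set y | root H y]|)%N.
  have /(congr1 (fun F : 'F_p -> nat => \sum_y F y)%N) :
     (fun _ => 1)%N = fun y : 'F_p =>
       ((H.[y] ^+ p./2 == 1)%R + (H.[y] ^+ p./2 == -1)%R + (H.[y] == 0)%R)%N.
    by apply: funext => y; rewrite -oneE.
  rewrite sum1_card card_Fp // !big_split /= -!nE => {1}->; congr (_ + _)%N.
  by rewrite -sum1_card [RHS]big_mkcond /=; apply: eq_bigr => y _; rewrite inE rootE;
    case: ifP.
have := @stepanov_bound p p_pr p_odd H m l alpha 1 sH H0 oddH lep lem.
have := @stepanov_bound p p_pr p_odd H m l alpha (-1) sH H0 oddH lep lem.
rewrite -/(n _) -/(n _); move: (n 1) (n (-1)) #|_| pE n0 => x y z pE n0.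
have lelp : (l <= p)%N.
  have /andP[+ _] := lep; apply: leq_trans; rewrite -[leqLHS]muln1 expnS expn1.
  by apply: leq_mul; lia.
move=> h1 h2.
have {}h1 : (2 * y * l + l * m * 0 <= l * (x + y + z) + (7 * m + 8) * p)%N by rewrite -pE;
  lia.
have {}h2 : (2 * x * l + l * m * 0 <= l * (x + y + z) + (7 * m + 8) * p)%N by rewrite -pE;
  lia.
have lz : (l * z <= m * p)%N by rewrite mulnC leq_mul.
have [lexy|ltyx] := leqP x y.
  rewrite distrC subzn // ger0_norm // -PoszM lez_nat mulnBl; lia.
rewrite subzn ?(ltnW ltyx) // ger0_norm // -PoszM lez_nat mulnBl; lia.
Qed.

(** * Moments of short character sums *)

(** The tuples for which the product of the y + beta_i + 1 is a square, so that the complete sum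
    over y has no cancellation. *)
Definition even_fibers (n B : nat) (beta : {ffun 'I_n -> 'I_B}) :=
  [forall b, ~~ odd #|[set i | beta i == b]|].

(** Every value that occurs does so at least twice, so there are at most r values and beta factors
    through a set of r elements. *)
Lemma card_even_fibers (r B : nat) :
  (#|[set beta : {ffun 'I_(2 * r) -> 'I_B} | even_fibers beta]| <=
     B ^ r * r ^ (2 * r))%N.
Proof.
pose comp (u : {ffun 'I_r -> 'I_B} * {ffun 'I_(2 * r) -> 'I_r}) :=
  [ffun i => u.1 (u.2 i)].
have -> : (B ^ r * r ^ (2 * r))%N =
    #|{: {ffun 'I_r -> 'I_B} * {ffun 'I_(2 * r) -> 'I_r}}|.
  by rewrite card_prod !card_ffun !card_ord.
apply: leq_trans (leq_imset_card comp _); apply: subset_leq_card.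
apply/fintype.subsetP => beta; rewrite inE => /forallP ev.
pose A := beta @: [set: 'I_(2 * r)].
have lt_sizeA i : (index (beta i) (enum A) < size (enum A))%N.
  by rewrite index_mem mem_enum imset_f.
have leAr : (#|A| <= r)%N.
  have : (\sum_(b in A) 2 <= \sum_(b in A) #|[set i | beta i == b]|)%N.
    apply: leq_sum => b /imsetP[i _ ->]; have := ev (beta i).
    have : (0 < #|[set j | beta j == beta i]|)%N.
      by apply/card_gt0P; exists i; rewrite inE.
    by case: #|_| => [|[]].
  rewrite sum_nat_const (_ : \sum_(b in A) _ = 2 * r)%N; last first.
    rewrite -[RHS](card_ord (2 * r)) -sum1_card (partition_big beta (mem A)) /=.
      by apply: eq_bigr => b _; rewrite -sum1_card; apply: eq_bigl => i; rewrite inE.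
    by move=> i _; rewrite imset_f.
  by rewrite mulnC leq_pmul2l.
have ltr i : (index (beta i) (enum A) < r)%N.
  by apply: leq_trans (lt_sizeA i) _; rewrite -cardE.
have [r0|r_gt0] := posnP r.
  have e1 : #|'I_r| = 0%N by rewrite card_ord.
  have e2 : #|'I_(2 * r)| = 0%N by rewrite card_ord r0.
  apply/imsetP; exists (ffun0 e1, ffun0 e2) => //.
  by apply/ffunP => i; have := ltn_ord i; rewrite [X in (_ < X)%N -> _](_ : _ = 0%N) ?r0.
have i0 : 'I_(2 * r) by exists 0%N; rewrite muln_gt0.
apply/imsetP; exists ([ffun k : 'I_r => nth (beta i0) (enum A) k],
                      [ffun i => Ordinal (ltr i)]) => //.
by apply/ffunP => i; rewrite !ffunE /= nth_index // mem_enum imset_f.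
Qed.

(** A value b with odd fibre is a root -(b + 1) of odd multiplicity; B < p keeps the roots distinct
    and nonzero. *)
Lemma qchar_prod_sum_bound (p : nat) (p_pr : prime p) (p_odd : odd p)
    (n B l : nat) (beta : {ffun 'I_n -> 'I_B}) :
  (B < p)%N -> ~~ even_fibers beta ->
  (l ^ 2 <= p < l.+1 ^ 2)%N -> (4 * n + 6 <= l)%N ->
  `|\sum_(y : 'F_p) \prod_i qchar (y + (beta i).+1%:R)| * l%:Z <= ((8 * n + 8) * p)%:Z.
Proof.
move=> ltBp /forallPn[b /negPn odd_b] lp ln.
pose c (b : 'I_B) : 'F_p := - b.+1%:R.
pose H : {poly 'F_p} := \prod_(x <- [seq c (beta i) | i <- enum 'I_n]) ('X - x%:P).
have nat_ltp k : (k < p)%N -> (k%:R : 'F_p) = k :> nat.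
  by move=> ltkp; rewrite val_Fp_nat // modn_small.
have c_inj : injective c.
  move=> x y /oppr_inj /(congr1 val) /=.
  by rewrite !nat_ltp ?(leq_ltn_trans (ltn_ord _)) // => -[] /val_inj.
have nzc x : c x != 0.
  rewrite oppr_eq0 -(dvdn_pcharf (pchar_Fp p_pr)) gtnNdvd //.
  exact: leq_ltn_trans (ltn_ord _) ltBp.
have HE y : H.[y] = \prod_i (y + (beta i).+1%:R).
  rewrite /H big_map big_enum horner_prod; apply: eq_bigr => i _.
  by rewrite !hornerE /c opprK.
under eq_bigr do rewrite qchar_prod // -HE.
apply: (@qchar_sum_bound p p_pr p_odd H n l (c b)) => //.
- by rewrite size_prod_XsubC size_map size_enum_ord.
- rewrite HE; apply/prodf_neq0 => i _; rewrite add0r; apply: contra (nzc (beta i)).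
  by move=> /eqP cE; rewrite /c cE oppr0.
rewrite mu_prod_XsubC count_map; move: odd_b; congr (odd _).
rewrite -sum1_card -sum1_count big_enum_cond; apply: eq_bigl => i /=.
by rewrite inE (inj_eq c_inj).
Qed.

(** Expanding the power gives a sum over 2r-tuples: the trivial bound p for those with even fibres,
    square-root cancellation for the others. *)
Lemma qchar_moment (p : nat) (p_pr : prime p) (p_odd : odd p) (r B l : nat) :
  (B < p)%N -> (l ^ 2 <= p < l.+1 ^ 2)%N -> (8 * r + 6 <= l)%N ->
  (\sum_(y : 'F_p) (\sum_(b < B) qchar (y + b.+1%:R)) ^+ (2 * r)) * l%:Z <=
  (B ^ r * r ^ (2 * r) * p * l + B ^ (2 * r) * ((16 * r + 8) * p))%:Z.
Proof.
move=> ltBp lp lr.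
under eq_bigr => y _.
  rewrite -[X in _ ^+ X]card_ord -prodr_const bigA_distr_bigA /=. over.
rewrite exchange_big /= (bigID (@even_fibers _ _)) /= mulrDl PoszD lerD //.
  rewrite (@le_trans _ _ (\sum_(b : {ffun 'I_(2 * r) -> 'I_B} | even_fibers b) (p * l)%:Z))
    //.
    rewrite mulr_suml; apply: ler_sum => b _; rewrite PoszM ler_wpM2r //.
    apply: le_trans (ler_norm _) _; apply: le_trans (ler_norm_sum _ _ _) _.
    apply: (@le_trans _ _ (\sum_(y : 'F_p) 1)); last by rewrite sumr_const card_Fp // natz.
    apply: ler_sum => y _; rewrite normr_prod; apply: prodr_ile1 => i _.
    by rewrite normr_ge0 qchar_norm_le1.
  rewrite sumr_const -mulr_natl natz -PoszM lez_nat -mulnA leq_mul2r; apply/orP; right.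
  apply: leq_trans (card_even_fibers r B); apply: eq_leq.
  by rewrite cardsE.
rewrite mulr_suml.
rewrite (@le_trans _ _ (\sum_(b : {ffun 'I_(2 * r) -> 'I_B} | ~~ even_fibers b) ((16 * r +
  8) * p)%:Z)) //.
  apply: ler_sum => b nb.
  apply: (@le_trans _ _ (`|\sum_(y : 'F_p) \prod_i qchar (y + (b i).+1%:R)| * l%:Z)).
    by rewrite ler_wpM2r // ler_norm.
  have -> : (16 * r = 8 * (2 * r))%N by lia.
  by apply: qchar_prod_sum_bound => //; lia.
rewrite sumr_const -mulr_natl natz -PoszM lez_nat leq_mul2r; apply/orP; right.
apply: leq_trans (max_card _) _; by rewrite card_ffun !card_ord.
Qed.

(** * Burgess' averaging argument *)

(** Cauchy-Schwarz for the sizes of the fibres of [phi] above Y. *)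
Lemma card_preim_sqr_le (U V : finType) (phi : U -> V) (D : {set U}) (Y : {set V}) :
  (#|[set u in D | phi u \in Y]| ^ 2 <=
     #|Y| * #|[set w : U * U | [&& w.1 \in D, w.2 \in D & phi w.1 == phi w.2]]|)%N.
Proof.
pose nu y := #|[set u in D | phi u == y]|.
have -> : #|[set u in D | phi u \in Y]| = (\sum_(y in Y) nu y)%N.
  rewrite -sum1_card (partition_big phi (mem Y)) /= => [|u]; last by rewrite inE => /andP[].
  apply: eq_bigr => y Yy; rewrite /nu -sum1_card; apply: eq_bigl => u.
  by rewrite !inE -andbA; case: eqP => [->|]; rewrite ?Yy ?andbF.
have le_nu : (\sum_(y in Y) nu y ^ 2 <=
    #|[set w : U * U | [&& w.1 \in D, w.2 \in D & phi w.1 == phi w.2]]|)%N.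
  rewrite -sum1_card (partition_big (fun w => phi w.1) predT) //= [leqRHS](bigID (mem Y))
    /=.
  apply: leq_trans (leq_addr _ _); apply: leq_sum => y _.
  rewrite sum1_card expnS expn1 -cardsX; apply: subset_leq_card.
  apply/fintype.subsetP => -[u v]; rewrite !inE /=.
  by move=> /andP[/andP[Du /eqP uy] /andP[Dv /eqP vy]];
    rewrite unfold_in inE /= Du Dv uy vy !eqxx.
apply: leq_trans (leq_mul (leqnn _) le_nu).
rewrite -(leq_pmul2l (isT : 0 < 2)%N) expnS expn1 big_distrlr /=.
have -> : (2 * (#|Y| * \sum_(y in Y) nu y ^ 2))%N =
    (\sum_(i in Y) \sum_(j in Y) (nu i ^ 2 + nu j ^ 2))%N.
  rewrite [RHS](eq_bigr (fun i => #|Y| * nu i ^ 2 + \sum_(y in Y) nu y ^ 2)%N).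
    by rewrite big_split /= sum_nat_const -big_distrr /= addnn mul2n.
  by move=> i _; rewrite big_split /= sum_nat_const.
rewrite big_distrr; apply: leq_sum => i _; rewrite big_distrr; apply: leq_sum => j _.
exact: nat_Cauchy.
Qed.

Lemma sum_shift_norm (g : nat -> int) (x k : nat) : (forall n, `|g n| <= 1) ->
  `|\sum_(n < x) g n - \sum_(n < x) g (n + k)%N| <= (2 * k)%:Z.
Proof.
move=> g1.
have gk i : \sum_(i <= n < i + k) `|g n| <= k%:Z.
  rewrite (@le_trans _ _ (\sum_(i <= n < i + k) 1)) ?ler_sum //.
  by rewrite big_const_nat iter_addr_0 addKn natz.
rewrite -(big_mkord xpredT g) -(big_mkord xpredT (fun n => g (n + k)%N)).
have -> : \sum_(0 <= n < x) g (n + k)%N = \sum_(k <= n < x + k) g n.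
  by rewrite -{2}[k]add0n big_addn addnK.
have e1 := @big_cat_nat _ _ _ x 0 (x + k) xpredT g (leq0n _) (leq_addr _ _).
have e2 := @big_cat_nat _ _ _ k 0 (x + k) xpredT g (leq0n _) (leq_addl _ _).
have -> : \sum_(0 <= n < x) g n - \sum_(k <= n < x + k) g n =
    \sum_(0 <= n < k) g n - \sum_(x <= n < x + k) g n.
  apply/eqP; rewrite subr_eq addrAC eq_sym subr_eq; apply/eqP.
  by rewrite -[RHS]e1 -[LHS]e2.
rewrite (le_trans (ler_normB _ _)) // mul2n -addnn PoszD lerD //.
  by rewrite (le_trans (ler_norm_sum _ _ _)) //; apply: (gk 0%N).
by rewrite (le_trans (ler_norm_sum _ _ _)).
Qed.

Definition short_sum (p B : nat) (y : 'F_p) : int := \sum_(b < B) qchar (y + b.+1%:R).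

Lemma short_sum_norm (p B : nat) (y : 'F_p) : `|short_sum B y| <= B%:Z.
Proof.
rewrite (le_trans (ler_norm_sum _ _ _)) // (@le_trans _ _ (\sum_(b < B) 1)) ?ler_sum //.
  by move=> b _; apply: qchar_norm_le1.
by rewrite sumr_const card_ord natz.
Qed.

Definition large_sums (p B d : nat) : {set 'F_p} :=
  [set y : 'F_p | B%:Z < d%:Z * `|short_sum B y|].

(** Chebyshev's inequality for the 2r-th moment. By l <= B^r the diagonal term is, up to constants,
    no larger than the other one, so only O(sqrt p) short sums exceed B/d. *)
Lemma card_large_sums (p : nat) (p_pr : prime p) (p_odd : odd p) (r B l d : nat) :
  (0 < B < p)%N -> (l ^ 2 <= p < l.+1 ^ 2)%N -> (8 * r + 6 <= l)%N -> (l <= B ^ r)%N ->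
  (#|large_sums p B d| * l <=
    d ^ (2 * r) * (r ^ (2 * r) + 16 * r + 8) * p)%N.
Proof.
move=> /andP[B_gt0 ltBp] lp lr lB; set Y := large_sums p B d.
have := qchar_moment p_pr p_odd ltBp lp lr; rewrite -/(short_sum _ _) => mom.
have {mom} : (#|Y| * B ^ (2 * r) * l)%:Z <=
   (d ^ (2 * r) * (B ^ r * r ^ (2 * r) * p * l + B ^ (2 * r) * ((16 * r + 8) * p)))%:Z.
  rewrite [leRHS]PoszM; apply: le_trans (ler_wpM2l _ mom) => //.
  rewrite mulrA PoszM ler_wpM2r // mulr_sumr (bigID (mem Y)) /=.
  apply: ler_wpDr.
    by apply: sumr_ge0 => y _; rewrite mulr_ge0 // exprM exprn_ge0 // sqr_ge0.
  have -> : (#|Y| * B ^ (2 * r))%N%:Z = \sum_(y in Y) (B ^ (2 * r))%:Z.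
    by rewrite sumr_const -mulr_natl natz PoszM.
  apply: ler_sum => y; rewrite inE => /ltW Bd.
  have PX (a k : nat) : (a ^ k)%:Z = a%:Z ^+ k by rewrite -natz natrX natz.
  have even_norm (z : int) : z ^+ (2 * r) = `|z| ^+ (2 * r).
    by rewrite !exprM real_normK ?num_real.
  rewrite !PX (even_norm (\sum_(_ < _) _)) -exprMn.
  by apply: lerXn2r; rewrite ?nnegrE ?mulr_ge0.
rewrite lez_nat => h.
have Br_gt0 : (0 < B ^ r)%N by rewrite expn_gt0 B_gt0.
rewrite -(leq_pmul2l (_ : 0 < B ^ r * B ^ r))%N ?muln_gt0 ?Br_gt0 //.
have BB : (B ^ (2 * r) = B ^ r * B ^ r)%N by rewrite mul2n -addnn expnD.
rewrite BB in h.
have h2 : (B ^ r * l * (d ^ (2 * r) * r ^ (2 * r) * p) <= B ^ r * B ^ r * (d ^ (2 * r) * r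
  ^ (2 * r) * p))%N.
  by rewrite leq_mul2r leq_mul2l lB !orbT.
lia.
Qed.

Definition qchar_sum (p x : nat) : int := \sum_(n < x) qchar (n.+1%:R : 'F_p).

Definition ratio_map (p A x : nat) (u : 'I_A.+1 * 'I_x) : 'F_p :=
  u.2.+1%:R / u.1%:R.

(** Replacing n by n + ab changes the sum by at most 2ab, and chi(n + ab) = chi(a) chi(n/a + b)
    turns the sum over b into a short sum at n/a modulo p. Pairs with n/a in [large_sums] are
    estimated trivially. *)
Lemma burgess_average (p : nat) (p_pr : prime p) (p_odd : odd p)
    (B d A x : nat) (AA : {set 'I_A.+1}) : (0 < B)%N -> (A < p)%N ->
  (forall a, a \in AA -> (0 < a)%N) ->
  (d * #|AA|)%:Z * `|qchar_sum p x| <=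
    (#|AA| * x + 2 * d * #|AA| * A * B
     + d * #|[set u in finset.setX AA [set: 'I_x] | ratio_map p u \in large_sums p B
       d]|)%:Z.
Proof.
move=> B_gt0 ltAp AA_gt0; set Y := large_sums p B d.
have nza (a : 'I_A.+1) : a \in AA -> (a%:R : 'F_p) != 0.
  move=> /AA_gt0 a_gt0; rewrite -(dvdn_pcharf (pchar_Fp p_pr)) gtnNdvd //.
  by apply: leq_ltn_trans ltAp; rewrite -ltnS.
have Ea (a : 'I_A.+1) : a \in AA ->
    (d * B)%:Z * `|qchar_sum p x| <=
    (2 * d * A * B * B)%:Z + \sum_(n < x) (B + d * B * (ratio_map p (a, n) \in Y))%:Z.
  move=> AAa.
  pose g n : int := qchar (n.+1%:R : 'F_p).
  have DB : B%:Z * qchar_sum p x = \sum_(b < B) (\sum_(n < x) g n - \sum_(n < x) g (n + a *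
    b.+1)%N)
      + qchar (a%:R : 'F_p) * \sum_(n < x) short_sum B (ratio_map p (a, n)).
    rewrite sumrB sumr_const card_ord -[_ *+ B]mulr_natl natz -/(qchar_sum p x).
    rewrite exchange_big /= -[LHS]addr0 -addrA; congr (_ + _).
    apply/eqP; rewrite eq_sym addrC subr_eq0; apply/eqP.
    rewrite mulr_sumr; apply: eq_bigr => n _.
    rewrite /short_sum mulr_sumr; apply: eq_bigr => b _.
    rewrite -qcharM // /g /ratio_map mulrDr mulrC divfK ?nza //.
    by rewrite -natrM -natrD addSn.
  have le1 : `|\sum_(b < B) (\sum_(n < x) g n - \sum_(n < x) g (n + a * b.+1)%N)| <=
      (2 * A * B * B)%:Z.
    rewrite (le_trans (ler_norm_sum _ _ _)) //.
    rewrite (@le_trans _ _ (\sum_(b < B) (2 * A * B)%:Z)) ?ler_sum //.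
      move=> b _; rewrite (le_trans (sum_shift_norm _ _ _)) //.
        by move=> n; apply: qchar_norm_le1.
      by rewrite lez_nat -mulnA leq_pmul2l // leq_mul // -ltnS.
    by rewrite sumr_const card_ord -mulr_natl natz -PoszM lez_nat mulnC.
  rewrite PoszM -mulrA -[X in X * `|_|]/(`|B%:Z|) -normrM DB.
  rewrite (@le_trans _ _ (d%:Z * (`|\sum_(b < B) (\sum_(n < x) g n - \sum_(n < x) g (n + a
    * b.+1)%N)|
      + \sum_(n < x) `|short_sum B (ratio_map p (a, n))|))) //.
    rewrite ler_wpM2l // (le_trans (ler_normD _ _)) // lerD // normrM qchar_norm ?nza //
      mul1r.
    exact: ler_norm_sum.
  rewrite mulrDr lerD //.
    apply: le_trans (ler_wpM2l _ le1) _ => //; rewrite -PoszM lez_nat; lia.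
  rewrite mulr_sumr; apply: ler_sum => n _; case: (boolP (_ \in Y)) => [_|].
    rewrite muln1 PoszD ler_wpDl // PoszM ler_wpM2l //; exact: short_sum_norm.
  by rewrite inE -leNgt muln0 addn0.
have B0 : 0 < B%:Z by rewrite ltz_nat.
rewrite -(ler_pM2l B0).
have -> : B%:Z * ((d * #|AA|)%:Z * `|qchar_sum p x|) =
    \sum_(a in AA) ((d * B)%:Z * `|qchar_sum p x|).
  by rewrite sumr_const -[RHS]mulr_natl natz !PoszM; ring.
apply: le_trans (ler_sum _ Ea) _; rewrite big_split /= sumr_const -mulr_natl natz.
rewrite pair_big_dep /=.
set M := #|[set _ in _ | _]|.
have -> : \sum_(u : 'I_A.+1 * 'I_x | (u.1 \in AA) && true)
    (B + d * B * (ratio_map p (u.1, u.2) \in Y))%N%:Z = (#|AA| * x * B + d * B * M)%:Z.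
  rewrite -(big_morph Posz PoszD (erefl _)) big_split /=; congr (Posz (_ + _)).
    have cX : #|finset.setX AA [set: 'I_x]| = (#|AA| * x)%N.
      by rewrite finset.cardsX cardsT card_ord.
    rewrite sum_nat_const -cX; congr (_ * _)%N.
    by apply: eq_card => u; rewrite !inE andbT [LHS]andbT.
  rewrite -big_distrr /=; congr (_ * _)%N;
    rewrite /M -sum1_card big_mkcond [RHS]big_mkcond /=.
  apply: eq_bigr => -[a n] _.
  have -> : ((a, n) \in [set u in finset.setX AA [set: 'I_x] | ratio_map p u \in Y]) =
      (a \in AA) && (ratio_map p (a, n) \in Y) by rewrite !inE /= andbT.
  rewrite /= andbT.
  by case: (a \in AA); case: (_ \in Y).
rewrite -!PoszM -PoszD lez_nat; apply: eq_leq.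
have fin (K M' : nat) : (K * (2 * d * A * B * B) + (K * x * B + d * B * M') =
    B * (K * x + 2 * d * K * A * B + d * M'))%N by ring.
exact: fin.
Qed.

(** The multiplicative energy of AA and [1, x] modulo p. *)
Definition energy (p A x : nat) (AA : {set 'I_A.+1}) : nat :=
  #|[set w : ('I_A.+1 * 'I_x) * ('I_A.+1 * 'I_x) |
     [&& w.1 \in finset.setX AA [set: 'I_x], w.2 \in finset.setX AA [set: 'I_x]
       & ratio_map p w.1 == ratio_map p w.2]]|.

(** The factor 3 collects three errors of size x: short sums of size at most B/d, the shifts by ab,
    and the exceptional pairs, whose number Cauchy-Schwarz bounds through [energy]. *)
Lemma burgess_energy (p : nat) (p_pr : prime p) (p_odd : odd p)
    (r l B d A x : nat) (AA : {set 'I_A.+1}) :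
  (0 < B < p)%N -> (l ^ 2 <= p < l.+1 ^ 2)%N -> (8 * r + 6 <= l)%N -> (l <= B ^ r)%N ->
  (A < p)%N -> (2 * d * A * B <= x)%N -> (0 < #|AA|)%N ->
  (forall a, a \in AA -> (0 < a)%N) ->
  (d ^ 2 * (d ^ (2 * r) * (r ^ (2 * r) + 16 * r + 8) * p) * energy p x AA
     <= l * (#|AA| * x) ^ 2)%N ->
  d%:Z * `|qchar_sum p x| <= (3 * x)%:Z.
Proof.
move=> B_gt0 lp lr lB ltAp ABx AA_gt0 AA_pos leE.
have avg := @burgess_average p p_pr p_odd B d A x AA (proj1 (andP B_gt0)) ltAp AA_pos.
have CS := card_preim_sqr_le (@ratio_map p A x) (finset.setX AA [set: 'I_x]) (large_sums p
  B d).
rewrite -/(energy p x AA) in CS.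
have large := @card_large_sums p p_pr p_odd r B l d B_gt0 lp lr lB.
move: avg CS large leE; set M := #|[set _ in _ | _]|; set Y := #|large_sums p B d|.
set K := (d ^ (2 * r) * _ * p)%N; set E := energy p x AA; set L := #|AA|.
move=> avg CS large leE.
have l_gt0 : (0 < l)%N by apply: leq_trans lr; rewrite addnS.
have dM : (d * M <= L * x)%N.
  rewrite -(leq_sqr (d * M)) expnMn -(leq_pmul2l l_gt0); apply: leq_trans leE.
  rewrite mulnCA -mulnA leq_mul2l; apply/orP; right.
  apply: (@leq_trans (l * (Y * E))%N); first by rewrite leq_mul2l CS orbT.
  by rewrite mulnA leq_mul2r [(l * Y)%N]mulnC large orbT.
have dAB : (2 * d * L * A * B <= L * x)%N.
  have -> : (2 * d * L * A * B = L * (2 * d * A * B))%N by ring.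
  by rewrite leq_mul2l ABx orbT.
have L0 : 0 < L%:Z by rewrite ltz_nat.
rewrite -(ler_pM2l L0) mulrA -PoszM [(L * d)%N]mulnC; apply: le_trans avg _.
by rewrite -PoszM lez_nat; move: dM dAB; rewrite /M; lia.
Qed.

Lemma eq_ratio_map (p : nat) (p_pr : prime p) (A x : nat) (u v : 'I_A.+1 * 'I_x) :
  (A * x < p)%N -> (0 < u.1)%N -> (0 < v.1)%N -> ratio_map p u = ratio_map p v ->
  (u.2.+1 * v.1 = v.2.+1 * u.1)%N.
Proof.
move=> Axp; case: u v => [a n] [b k] /= a_gt0 b_gt0; rewrite /ratio_map /=.
have leA (c : 'I_A.+1) : (c <= A)%N by rewrite -ltnS.
have A_gt0 : (0 < A)%N by apply: leq_trans a_gt0 (leA a).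
have x_gt0 : (0 < x)%N by apply: leq_ltn_trans (ltn_ord n).
have nz (c : 'I_A.+1) : (0 < c)%N -> (c%:R : 'F_p) != 0.
  move=> c_gt0; rewrite -(dvdn_pcharf (pchar_Fp p_pr)) gtnNdvd //.
  by apply: leq_ltn_trans Axp; apply: leq_trans (leA c) _; rewrite leq_pmulr.
move=> /eqP; rewrite eqr_div ?nz // -!natrM => /eqP/(congr1 val) /=.
rewrite !val_Fp_nat // !modn_small //; apply: leq_ltn_trans Axp;
  rewrite [leqRHS]mulnC leq_mul //.
Qed.

(** Since A x < p, a coincidence n/a = k/b modulo p is an equality nb = ka of integers. If a = b
    then n = k; distinct primes a and b force n = ta and k = tb with t <= x/A1. *)
Lemma energy_primes (p : nat) (p_pr : prime p) (A A1 x : nat) (AA : {set 'I_A.+1}) :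
  (A * x < p)%N -> (0 < A1)%N ->
  (forall a, a \in AA -> prime a && (A1 <= a)%N) ->
  (energy p x AA <= #|AA| * x + #|AA| ^ 2 * (x %/ A1).+1)%N.
Proof.
move=> Axp A1_gt0 AAP; rewrite /energy; set W := finset _.
pose diag := [set w : ('I_A.+1 * 'I_x) * ('I_A.+1 * 'I_x) | w.1.1 == w.2.1].
have WP w : w \in W -> [/\ w.1.1 \in AA, w.2.1 \in AA
   & (w.1.2.+1 * w.2.1 = w.2.2.+1 * w.1.1)%N].
  case: w => [[a n] [b k]]; rewrite !inE !andbT /= => /and3P[aA bA /eqP E].
  split=> //; apply: (eq_ratio_map p_pr Axp _ _ E) => /=;
    by apply: prime_gt0; case/andP: (AAP _ aA); case/andP: (AAP _ bA).
rewrite -(finset.cardsID diag W); apply: leq_add.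
  have <- : #|finset.setX AA [set: 'I_x]| = (#|AA| * x)%N.
    by rewrite finset.cardsX cardsT card_ord.
  have inj_fst : {in W :&: diag &, injective fst}%SET.
    move=> [[a n] [b k]] [[a' n'] [b' k']] /setIP[/WP /= [aA _ E1]].
    rewrite inE /= => /eqP ab /setIP[/WP /= [_ _ E2]]; rewrite inE /= => /eqP ab' [ea en].
    have a_gt0 : (0 < a)%N by apply: prime_gt0; case/andP: (AAP _ aA).
    subst b b' a' n'; congr (_, (_, _)); apply: val_inj => /=.
    by move/eqP: E1; move/eqP: E2; rewrite !eqn_pmul2r // => /eqP [<-] /eqP [<-].
  rewrite -(card_in_imset inj_fst); apply: subset_leq_card.
  by apply/fintype.subsetP => _ /imsetP[w /setIP[/WP[aA _ _] _] ->]; rewrite !inE aA.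
pose f (w : ('I_A.+1 * 'I_x) * ('I_A.+1 * 'I_x)) : 'I_A.+1 * 'I_A.+1 * 'I_(x %/ A1).+1 :=
  (w.1.1, w.2.1, inord (w.1.2.+1 %/ w.1.1)).
have <- : #|finset.setX (finset.setX AA AA) [set: 'I_(x %/ A1).+1]| =
    (#|AA| ^ 2 * (x %/ A1).+1)%N.
  by rewrite !finset.cardsX cardsT card_ord expnS expn1.
have WD w : w \in (W :\: diag)%SET ->
   exists t, [/\ w.1.2.+1 = t * w.1.1, w.2.2.+1 = t * w.2.1 & t <= x %/ A1]%N.
  case: w => [[a n] [b k]] /setDP[/WP /= [aA bA E]]; rewrite inE /= => neq_ab.
  have /andP[a_pr leA1a] := AAP _ aA; have /andP[b_pr _] := AAP _ bA.
  have : (a %| n.+1 * b)%N by rewrite E dvdn_mull.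
  rewrite Euclid_dvdM // => /orP[/dvdnP[t Dt]|]; last first.
    by rewrite (dvdn_prime2 a_pr b_pr) val_eqE (negPf neq_ab).
  exists t; split=> //.
    move/eqP: E; rewrite Dt mulnAC [X in _ == X]mulnC.
    by rewrite [X in X == _]mulnC eqn_pmul2l ?prime_gt0 // eq_sym => /eqP.
  rewrite leq_divRL //; apply: leq_trans (ltn_ord n); rewrite Dt.
  by rewrite leq_mul2l leA1a orbT.
have inj_f : {in (W :\: diag)%SET &, injective f}.
  move=> w w' Dw Dw'; have [t [E1 E2 let_]] := WD _ Dw;
    have [t' [E1' E2' let'_]] := WD _ Dw'.
  move: Dw Dw' => /setDP[/WP [aA bA _] _] /setDP[/WP [aA' bA' _] _].
  case: w w' E1 E2 E1' E2' aA bA aA' bA' => [[a n] [b k]] [[a' n'] [b' k']] /=.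
  rewrite /f /= => E1 E2 E1' E2' aA bA _ _ [ea eb]; subst a' b'.
  have a_gt0 : (0 < a)%N by apply: prime_gt0; case/andP: (AAP _ aA).
  rewrite E1 E1' !mulnK // => /(congr1 val); rewrite /= !inordK ?ltnS // => ett.
  subst t'; congr (_, _, (_, _)); apply: val_inj; apply: succn_inj.
    by rewrite [LHS]E1 E1'.
  by rewrite [LHS]E2 E2'.
rewrite -(card_in_imset inj_f); apply: subset_leq_card.
apply/fintype.subsetP => _ /imsetP[w /setDP[/WP[aA bA _] _] ->].
by rewrite !inE aA bA.
Qed.

(** The multiplier set {1} serves when x is a large multiple of sqrt p, where longer ranges of
    multipliers could violate A x < p. *)
Lemma energy_one (p : nat) (p_pr : prime p) (x : nat) : (x <= p)%N ->
  (energy p x [set ord_max : 'I_2] <= x)%N.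
Proof.
move=> lexp; rewrite /energy; set W := finset _.
have inj_f : {in W &, injective (fun w : ('I_2 * 'I_x) * ('I_2 * 'I_x) => w.1.2)}.
  have WP w : w \in W -> w = ((ord_max, w.1.2), (ord_max, w.1.2)).
    case: w => [[a n] [b k]]; rewrite !inE !andbT /= => /and3P[/eqP -> /eqP -> /eqP].
    rewrite /ratio_map /= !divr1 => /(congr1 val) /=; rewrite !val_Fp_nat // => E.
    congr (_, (_, _)); apply: val_inj => /=.
    have [nn kk] : (n < p /\ k < p)%N by split; apply: leq_trans lexp.
    have : (n == k %[mod p])%N by rewrite -(eqn_modDr 1) !addn1 E.
    by rewrite !modn_small // => /eqP.
  by move=> w w' /WP -> /WP -> /= ->.
rewrite -(card_in_imset inj_f) -[leqRHS](card_ord x); exact: max_card.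
Qed.

(** * The Legendre symbol *)

(** The unit group is cyclic: if z = g^k and z^(p./2) = 1, then p - 1 = 2 (p./2) divides k (p./2),
    so k is even. *)
Lemma exp_half_sqr (p : nat) (p_pr : prime p) (p_odd : odd p) (z : 'F_p) :
  z != 0 -> z ^+ p./2 = 1 -> exists x : 'F_p, x ^+ 2 = z.
Proof.
move=> nz zP1.
have /cyclicP[g Dg] := field_unit_group_cyclic [group of [set: {unit 'F_p}]].
have uz : z \is a GRing.unit by rewrite unitfE.
have : FinRing.unit 'F_p uz \in cycle g by rewrite -Dg inE.
case/cycleP => k Dk; have ord_g : order g = p.-1.
  by rewrite /order -Dg card_finField_unit card_Fp.
have zE : z = (val g) ^+ k by have /(congr1 val) := Dk; rewrite FinRing.val_unitX.
have : (g ^+ (k * p./2))%g == 1%g.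
  by rewrite -val_eqE /= FinRing.val_unitX exprM -zE zP1.
rewrite -order_dvdn ord_g.
have pE : p.-1 = (2 * p./2)%N by rewrite -[in LHS](odd_double_half p) p_odd add1n mul2n.
have P_gt0 : (0 < p./2)%N by have := odd_prime_gt2 p_odd p_pr; lia.
rewrite pE dvdn_pmul2r // => /dvdnP[j Dj].
by exists (val g ^+ j); rewrite -exprM -Dj -zE.
Qed.

Lemma legendreE (p : nat) (p_pr : prime p) (p_odd : odd p) (n : nat) :
  legendre p n = qchar (n%:R : 'F_p).
Proof.
rewrite /legendre /qchar -(dvdn_pcharf (pchar_Fp p_pr)); case: ifP => // /negbT pNn.
have nz : (n%:R : 'F_p) != 0 by rewrite -(dvdn_pcharf (pchar_Fp p_pr)).
have natE (a b : nat) : (a == b %[mod p])%N = ((a%:R : 'F_p) == b%:R).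
  by rewrite -val_eqE /= !val_Fp_nat.
congr (if _ then _ else _); apply/existsP/eqP => [[x]|].
  rewrite natE natrX => /eqP xE; rewrite -xE in nz *.
  have nzx : (x%:R : 'F_p) != 0 by move: nz; rewrite expf_eq0.
  rewrite -exprM; apply: (mulfI nzx); rewrite mulr1 -exprS -[RHS](expFp p_pr).
  by congr (_ ^+ _); rewrite mul2n -[RHS](odd_double_half p) p_odd.
move=> /(exp_half_sqr p_pr p_odd nz)[x xE].
have ltxp : (x < p)%N by have := ltn_ord x; rewrite [X in (_ < X)%N]Fp_cast.
by exists (Ordinal ltxp); rewrite natE natrX -xE /= natr_Zp.
Qed.

Lemma legendre_sumE (R : realType) (p : nat) (p_pr : prime p) (p_odd : odd p) (n : nat) :
  legendre_sum p (n%:R : R) = qchar_sum p n.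
Proof.
rewrite /legendre_sum /qchar_sum natrK big_add1 /= big_mkord.
by apply: eq_bigr => i _; rewrite legendreE.
Qed.

(** * Chebyshev and Mertens estimates *)

Lemma ln_sub_le (R : realType) (a b : R) : 0 < a -> 0 < b -> ln a - ln b <= (a - b) / b.
Proof.
move=> a_gt0 b_gt0; rewrite -ln_div ?posrE //.
have -> : a / b = 1 + (a - b) / b by rewrite mulrBl divff ?gt_eqF // addrC subrK.
by apply: le_ln1Dx; rewrite mulrBl divff ?gt_eqF // ltrBrDr addNr divr_gt0.
Qed.

Lemma ler_ln_nat (R : realType) (m n : nat) : (m <= n)%N -> ln (m%:R : R) <= ln n%:R.
Proof.
case: m => [|m] le_mn;
  last by rewrite ler_ln ?posrE ?ltr0n ?ler_nat // (leq_ltn_trans _ le_mn).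
case: n {le_mn} => [|n]; first by [].
by rewrite (@le_trans _ _ 0) ?ln_le0 ?ln_ge0 ?ler01 ?ler1n.
Qed.

Lemma ln_nat_ge0 (R : realType) (n : nat) : 0 <= ln (n%:R : R).
Proof. by have := ler_ln_nat R (leq0n n); rewrite ln0. Qed.

Lemma ln_fact_bounds (R : realType) (n : nat) :
  n%:R * ln (n%:R : R) - n%:R <= ln (n`!)%:R <= n%:R * ln (n%:R : R).
Proof.
have step (k : nat) : ln (k.+1`!)%:R = ln k.+1%:R + ln (k`!)%:R :> R.
  by rewrite factS natrM lnM // posrE ltr0n // fact_gt0.
elim: n => [|n /andP[IH1 IH2]]; first by rewrite fact0 ln1 !mul0r subr0 lexx.
rewrite step -natr1.
case: n IH1 IH2 => [|n] IH1 IH2; first by rewrite fact0 ln1 add0r ln1; lra.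
have := @ln_sub_le R n.+2%:R n.+1%:R (ltr0Sn _ _) (ltr0Sn _ _).
have := @ler_ln_nat R n.+1 n.+2 (leqnSn _).
have -> : n.+2%:R - n.+1%:R = 1 :> R by rewrite -[n.+2%:R]natr1 addrAC subrr add0r.
rewrite ler_pdivlMr ?ltr0Sn // natr1.
set a := ln n.+1%:R; set b := ln n.+2%:R; set c : R := n.+1%:R.
have : 0 <= c by rewrite ler0n.
move: IH1 IH2; rewrite -/a -/c; move: (ln (n.+1)`!%:R) => F.
nra.
Qed.

Lemma big_nat_vanish (R : nmodType) (F : nat -> R) (a b : nat) :
  (a <= b)%N -> (forall q, (a <= q)%N -> F q = 0) ->
  \sum_(0 <= q < b) F q = \sum_(0 <= q < a) F q.
Proof.
move=> leab F0; rewrite (@big_cat_nat _ _ _ a) //= [X in _ + X](_ : _ = 0) ?addr0 //.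
by rewrite big_nat_cond big1 // => q /andP[/andP[leaq _] _]; apply: F0.
Qed.

Lemma ln_prod_gt0 (R : realType) (I : Type) (s : seq I) (F : I -> R) :
  (forall i, 0 < F i) -> ln (\prod_(i <- s) F i) = \sum_(i <- s) ln (F i).
Proof.
move=> F_gt0; elim: s => [|i s IHs]; first by rewrite !big_nil ln1.
by rewrite !big_cons lnM ?posrE ?IHs // prodr_gt0.
Qed.

Lemma ln_prime_decomp (R : realType) (m x : nat) : (0 < m)%N ->
  (forall q, prime q -> (q %| m)%N -> (q <= x)%N) ->
  ln (m%:R : R) = \sum_(1 <= q < x.+1 | prime q) (logn q m)%:R * ln q%:R.
Proof.
move=> m_gt0 lex; pose F q : R := (logn q m)%:R * ln q%:R.
have F0 q : ~~ (prime q && (q %| m)%N) -> F q = 0.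
  by rewrite /F lognE m_gt0 /= => /negPf->; rewrite mul0r.
have -> : ln (m%:R : R) = \sum_(0 <= q < m.+1) F q.
  rewrite -{1}(partnT m_gt0) /partn natr_prod ln_prod_gt0 => [|q]; last first.
    by rewrite ltr0n pfactor_gt0.
  apply: eq_bigr => q _; rewrite /F; have [->|q_gt0] := posnP q.
    by rewrite lognE /= mul0r ln1.
  by rewrite natrX lnXn ?ltr0n // mulr_natl.
rewrite -(@big_nat_vanish _ F m.+1 (maxn m x).+1) ?ltnS ?leq_maxl //; last first.
  by move=> q ltq; apply: F0; apply/nandP; right; rewrite gtnNdvd.
rewrite (@big_nat_vanish _ F x.+1 (maxn m x).+1) ?ltnS ?leq_maxr //; last first.
  move=> q ltq; apply: F0; apply/negP => /andP[qp /(lex _ qp)].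
  by rewrite leqNgt ltq.
rewrite big_ltn // F0 // add0r [RHS]big_mkcond; apply: eq_bigr => q _.
by case: ifP => // /negbT qNp; rewrite F0 // (negPf qNp).
Qed.

Lemma ln_fact_primes (R : realType) (x : nat) :
  ln (x`!)%:R = \sum_(1 <= q < x.+1 | prime q)
    (\sum_(1 <= k < x.+1) x %/ q ^ k)%:R * ln q%:R :> R.
Proof.
rewrite (@ln_prime_decomp _ _ x) ?fact_gt0 // => [|q q_pr]; last first.
  have : {in [pred n | (0 < n)%N], forall n, (q %| n)%N -> (q <= n)%N} by move=> n /=;
    apply: dvdn_leq.
  move=> le_q; elim: x => [|x IHx]; first by rewrite fact0 Euclid_dvd1.
  rewrite factS Euclid_dvdM // => /orP[/le_q|/IHx le_qx]; first by apply.
  exact: leq_trans le_qx _.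
by apply: eq_bigr => q q_pr; rewrite logn_fact.
Qed.

(** The part of Legendre's formula for log x! that comes from first powers of primes. *)
Definition floor_prime_sum (R : realType) (x : nat) : R :=
  \sum_(1 <= q < x.+1 | prime q) (x %/ q)%:R * ln q%:R.

Lemma sum_geometric_le (R : realType) (q n : nat) : (1 < q)%N ->
  \sum_(2 <= k < n) (q%:R ^- k : R) <= (q%:R * (q%:R - 1))^-1.
Proof.
move=> q_gt1; have q0 : 0 < q%:R :> R by rewrite ltr0n ltnW.
have q1 : 0 < q%:R - 1 :> R by rewrite subr_gt0 ltr1n.
case: n => [|[|n]]; try by rewrite big_geq // invr_ge0 mulr_ge0 ?ltW.
suff -> : \sum_(2 <= k < n.+2) (q%:R ^- k : R) =
    (q%:R * (q%:R - 1))^-1 * (1 - q%:R ^- n).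
  by rewrite ger_pMr ?invr_gt0 ?mulr_gt0 // gerBl invr_ge0 exprn_ge0 // ltW.
elim: n => [|n IHn]; first by rewrite big_geq // expr0 invr1 subrr mulr0.
rewrite big_nat_recr //= IHn !exprS.
have qn : 0 < q%:R ^+ n :> R by rewrite exprn_gt0.
by field; rewrite !gt_eqF.
Qed.

(** Telescopes against (ln n + 2)/n, whose value at 1 is the bound 2. *)
Lemma sum_ln_quadratic (R : realType) (x : nat) :
  \sum_(2 <= n < x) ln (n%:R : R) / (n%:R * (n%:R - 1)) <= 2.
Proof.
pose a n : R := (ln n%:R + 2) / n%:R.
have a_ge0 n : 0 <= a n by rewrite divr_ge0 ?addr_ge0 ?ln_nat_ge0.
case: x => [|[|x]]; try by rewrite big_geq.
suff le_a : \sum_(2 <= n < x.+2) ln (n%:R : R) / (n%:R * (n%:R - 1)) <= 2 - a x.+1.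
  by apply: le_trans le_a _; rewrite gerBl.
elim: x => [|x IHx]; first by rewrite big_geq // /a ln1 add0r divr1 subrr.
rewrite big_nat_recr //=; apply: le_trans (lerD IHx (lexx _)) _.
rewrite -addrA lerD2l /a.
have := @ln_sub_le R x.+2%:R x.+1%:R (ltr0Sn _ _) (ltr0Sn _ _).
have -> : x.+2%:R - x.+1%:R = 1 :> R by rewrite -[x.+2%:R]natr1 addrAC subrr add0r.
move=> le1.
set u := ln x.+1%:R in le1 *; set v := ln x.+2%:R in le1 *.
have c0 : 0 < x.+1%:R :> R by rewrite ltr0n.
rewrite -[x.+2%:R]natr1 addrK; set c : R := x.+1%:R in c0 le1 *.
rewrite -subr_ge0.
have -> : - ((v + 2) / (c + 1)) - (- ((u + 2) / c) + v / ((c + 1) * c)) =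
    (2 - (c + 1) * (v - u)) / ((c + 1) * c).
  by field; rewrite !gt_eqF // addr_gt0.
apply: divr_ge0; last by rewrite mulr_ge0 ?addr_ge0 ?ltW.
rewrite subr_ge0.
apply: le_trans (ler_wpM2l _ le1) _; first by rewrite addr_ge0 // ltW.
have : 1 <= c by rewrite /c ler1n.
by move=> c1; rewrite div1r ler_pdivrMr //; lra.
Qed.

(** The higher powers of q contribute at most x ln q / (q (q - 1)), in total at most 2x. *)
Lemma floor_prime_sum_bounds (R : realType) (x : nat) :
  ln (x`!)%:R - 2 * x%:R <= floor_prime_sum R x <= ln (x`!)%:R.
Proof.
have lnn (q : nat) : 0 <= ln (q%:R : R) by apply: ln_nat_ge0.
case: x => [|x]; first by rewrite /floor_prime_sum fact0 ln1 mulr0 big_geq // subrr lexx.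
rewrite ln_fact_primes /floor_prime_sum; apply/andP; split; last first.
  apply: ler_sum => q _; rewrite ler_wpM2r // ler_nat big_ltn // expn1; exact: leq_addr.
rewrite lerBlDr -lerBlDl -sumrB.
apply: (@le_trans _ _ (x.+1%:R * \sum_(2 <= q < x.+2) ln (q%:R : R) / (q%:R * (q%:R - 1)))).
  rewrite big_ltn_cond // mulr_sumr [leLHS]big_mkcond;
    apply: ler_sum_nat => q /andP[q_ge2 _].
  have q0 : 0 < q%:R :> R by rewrite ltr0n (leq_trans _ q_ge2).
  have q1 : 0 < q%:R - 1 :> R by rewrite subr_gt0 ltr1n.
  case: ifP => _; last by rewrite mulr_ge0 // divr_ge0 // mulr_ge0 // ltW.
  rewrite -mulrBl big_ltn // expn1 natrD addrAC subrr add0r mulrA [x.+1%:R * _]mulrC -mulrA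
    mulrC.
  rewrite ler_wpM2l //;
    apply: le_trans (ler_wpM2l _ (@sum_geometric_le R q x.+2 q_ge2)) => //.
  rewrite mulr_sumr natr_sum; apply: ler_sum => k _.
  rewrite -natrX ler_pdivlMr; last by rewrite ltr0n expn_gt0 (leq_trans _ q_ge2).
  by rewrite -natrM ler_nat leq_divM.
by rewrite [leRHS]mulrC ler_wpM2l // sum_ln_quadratic.
Qed.

Definition theta (R : realType) (x : nat) : R := \sum_(1 <= q < x.+1 | prime q) ln q%:R.

(** Chebyshev's argument: with h = floor(x/2), the integer floor(x/q) - 2 floor(h/q) is nonnegative,
    and at least 1 when h < q <= x. *)
Lemma theta_half (R : realType) (x : nat) :
  theta R x - theta R (x %/ 2) <= floor_prime_sum R x - 2 * floor_prime_sum R (x %/ 2).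
Proof.
set h := (x %/ 2)%N; have lehx : (h <= x)%N by apply: leq_div.
have ext (F : nat -> R) : (forall q, (h < q)%N -> F q = 0) ->
    \sum_(1 <= q < h.+1 | prime q) F q = \sum_(1 <= q < x.+1 | prime q) F q.
  move=> F0; rewrite [RHS](@big_cat_nat _ _ _ h.+1) //= [X in _ = _ + X](_ : _ = 0) ?addr0
    //.
  by rewrite big_nat_cond big1 // => q /andP[/andP[lehq _] _]; apply: F0.
have -> : theta R h = \sum_(1 <= q < x.+1 | prime q) (if (q <= h)%N then ln q%:R else 0).
  rewrite -ext => [|q]; last by rewrite ltnNge => /negPf->.
  by rewrite /theta big_nat_cond [RHS]big_nat_cond;
    apply: eq_bigr => q /andP[/andP[_ ltqh] _]; rewrite -ltnS ltqh.
rewrite /floor_prime_sum ext => [|q ltq]; last by rewrite divn_small // mul0r.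
rewrite mulr_sumr -!sumrB big_nat_cond [leRHS]big_nat_cond; apply: ler_sum => q.
move=> /andP[/andP[q_gt0 ltqx] _].
have le_floor : (2 * (h %/ q) + ~~ (q <= h) <= x %/ q)%N.
  have [leqh|lthq] := leqP q h; last by rewrite /= divn_small // leq_divRL // mul1n -ltnS.
  rewrite addn0 leq_divRL // -mulnA; apply: leq_trans (leq_divM x 2).
  by rewrite mulnC leq_mul2r /= leq_divM.
have : (2 * (h %/ q) + ~~ (q <= h))%N%:R <= (x %/ q)%:R :> R by rewrite ler_nat.
rewrite natrD natrM => {}le_floor; have lnq := ln_nat_ge0 R q.
move: le_floor; case: (q <= h)%N => /= le_floor; nra.
Qed.

(** With h = floor(x/2), the error terms at h cost 6h <= 3x and x ln x - 2h ln h is at most 3x. An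
    inductive constant c thus needs c/2 + 3 + 3 <= c, and 12 is the least one. *)
Lemma theta_le (R : realType) (x : nat) : theta R x <= 12 * x%:R.
Proof.
elim/ltn_ind: x => x IH; have [lex1|lt1x] := leqP x 1.
  rewrite /theta big_nat_cond big1 ?mulr_ge0 // => q /andP[/andP[_ leqx] /prime_gt1 q1].
  by move: leqx; rewrite ltnS leqNgt (leq_ltn_trans lex1 q1).
have := IH (x %/ 2)%N (ltn_Pdiv (isT : 1 < 2)%N (ltnW lt1x)).
have := theta_half R x.
have /andP[_] := floor_prime_sum_bounds R x.
have /andP[+ _] := floor_prime_sum_bounds R (x %/ 2).
have /andP[_] := ln_fact_bounds R x.
have /andP[+ _] := ln_fact_bounds R (x %/ 2).
have hx : (2 * (x %/ 2) <= x <= 2 * (x %/ 2) + 1)%N by lia.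
have h_gt0 : (0 < x %/ 2)%N by rewrite divn_gt0.
have ln_sub := @ln_sub_le R x%:R (x %/ 2)%:R.
rewrite !ltr0n h_gt0 (ltnW lt1x) in ln_sub; move: (ln_sub isT isT) => {}ln_sub.
have /ln_sublinear ln_h : 0 < (x %/ 2)%:R :> R by rewrite ltr0n.
have lnh0 := ln_nat_ge0 R (x %/ 2).
move: (theta R x) (theta R (x %/ 2)) (floor_prime_sum R x) (floor_prime_sum R (x %/ 2)).
move: (x %/ 2)%N h_gt0 hx ln_sub ln_h lnh0 => h h_gt0 /andP[hx1 hx2] ln_sub ln_h lnh0.
move: (ln (x`!)%:R) (ln (h`!)%:R) => T1 T2 t1 t2 U1 U2.
have {}hx1 : 2 * h%:R <= x%:R :> R by rewrite -natrM ler_nat.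
have {}hx2 : x%:R <= 2 * h%:R + 1 :> R by rewrite -natrM natr1 ler_nat -addn1.
have h1 : 1 <= h%:R :> R by rewrite ler1n.
have h0 : 0 < h%:R :> R by rewrite ltr0n.
rewrite ler_pdivlMr // in ln_sub.
move: (ln x%:R) (ln h%:R) ln_sub ln_h lnh0 => a b ln_sub ln_h lnh0 H1 H2 H3 H4 H5 H6.
have ab : a - b <= 2 by nra.
have xab : x%:R * (a - b) <= 2 * x%:R :> R by nra.
have xb : (x%:R - 2 * h%:R) * b <= x%:R :> R by nra.
nra.
Qed.

Definition mertens_sum (R : realType) (x : nat) : R :=
  \sum_(1 <= q < x.+1 | prime q) ln q%:R / q%:R.

(** Compares x/q with its integer part. The 3 is 1 from log x! and 2 from the prime powers; the 12
    is the constant of [theta_le]. *)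
Lemma mertens_bounds (R : realType) (x : nat) : (0 < x)%N ->
  ln x%:R - 3 <= mertens_sum R x <= ln x%:R + 12.
Proof.
move=> x_gt0; have x0 : 0 < x%:R :> R by rewrite ltr0n.
have /andP[T1 T2] := ln_fact_bounds R x.
have /andP[U1 U2] := floor_prime_sum_bounds R x.
have th := theta_le R x.
have le1 : floor_prime_sum R x <= x%:R * mertens_sum R x.
  rewrite mulr_sumr; apply: ler_sum => q q_pr.
  rewrite [leRHS]mulrCA [leRHS]mulrC ler_wpM2r ?ln_nat_ge0 // ler_pdivlMr ?ltr0n ?prime_gt0
    //.
  by rewrite -natrM ler_nat leq_divM.
have le2 : x%:R * mertens_sum R x <= floor_prime_sum R x + theta R x.
  rewrite mulr_sumr -big_split; apply: ler_sum => q q_pr /=.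
  rewrite [leLHS]mulrCA [leLHS]mulrC -[X in _ + X]mul1r -mulrDl.
  rewrite ler_wpM2r ?ln_nat_ge0 // ler_pdivrMr ?ltr0n ?prime_gt0 //.
  by rewrite natr1 -natrM ler_nat ltnW // ltn_ceil // prime_gt0.
apply/andP; split; rewrite -(ler_pM2l x0); nra.
Qed.

Lemma mertens_interval (R : realType) (a b : nat) : (0 < a <= b)%N ->
  ln b%:R - ln a%:R - 15 <= \sum_(a.+1 <= q < b.+1 | prime q) (ln q%:R / q%:R : R)
    <= ln b%:R - ln a%:R + 15.
Proof.
move=> /andP[a_gt0 leab].
have /andP[A1 A2] := @mertens_bounds R a a_gt0.
have /andP[B1 B2] := @mertens_bounds R b (leq_trans a_gt0 leab).
have DB : mertens_sum R b = mertens_sum R a + \sum_(a.+1 <= q < b.+1 | prime q) ln q%:R /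
  q%:R.
  by rewrite /mertens_sum (@big_cat_nat _ _ _ a.+1).
by apply/andP; split; lra.
Qed.

Lemma mertens_reciprocal (R : realType) (N x : nat) : (1 < N <= x)%N ->
  \sum_(N.+1 <= q < x.+1 | prime q) (q%:R^-1 : R) <=
    ln (ln x%:R) - ln (ln N%:R) + 15 / ln N%:R.
Proof.
move=> /andP[N_gt1 leNx]; pose E n : R := mertens_sum R n - ln n%:R.
have E_bd n : (0 < n)%N -> - 3 <= E n <= 12.
  by move=> /(@mertens_bounds R)/andP[]; rewrite /E => ? ?; apply/andP; split; lra.
(* Abel summation as an induction on x: the boundary term carries the error E of Mertens' sum,
   shifted by 12 to be nonpositive. At x = N the claim holds because E N >= -3. *)
suff : \sum_(N.+1 <= q < x.+1 | prime q) (q%:R^-1 : R) <=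
    ln (ln x%:R) - ln (ln N%:R) + 15 / ln N%:R + (E x - 12) / ln x%:R.
  have : (E x - 12) / ln x%:R <= 0; last by lra.
  rewrite pmulr_lle0 ?invr_gt0 ?ln_gt0 ?ltr1n ?(leq_trans N_gt1) //.
  by have /andP[_] := E_bd x (ltnW (leq_trans N_gt1 leNx)); rewrite subr_le0.
elim: x leNx => [|x IHx]; first by rewrite leqNgt (ltnW N_gt1).
rewrite leq_eqVlt => /predU1P[<-|]; last rewrite ltnS => leNx.
  have lnN : 0 < ln N%:R :> R by rewrite ln_gt0 // ltr1n.
  rewrite big_geq // subrr add0r -mulrDl divr_ge0 ?(ltW lnN) //.
  by have /andP[EN _] := E_bd N (ltnW N_gt1); lra.
rewrite big_mkcond big_nat_recr ?ltnS //= -big_mkcond /=; move: (IHx leNx) => {IHx}.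
set S := \sum_(_ <= _ < _ | _) _ => IHx.
have x_gt1 : (1 < x)%N := leq_trans N_gt1 leNx.
have [lx lx1] : 0 < ln x%:R :> R /\ 0 < ln x.+1%:R :> R.
  by split; rewrite ln_gt0 // ltr1n // ltnW.
have -> : (if prime x.+1 then x.+1%:R^-1 else 0) =
    (E x.+1 - E x + (ln x.+1%:R - ln x%:R)) / ln x.+1%:R :> R.
  have -> : E x.+1 - E x + (ln x.+1%:R - ln x%:R) = mertens_sum R x.+1 - mertens_sum R x.
    by rewrite /E; lra.
  rewrite /mertens_sum [X in X - _]big_mkcond big_nat_recr //= -big_mkcond /= addrAC subrr
    add0r.
  by case: ifP => _; rewrite ?mul0r // mulrAC divff ?gt_eqF // mul1r.
have lnln : (ln x.+1%:R - ln x%:R) / ln x.+1%:R <= ln (ln x.+1%:R) - ln (ln x%:R) :> R.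
  by have := ln_sub_le lx lx1; rewrite -[_ - ln x.+1%:R]opprB mulNr; lra.
have Ex : (E x - 12) / ln x%:R <= (E x - 12) / ln x.+1%:R.
  have /andP[_ E12] := E_bd x (ltnW x_gt1).
  rewrite -subr_le0 -mulrBr mulr_le0_ge0 ?subr_le0 // subr_ge0.
  by rewrite lef_pV2 ?posrE // ler_ln_nat.
rewrite (_ : (_ + _) / _ = (E x.+1 - 12) / ln x.+1%:R - (E x - 12) / ln x.+1%:R
  + (ln x.+1%:R - ln x%:R) / ln x.+1%:R).
  by move: IHx lnln Ex; lra.
by rewrite -mulrBl -mulrDl; congr (_ / _); lra.
Qed.

(** As 16 = 15 + 1, the interval has Mertens mass at least 1, and each prime in it contributes at
    most ln A / A1. *)
Lemma card_primes_interval (R : realType) (A1 A : nat) : (0 < A1 <= A)%N ->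
  16 <= ln A%:R - ln A1%:R :> R ->
  A1%:R <= (\sum_(A1.+1 <= q < A.+1 | prime q) 1)%N%:R * ln A%:R :> R.
Proof.
move=> A1A ln16; have /andP[+ _] := mertens_interval R A1A.
move: A1A => /andP[A1_gt0 leA].
have A10 : 0 < A1%:R :> R by rewrite ltr0n.
set S := \sum_(_ <= _ < _ | _) _ => S_ge.
have {S_ge} : 1 <= S by lra.
have : A1%:R * S <= (\sum_(A1.+1 <= q < A.+1 | prime q) 1)%N%:R * ln A%:R; last by nra.
rewrite natr_sum mulr_suml mulr_sumr big_nat_cond [leRHS]big_nat_cond.
apply: ler_sum => q /andP[/andP[ltA1q leqA] _]; rewrite mul1r mulrCA.
apply: (@le_trans _ _ (ln q%:R)); last by rewrite ler_ln_nat.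
rewrite ler_piMr ?ln_nat_ge0 //.
  by rewrite ler_pdivrMr ?ltr0n ?(leq_ltn_trans _ ltA1q) // mul1r ler_nat ltnW.
Qed.

(** * Mean values of completely multiplicative signs *)

Lemma sum_multiples (R : nmodType) (G : nat -> R) (q N : nat) : (0 < q)%N ->
  \sum_(1 <= n < N.+1 | (q %| n)%N) G n = \sum_(1 <= m < (N %/ q).+1) G (q * m)%N.
Proof.
move=> q_gt0; elim: N => [|N IHN]; first by rewrite div0n !big_geq.
rewrite big_mkcond big_nat_recr //= -big_mkcond /= IHN divnS //.
case: ifP => [qN|_] /=; last by rewrite addr0 add0n.
have E : (q * (N %/ q).+1 = N.+1)%N.
  by rewrite mulnC -[(_ %/ q).+1]add1n; have := divnS N q_gt0; rewrite qN => <-;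
    rewrite divnK.
by rewrite add1n [RHS]big_nat_recr //= E.
Qed.

Section Deficiency.
Variables (R : realType) (f : nat -> R) (X : nat).
Hypothesis fM : forall m n, (0 < m)%N -> (0 < n)%N -> f (m * n)%N = f m * f n.
Hypothesis f1 : forall n, (0 < n <= X)%N -> f n = 1 \/ f n = -1.

Definition deficiency (tau : R) (n : nat) : R := \sum_(1 <= m < n.+1) (1 - tau * f m).

Definition is_sign (tau : R) := tau = 1 \/ tau = -1.

Lemma is_signM s t : is_sign s -> is_sign t -> is_sign (s * t).
Proof. by case=> ->; case=> ->; rewrite ?mulrNN ?mulrN ?mulr1; [left|right|right|left]. Qed.

Lemma is_sign_sqr s : is_sign s -> s * s = 1.
Proof. by case=> ->; rewrite ?mulrNN mulr1. Qed.

Lemma is_signN s : is_sign s -> is_sign (- s).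
Proof. by case=> ->; rewrite ?opprK; [right|left]. Qed.

Lemma deficiency_term tau n : is_sign tau -> (0 < n <= X)%N -> 0 <= 1 - tau * f n <= 2.
Proof. by move=> [] -> /f1 [] ->; lra. Qed.

Lemma deficiency_mono tau m n : is_sign tau -> (m <= n <= X)%N ->
  deficiency tau m <= deficiency tau n.
Proof.
move=> st /andP[lemn lenX]; rewrite /deficiency [leRHS](@big_cat_nat _ _ _ m.+1) //=.
rewrite lerDl big_nat_cond sumr_ge0 // => k /andP[/andP[ltmk ltkn] _].
have /(deficiency_term st)/andP[] // : (0 < k <= X)%N.
by rewrite (leq_ltn_trans _ ltmk) //= (leq_trans _ lenX) // -ltnS.
Qed.

Lemma deficiency_ge0 tau n : is_sign tau -> (n <= X)%N -> 0 <= deficiency tau n.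
Proof.
by move=> st lenX; rewrite -[leLHS](_ : deficiency tau 0 = 0) ?deficiency_mono //
  /deficiency big_geq.
Qed.

Lemma deficiencyN tau n : deficiency (- tau) n = 2 * n%:R - deficiency tau n.
Proof.
rewrite /deficiency; apply/eqP; rewrite eq_sym subr_eq -big_split /=; apply/eqP.
rewrite (eq_bigr (fun=> 2)) => [|k _]; last by lra.
by rewrite big_const_nat iter_addr_0 subn1 mulr_natr.
Qed.

Lemma deficiency_le tau n : is_sign tau -> (n <= X)%N -> deficiency tau n <= 2 * n%:R.
Proof.
by move=> st lenX; have := @deficiency_ge0 (- tau) n (is_signN st) lenX;
  rewrite deficiencyN subr_ge0.
Qed.

(** For 0 < n <= N this is the logarithm of the radical of n. *)
Definition rad_ln (N n : nat) : R := \sum_(1 <= q < N.+1 | prime q && (q %| n)%N) ln q%:R.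

Lemma rad_ln_le N n : (0 < n <= N)%N -> rad_ln N n <= ln n%:R.
Proof.
move=> /andP[n_gt0 lenN]; rewrite (@ln_prime_decomp _ n N) // => [|q _ /(dvdn_leq n_gt0)];
  last first.
  by move=> leqn; apply: leq_trans lenN.
rewrite /rad_ln big_mkcondr; apply: ler_sum => q q_pr; case: ifP => qn; last first.
  by rewrite mulr_ge0 ?ln_nat_ge0.
by rewrite ler_peMl ?ln_nat_ge0 // ler1n logn_gt0 mem_primes q_pr n_gt0.
Qed.

Lemma sum_rad_ln N : \sum_(1 <= n < N.+1) rad_ln N n = floor_prime_sum R N.
Proof.
rewrite /rad_ln (exchange_big_dep prime) /= => [|n q _ /andP[]//].
rewrite /floor_prime_sum; apply: eq_bigr => q q_pr; rewrite (eq_bigl (fun n => q %| n)%N).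
  by rewrite sum_multiples ?prime_gt0 // big_const_nat iter_addr_0 subn1 mulr_natl.
by move=> n; rewrite q_pr.
Qed.

(** Writing n = qm gives tau f(q) f(m) = tau f(n): this identity ties the scale N to the scales
    N/q. *)
Lemma sum_ln_deficiency tau N :
  \sum_(1 <= q < N.+1 | prime q) ln q%:R * deficiency (tau * f q) (N %/ q) =
  \sum_(1 <= n < N.+1) rad_ln N n * (1 - tau * f n).
Proof.
under [RHS]eq_bigr do rewrite /rad_ln mulr_suml.
rewrite (exchange_big_dep prime) /= => [|n q _ /andP[]//].
apply: eq_bigr => q q_pr; rewrite -mulr_sumr; congr (_ * _).
rewrite (eq_bigl (fun n => q %| n)%N) => [|n]; last by rewrite q_pr.
rewrite sum_multiples ?prime_gt0 // /deficiency big_nat_cond [RHS]big_nat_cond.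
by apply: eq_bigr => m /andP[/andP[m_gt0 _] _]; rewrite (fM (prime_gt0 q_pr) m_gt0) mulrA.
Qed.

Lemma sum_ln_deficiency_le tau N : is_sign tau -> (N <= X)%N ->
  \sum_(1 <= q < N.+1 | prime q) ln q%:R * deficiency (tau * f q) (N %/ q) <=
  ln N%:R * deficiency tau N.
Proof.
move=> st leNX; rewrite sum_ln_deficiency /deficiency mulr_sumr.
rewrite big_nat_cond [leRHS]big_nat_cond; apply: ler_sum => n /andP[/andP[n_gt0 ltnN] _].
have /(deficiency_term st)/andP[d0 _] : (0 < n <= X)%N by rewrite n_gt0 (leq_trans _ leNX).
rewrite ler_wpM2r //; apply: le_trans (rad_ln_le _) _; first by rewrite n_gt0.
by rewrite ler_ln_nat.
Qed.

(** The 6 is 2 times 3: a term 1 - tau f(n) is at most 2, and ln N - [rad_ln] N n has mean at most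
    3, with 1 from log N! and 2 from the prime powers. *)
Lemma sum_ln_deficiency_ge tau N : is_sign tau -> (N <= X)%N ->
  ln N%:R * deficiency tau N <=
  \sum_(1 <= q < N.+1 | prime q) ln q%:R * deficiency (tau * f q) (N %/ q) + 6 * N%:R.
Proof.
move=> st leNX; rewrite sum_ln_deficiency -lerBlDl /deficiency mulr_sumr -sumrB.
apply: (@le_trans _ _ (\sum_(1 <= n < N.+1) 2 * (ln N%:R - rad_ln N n))).
  rewrite big_nat_cond [leRHS]big_nat_cond; apply: ler_sum => n /andP[/andP[n_gt0 ltnN] _].
  have /(deficiency_term st)/andP[d0 d2] : (0 < n <= X)%N by rewrite n_gt0 (leq_trans _
    leNX).
  have /rad_ln_le : (0 < n <= N)%N by rewrite n_gt0.
  have := ler_ln_nat R (ltnSE ltnN); rewrite -mulrBl; nra.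
rewrite -mulr_sumr sumrB sum_rad_ln big_const_nat iter_addr_0 subn1 -mulr_natl /=.
have /andP[T1 T2] := ln_fact_bounds R N; have /andP[U1 U2] := floor_prime_sum_bounds R N.
lra.
Qed.

Lemma sum_ln_deficiency_pair tau N : is_sign tau -> (N <= X)%N ->
  \sum_(1 <= q < N.+1 | prime q) \sum_(1 <= r < (N %/ q).+1 | prime r)
    ln q%:R * ln r%:R * deficiency (tau * f q * f r) (N %/ q %/ r) <=
  ln N%:R ^+ 2 * deficiency tau N.
Proof.
move=> st leNX; rewrite expr2 -mulrA.
apply: le_trans (ler_wpM2l (ln_nat_ge0 R N) (sum_ln_deficiency_le st leNX)).
rewrite mulr_sumr big_nat_cond [leRHS]big_nat_cond; apply: ler_sum => q.
move=> /andP[/andP[q_gt0 ltqN] q_pr].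
have leqX : (N %/ q <= X)%N := leq_trans (leq_div N q) leNX.
have sq : is_sign (tau * f q).
  by apply: is_signM st (f1 _); rewrite q_gt0 (leq_trans _ leNX).
under eq_bigr do rewrite -mulrA.
rewrite -mulr_sumr mulrCA ler_wpM2l ?ln_nat_ge0 //.
apply: le_trans (sum_ln_deficiency_le sq leqX) _.
by rewrite ler_wpM2r ?deficiency_ge0 // ler_ln_nat // leq_div.
Qed.
End Deficiency.

(** * Blocks of primes on a logarithmic scale *)

Definition prime_block (C i : nat) : seq nat :=
  [seq q <- index_iota (C ^ i.-1).+1 (C ^ i).+1 | prime q].

Lemma mem_prime_block C i q :
  (q \in prime_block C i) = [&& prime q, (C ^ i.-1 < q)%N & (q <= C ^ i)%N].
Proof. by rewrite mem_filter mem_index_iota ltnS. Qed.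

Lemma sum_prime_blocks (R : realType) (C K : nat) (F : nat -> R) : (0 < C)%N ->
  \sum_(1 <= i < K.+1) \sum_(q <- prime_block C i) F q =
  \sum_(2 <= q < (C ^ K).+1 | prime q) F q.
Proof.
move=> C_gt0; elim: K => [|K IHK]; first by rewrite expn0 !big_geq.
rewrite big_nat_recr //= IHK [RHS](@big_cat_nat _ _ _ (C ^ K).+1) //=.
- by congr (_ + _); rewrite /prime_block big_filter.
- by rewrite ltnS expn_gt0 C_gt0.
- by rewrite ltnS leq_pexp2l.
Qed.

Lemma sum_prime_blocks_le (R : realType) (C K N : nat) (F : nat -> R) : (0 < C)%N ->
  (C ^ K <= N)%N -> (forall q, prime q -> (q <= N)%N -> 0 <= F q) ->
  \sum_(1 <= i < K.+1) \sum_(q <- prime_block C i) F q <=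
  \sum_(1 <= q < N.+1 | prime q) F q.
Proof.
move=> C_gt0 leKN F_ge0; rewrite sum_prime_blocks //.
have N_gt0 : (0 < N)%N by apply: leq_trans leKN; rewrite expn_gt0 C_gt0.
rewrite [leRHS]big_ltn_cond //= (@big_cat_nat _ _ _ (C ^ K).+1 2 N.+1) //=; last first.
  by rewrite ltnS expn_gt0 C_gt0.
by rewrite lerDl big_nat_cond sumr_ge0 // => q /andP[/andP[_ leqN] /F_ge0]; apply.
Qed.

Section BlockPairs.
Variables (R : realType) (f : nat -> R) (X N C K : nat) (sigma delta : R).
Hypothesis fM : forall m n, (0 < m)%N -> (0 < n)%N -> f (m * n)%N = f m * f n.
Hypothesis f1 : forall n, (0 < n <= X)%N -> f n = 1 \/ f n = -1.
Hypothesis sigma1 : is_sign sigma.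
Hypothesis N_gt0 : (0 < N)%N.
Hypothesis leNX : (N <= X)%N.
Hypothesis C_gt0 : (0 < C)%N.
Hypothesis leKN : (C ^ K <= N)%N.
Hypothesis lnC16 : 16 <= ln (C%:R : R).
Hypothesis def_N : deficiency f sigma N <= delta * N%:R.

Let wt (q : nat) : R := ln q%:R / q%:R.
Definition block_mass i : R := \sum_(q <- prime_block C i) ln q%:R / q%:R.
(** Normalised by N/q and not by its integer part, so that the weights ln q / q restore exactly the
    terms of [sum_ln_deficiency_le]. *)
Definition def1 q : R := deficiency f (sigma * f q) (N %/ q) * (q%:R / N%:R).
Definition def2 q r : R :=
  deficiency f (sigma * f q * f r) (N %/ q %/ r) * (q%:R * r%:R / N%:R).
Definition block_def1 i : R := \sum_(q <- prime_block C i) ln q%:R / q%:R * def1 q.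
Definition block_def2 i j : R := \sum_(q <- prime_block C i) \sum_(r <- prime_block C j)
  ln q%:R / q%:R * (ln r%:R / r%:R) * def2 q r.
(** The weighted sum of [def1] q + [def1] r + [def2] q r over q in block i and r in block j, already
    split into its three parts. *)
Definition pair_defect i j : R :=
  block_mass j * block_def1 i + block_mass i * block_def1 j + block_def2 i j.

Let wt_ge0 q : 0 <= wt q. Proof. by rewrite /wt divr_ge0 ?ln_nat_ge0. Qed.

(** A block has logarithmic length ln C >= 16, one more than the Mertens error 15. *)
Lemma block_mass_ge1 i : (0 < i)%N -> 1 <= block_mass i.
Proof.
case: i => // i _; rewrite /block_mass big_filter /=.
have le12 : (0 < C ^ i <= C ^ i.+1)%N by rewrite expn_gt0 C_gt0 leq_pexp2l.
have /andP[+ _] := mertens_interval R le12.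
rewrite !natrX !lnXn ?ltr0n // mulrSr.
by move: (ln C%:R *+ i) => a; apply: le_trans; move: lnC16; lra.
Qed.

Lemma sum_block_mass_le : \sum_(1 <= i < K.+1) block_mass i <= ln N%:R + 12.
Proof.
have /andP[_] := mertens_bounds R N_gt0; apply: le_trans.
by apply: sum_prime_blocks_le => // q _ _; apply: wt_ge0.
Qed.

Lemma def1_ge0 q : prime q -> (q <= N)%N -> 0 <= def1 q.
Proof.
move=> q_pr leqN; rewrite /def1 mulr_ge0 ?divr_ge0 //.
apply: (deficiency_ge0 f1); last exact: leq_trans (leq_div _ _) leNX.
by apply: is_signM => //; apply: f1; rewrite prime_gt0 ?(leq_trans leqN).
Qed.

Lemma def2_ge0 q r : prime q -> prime r -> (q <= N)%N -> (r <= N)%N -> 0 <= def2 q r.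
Proof.
move=> q_pr r_pr leqN lerN; rewrite /def2 mulr_ge0 ?divr_ge0 ?mulr_ge0 //.
apply: (deficiency_ge0 f1); last first.
  by apply: leq_trans (leq_div _ _) _; apply: leq_trans (leq_div _ _) leNX.
apply: is_signM; last by apply: f1; rewrite prime_gt0 ?(leq_trans lerN).
by apply: is_signM => //; apply: f1; rewrite prime_gt0 ?(leq_trans leqN).
Qed.

Lemma mem_prime_block_le i q : (i <= K)%N -> q \in prime_block C i -> prime q /\ (q <= N)%N.
Proof.
move=> leiK; rewrite mem_prime_block => /and3P[-> _ leq]; split=> //.
by apply: leq_trans leq _; apply: leq_trans leKN; rewrite leq_pexp2l.
Qed.

Lemma block_def1_ge0 i : (i <= K)%N -> 0 <= block_def1 i.
Proof.
move=> leiK; rewrite /block_def1 big_seq sumr_ge0 // => q /(mem_prime_block_le leiK)[qp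
  leqN].
by rewrite mulr_ge0 ?def1_ge0 // wt_ge0.
Qed.

Lemma block_def2_ge0 i j : (i <= K)%N -> (j <= K)%N -> 0 <= block_def2 i j.
Proof.
move=> leiK lejK; rewrite /block_def2 big_seq sumr_ge0 // => q /(mem_prime_block_le
  leiK)[qp leqN].
rewrite big_seq sumr_ge0 // => r /(mem_prime_block_le lejK)[rp lerN].
by rewrite mulr_ge0 ?def2_ge0 // mulr_ge0 // wt_ge0.
Qed.

Lemma pair_defect_ge0 i j : (0 < i <= K)%N -> (0 < j <= K)%N -> 0 <= pair_defect i j.
Proof.
move=> /andP[i0 leiK] /andP[j0 lejK]; have mi := block_mass_ge1 i0;
  have mj := block_mass_ge1 j0.
by rewrite !addr_ge0 ?mulr_ge0 ?block_def1_ge0 ?block_def2_ge0 //; lra.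
Qed.

Lemma sum_block_def1_le : \sum_(1 <= i < K.+1) block_def1 i <= delta * ln N%:R.
Proof.
have N0 : 0 < N%:R :> R by rewrite ltr0n.
apply: le_trans (sum_prime_blocks_le C_gt0 leKN _) _ => [q qp leqN|].
  by rewrite mulr_ge0 ?def1_ge0 // wt_ge0.
rewrite -(ler_pM2l N0) mulr_sumr.
apply: (@le_trans _ _ (ln N%:R * deficiency f sigma N)); last first.
  rewrite [leRHS](_ : _ = ln N%:R * (delta * N%:R)); last by ring.
  by rewrite ler_wpM2l ?ln_nat_ge0.
apply: le_trans (sum_ln_deficiency_le fM f1 sigma1 leNX).
rewrite le_eqVlt; apply/orP; left; apply/eqP; apply: eq_bigr => q q_pr.
by rewrite /def1; field; rewrite !gt_eqF // ltr0n prime_gt0.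
Qed.

(** For fixed C, a number of pairs of order (ln N)^2 shares a total of order delta (ln N)^2, so most
    defects are small. The two single sums give ln N + 12 each, the double sum ln N. *)
Lemma sum_pair_defect_le :
  \sum_(1 <= i < K.+1) \sum_(1 <= j < (K - i).+1) pair_defect i j <=
    delta * ln N%:R * (3 * ln N%:R + 24).
Proof.
have N0 : 0 < N%:R :> R by rewrite ltr0n.
have mass0 i : 0 <= block_mass i by apply: sumr_ge0 => q _; apply: wt_ge0.
have swap (F : nat -> nat -> R) : \sum_(1 <= i < K.+1) \sum_(1 <= j < (K - i).+1) F i j =
    \sum_(1 <= i < K.+1) \sum_(1 <= j < K.+1 | (i + j <= K)%N) F i j.
  rewrite big_nat_cond [RHS]big_nat_cond; apply: eq_bigr => i /andP[/andP[_ leiK] _].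
  rewrite (@big_nat_widen _ _ _ 1 (K - i).+1 K.+1) ?ltnS ?leq_subr //=.
  by apply: eq_bigl => j; rewrite ltnS leq_subRL.
have S1 : \sum_(1 <= i < K.+1) \sum_(1 <= j < (K - i).+1) block_mass j * block_def1 i <=
    delta * ln N%:R * (ln N%:R + 12).
  apply: le_trans (ler_wpM2l (le_trans _ sum_block_def1_le) sum_block_mass_le); last first.
    by rewrite big_nat_cond sumr_ge0 // => i /andP[/andP[_ leiK] _]; apply: block_def1_ge0.
  apply: (@le_trans _ _ ((\sum_(1 <= i < K.+1) block_def1 i) * \sum_(1 <= i < K.+1)
    block_mass i)).
    rewrite mulr_suml big_nat_cond [leRHS]big_nat_cond;
      apply: ler_sum => i /andP[/andP[_ leiK] _].
    rewrite -mulr_suml mulrC ler_wpM2l ?block_def1_ge0 //.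
    rewrite [leRHS](@big_cat_nat _ _ _ (K - i).+1) ?ltnS ?leq_subr //= lerDl.
    by apply: sumr_ge0 => j _; apply: mass0.
  by rewrite ler_wpM2r ?sum_block_def1_le // sumr_ge0.
have S1' : \sum_(1 <= i < K.+1) \sum_(1 <= j < (K - i).+1) block_mass i * block_def1 j <=
    delta * ln N%:R * (ln N%:R + 12).
  rewrite swap (exchange_big_dep_nat xpredT) //=.
  under eq_bigr do under eq_bigl do rewrite addnC.
  by rewrite -(swap (fun i j => block_mass j * block_def1 i)).
have S2 : \sum_(1 <= i < K.+1) \sum_(1 <= j < (K - i).+1) block_def2 i j <=
    delta * ln N%:R * ln N%:R.
  pose g q r : R := ln q%:R / q%:R * (ln r%:R / r%:R) * def2 q r.
  have g_ge0 q r : prime q -> prime r -> (q <= N)%N -> (r <= N)%N -> 0 <= g q r.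
    by move=> *; rewrite mulr_ge0 ?def2_ge0 // mulr_ge0 // wt_ge0.
  apply: (@le_trans _ _ (\sum_(1 <= q < N.+1 | prime q) \sum_(1 <= r < (N %/ q).+1 | prime
    r) g q r)).
    have h0 q : prime q -> (q <= N)%N -> 0 <= \sum_(1 <= r < (N %/ q).+1 | prime r) g q r.
      move=> qp leqN; rewrite big_nat_cond sumr_ge0 // => r /andP[/andP[_ ltr] rp].
      by apply: g_ge0 => //; apply: leq_trans (ltnSE ltr) (leq_div _ _).
    apply: le_trans (sum_prime_blocks_le C_gt0 leKN h0).
    rewrite big_nat_cond [leRHS]big_nat_cond;
      apply: ler_sum => i /andP[/andP[i_gt0 ltiK] _].
    rewrite /block_def2 exchange_big /= big_seq [leRHS]big_seq; apply: ler_sum => q qi.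
    have [qp leqN] := mem_prime_block_le (ltnSE ltiK) qi.
    apply: sum_prime_blocks_le => // [|r rp ler]; last first.
      by apply: g_ge0 => //; apply: leq_trans ler (leq_div _ _).
    (* Here i + j <= K is used: q <= C^i gives C^(K - i) <= N/q, so the blocks j <= K - i stay
       within the inner range. *)
    rewrite leq_divRL ?prime_gt0 //; apply: leq_trans leKN.
    rewrite -[X in (_ <= C ^ X)%N](subnK (ltnSE ltiK)) expnD leq_mul2l; apply/orP; right.
    by move: qi; rewrite mem_prime_block => /and3P[].
  rewrite -(ler_pM2l N0).
  apply: (@le_trans _ _ (ln N%:R ^+ 2 * deficiency f sigma N)); last first.
    rewrite [leRHS](_ : _ = ln N%:R ^+ 2 * (delta * N%:R)); last by ring.
    by rewrite ler_wpM2l ?exprn_ge0 ?ln_nat_ge0.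
  apply: le_trans (sum_ln_deficiency_pair fM f1 sigma1 leNX).
  rewrite mulr_sumr le_eqVlt; apply/orP; left; apply/eqP; apply: eq_bigr => q q_pr.
  rewrite mulr_sumr; apply: eq_bigr => r r_pr.
  by rewrite /g /def2; field; rewrite !gt_eqF // ltr0n prime_gt0.
have -> : \sum_(1 <= i < K.+1) \sum_(1 <= j < (K - i).+1) pair_defect i j =
    \sum_(1 <= i < K.+1) \sum_(1 <= j < (K - i).+1) block_mass j * block_def1 i +
    \sum_(1 <= i < K.+1) \sum_(1 <= j < (K - i).+1) block_mass i * block_def1 j +
    \sum_(1 <= i < K.+1) \sum_(1 <= j < (K - i).+1) block_def2 i j.
  by rewrite -!big_split; apply: eq_bigr => i _; rewrite -!big_split.
lra.
Qed.

(** First-moment principle: both masses are at least 1, so a total of at least [kappa] for every q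
    and r would force the same for the blocks. *)
Lemma pair_defect_small (kappa : R) i j : (0 < i <= K)%N -> (0 < j <= K)%N -> 0 < kappa ->
  pair_defect i j < kappa ->
  exists q r, [/\ q \in prime_block C i, r \in prime_block C j
    & [/\ def1 q < kappa, def1 r < kappa & def2 q r < kappa]].
Proof.
move=> /andP[i0 leiK] /andP[j0 lejK] kappa_gt0; apply: contraPP => noqr; apply/negP;
  rewrite -leNgt.
have big_s q r : q \in prime_block C i -> r \in prime_block C j ->
    kappa <= def1 q + def1 r + def2 q r.
  move=> qi rj; have [qp leqN] := mem_prime_block_le leiK qi.
  have [rp lerN] := mem_prime_block_le lejK rj.
  have d1 := def1_ge0 qp leqN; have d2 := def1_ge0 rp lerN;
    have d3 := def2_ge0 qp rp leqN lerN.
  rewrite leNgt; apply/negP => lts; apply: noqr; exists q, r; split=> //.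
  by move: (def1 q) (def1 r) (def2 q r) d1 d2 d3 lts => x y z *; split; lra.
have mi := block_mass_ge1 i0; have mj := block_mass_ge1 j0.
have -> : pair_defect i j = \sum_(q <- prime_block C i) \sum_(r <- prime_block C j)
   wt q * wt r * (def1 q + def1 r + def2 q r).
  under eq_bigr do under eq_bigr do rewrite !mulrDr.
  under eq_bigr do rewrite !big_split /=.
  rewrite !big_split /= /pair_defect; congr (_ + _ + _).
  - rewrite mulrC /block_def1 mulr_suml; apply: eq_bigr => q _.
    by rewrite /block_mass mulr_sumr; apply: eq_bigr => r _; rewrite /wt; ring.
  rewrite /block_mass mulr_suml; apply: eq_bigr => q _.
  by rewrite /block_def1 mulr_sumr; apply: eq_bigr => r _; rewrite /wt; ring.
apply: (@le_trans _ _ (kappa * (block_mass i * block_mass j))).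
  by rewrite ler_peMr ?mulr_ege1 // ltW.
rewrite /block_mass big_distrlr /= mulr_sumr big_seq [leRHS]big_seq; apply: ler_sum => q qi.
rewrite mulr_sumr big_seq [leRHS]big_seq; apply: ler_sum => r rj.
by rewrite mulrC ler_wpM2l ?big_s // mulr_ge0 // wt_ge0.
Qed.
End BlockPairs.

(** * Signs at the scales N/C^i *)

Lemma ler_sum_subset (R : realType) (T : eqType) (F : T -> R) (s t : seq T) :
  uniq s -> uniq t -> {subset s <= t} -> (forall x, x \in t -> 0 <= F x) ->
  \sum_(x <- s) F x <= \sum_(x <- t) F x.
Proof.
move=> us ut sst F_ge0; rewrite [leRHS](bigID (mem s)) /=.
have -> : \sum_(x <- s) F x = \sum_(x <- t | x \in s) F x.
  rewrite -[RHS]big_filter; apply: perm_big; apply: uniq_perm => //;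
    first exact: filter_uniq.
  by move=> x; rewrite mem_filter; case: (boolP (x \in s)) => // /sst ->.
by rewrite lerDl big_seq_cond sumr_ge0 // => x /andP[/F_ge0].
Qed.

(** Meant for the maps (k, a) to (k - a, k + a), (k, a) and (k - a, a), each injective into the
    triangle i + j <= K. *)
Lemma sum_pairs_inj_le (R : realType) (K m : nat) (g : nat -> nat -> R)
    (h : nat * nat -> nat * nat) :
  (forall i j, (0 < i)%N -> (0 < j)%N -> (i + j <= K)%N -> 0 <= g i j) ->
  (forall k a k' a', (a < k)%N -> (a' < k')%N -> h (k, a) = h (k', a') -> k = k' /\ a = a')
    ->
  (forall k a, (0 < a < k)%N -> (k <= m)%N ->
     [&& 0 < (h (k, a)).1, 0 < (h (k, a)).2 & (h (k, a)).1 + (h (k, a)).2 <= K]%N) ->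
  \sum_(1 <= k < m.+1) \sum_(1 <= a < k) g (h (k, a)).1 (h (k, a)).2 <=
  \sum_(1 <= i < K.+1) \sum_(1 <= j < (K - i).+1) g i j.
Proof.
move=> g_ge0 h_inj h_in.
have uniq_dep (a b : nat) (c : nat -> nat) :
    uniq [seq (i, j) | i <- index_iota a b, j <- index_iota 1 (c i)].
  by apply: allpairs_uniq_dep => [|i _|[i j] [i' j'] _ _ /=];
    rewrite ?iota_uniq // => -[-> ->].
pose s := [seq (k, a) | k <- index_iota 1 m.+1, a <- index_iota 1 k].
pose t := [seq (i, j) | i <- index_iota 1 K.+1, j <- index_iota 1 (K - i).+1].
have tP u : u \in t -> [/\ 0 < u.1, 0 < u.2 & u.1 + u.2 <= K]%N.
  move=> /allpairsPdep[i [j [+ + ->]]] /=;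
    rewrite !mem_index_iota => /andP[i0 iK] /andP[j0 jK].
  by split=> //; rewrite -leq_subRL ?ltnS // -ltnS.
have -> : \sum_(1 <= i < K.+1) \sum_(1 <= j < (K - i).+1) g i j = \sum_(u <- t) g u.1 u.2.
  by rewrite /t big_allpairs_dep.
have -> : \sum_(1 <= k < m.+1) \sum_(1 <= a < k) g (h (k, a)).1 (h (k, a)).2 =
    \sum_(u <- map h s) g u.1 u.2.
  by rewrite big_map /s big_allpairs_dep.
apply: ler_sum_subset; rewrite ?uniq_dep //; last by move=> u /tP[? ? ?]; apply: g_ge0.
  rewrite map_inj_in_uniq ?uniq_dep // => _ _ /allpairsPdep[k [a [_ + ->]]]
    /allpairsPdep[k' [a' [_ + ->]]].
  by rewrite !mem_index_iota => /andP[_ ak] /andP[_ ak'] /(h_inj _ _ _ _ ak ak')[-> ->].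
move=> _ /mapP[u /allpairsPdep[k [a [+ + ->]]] ->]; rewrite !mem_index_iota.
move=> /andP[k0 km] /andP[a0 ak].
have := h_in k a; rewrite a0 ak -ltnS km => /(_ isT isT).
case: (h (k, a)) => i j /= /and3P[i0 j0 ijK].
apply/allpairsPdep; exists i, j; rewrite !mem_index_iota i0 j0 !ltnS.
have leiK : (i <= K)%N by apply: leq_trans ijK; apply: leq_addr.
by rewrite leiK leq_subRL.
Qed.

Lemma half_index_bounds K k a : (0 < a < k)%N -> (k <= K %/ 2)%N ->
  [/\ 0 < k - a, 0 < k + a & [/\ (k - a) + (k + a) <= K, k + a <= K & (k - a) + a <= K]]%N.
Proof. by move=> /andP[a0 ak] km; split; [lia|lia|split; lia]. Qed.

Section SignPattern.
Variables (R : realType) (f : nat -> R) (X N C K : nat) (sigma delta kappa : R).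
Hypothesis fM : forall m n, (0 < m)%N -> (0 < n)%N -> f (m * n)%N = f m * f n.
Hypothesis f1 : forall n, (0 < n <= X)%N -> f n = 1 \/ f n = -1.
Hypothesis sigma1 : is_sign sigma.
Hypothesis N_gt0 : (0 < N)%N.
Hypothesis leNX : (N <= X)%N.
Hypothesis C_gt0 : (0 < C)%N.
Hypothesis leKN : (C ^ K <= N)%N.
Hypothesis lnC16 : 16 <= ln (C%:R : R).
Hypothesis def_N : deficiency f sigma N <= delta * N%:R.
Hypothesis kappa_gt0 : 0 < kappa.
Hypothesis kappa_small : kappa * C%:R ^+ 2 < 2^-1.

Local Notation gamma := (pair_defect f N C sigma).

(** The factor C^2 is the loss in passing from N/(qr) to N/C^i: a product of two block primes may
    fall short of C^i by up to C^2. *)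
Definition sign_at (i : nat) (phi : R) :=
  is_sign phi /\ deficiency f (sigma * phi) (N %/ C ^ i) <= kappa * C%:R ^+ 2 * (N%:R /
    C%:R ^+ i).

(** The deficiencies for opposite signs add up to 2n, where n = floor(N/C^i) is at least half of
    N/C^i; but [kappa_small] bounds their sum strictly below N/C^i. *)
Lemma sign_at_unique i phi psi : (i <= K)%N -> sign_at i phi -> sign_at i psi -> phi = psi.
Proof.
move=> leiK [sphi dphi] [spsi dpsi]; have [//|neq] := eqVneq phi psi.
have psiE : psi = - phi.
  by case: sphi neq => ->; case: spsi => ->; rewrite ?eqxx ?opprK.
move: dpsi; rewrite psiE mulrN deficiencyN => dpsi.
have Ci_gt0 : (0 < C ^ i)%N by rewrite expn_gt0 C_gt0.
have leCN : (C ^ i <= N)%N by apply: leq_trans leKN; rewrite leq_pexp2l.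
have : N%:R / C%:R ^+ i <= 2 * (N %/ C ^ i)%:R :> R.
  rewrite ler_pdivrMr ?exprn_gt0 ?ltr0n // -natrX -!natrM ler_nat -mulnA.
  have := ltn_ceil N Ci_gt0; rewrite mulSn; have : (C ^ i <= N %/ C ^ i * C ^ i)%N.
    by rewrite leq_pmull // divn_gt0.
  lia.
have : 0 < N%:R / C%:R ^+ i :> R by rewrite divr_gt0 ?exprn_gt0 ?ltr0n.
move: (N%:R / C%:R ^+ i) dphi dpsi => y; move: (deficiency f (sigma * phi) _) => d.
move: (N %/ C ^ i)%N => n dphi dpsi y0 yn.
by move: kappa_small; move: (kappa * C%:R ^+ 2) dphi dpsi => k dphi dpsi; nra.
Qed.

(** Monotonicity carries the bound from N/d down to N/C^i at the price of C^e, where e will be the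
    number of primes in d. *)
Lemma def_block_le (tau : R) (c d i : nat) (e : nat) : is_sign tau -> (0 < d)%N ->
  (d <= C ^ i)%N -> (C ^ i <= C ^ e * d)%N -> (e <= 2)%N ->
  deficiency f tau (N %/ d) * (d%:R / N%:R) < kappa ->
  deficiency f tau (N %/ C ^ i) <= kappa * C%:R ^+ 2 * (N%:R / C%:R ^+ i).
Proof.
move=> st d_gt0 led leCd le2 lt_k.
have N0 : 0 < N%:R :> R by rewrite ltr0n.
have d0 : 0 < d%:R :> R by rewrite ltr0n.
have C0 : 0 < C%:R :> R by rewrite ltr0n.
apply: le_trans (_ : deficiency f tau (N %/ d) <= _).
  by apply: (deficiency_mono f1) => //; rewrite leq_div2l //= (leq_trans (leq_div _ _)).
apply: (@le_trans _ _ (kappa * (N%:R / d%:R))).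
  by rewrite -ler_pdivrMr ?divr_gt0 // invf_div ltW.
rewrite -mulrA ler_pM2l // mulrCA ler_pM2l //.
rewrite ler_pdivlMr ?exprn_gt0 // mulrC ler_pdivrMr // -!natrX -natrM ler_nat.
by apply: leq_trans leCd _; rewrite leq_mul2r leq_pexp2l // orbT.
Qed.

(** Complete multiplicativity supplies the signs: f(q), f(r) and f(q) f(r) for one pair of primes
    with small defects. *)
Lemma sign_at_pair i j : (0 < i)%N -> (0 < j)%N -> (i + j <= K)%N -> gamma i j < kappa ->
  exists phi psi, [/\ sign_at i phi, sign_at j psi & sign_at (i + j) (phi * psi)].
Proof.
move=> i0 j0 ijK gam.
have leiK : (0 < i <= K)%N by rewrite i0 (leq_trans _ ijK) ?leq_addr.
have lejK : (0 < j <= K)%N by rewrite j0 (leq_trans _ ijK) ?leq_addl.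
have [q [r [qi rj [d1 d2 d3]]]] :=
  pair_defect_small f1 sigma1 leNX C_gt0 leKN lnC16 leiK lejK kappa_gt0 gam.
have f_sign k n : (k <= K)%N -> n \in prime_block C k -> is_sign (f n).
  move=> lek /(mem_prime_block_le C_gt0 leKN lek)[np leN].
  by apply: f1; rewrite prime_gt0 // (leq_trans leN).
have sq := f_sign i q (proj2 (andP leiK)) qi.
have sr := f_sign j r (proj2 (andP lejK)) rj.
move: qi rj; rewrite !mem_prime_block => /and3P[qp Cq qC] /and3P[rp Cr rC].
have Ci : (C ^ i <= C * q)%N by rewrite -{1}(prednK i0) expnS leq_mul2l ltnW ?orbT.
have Cj : (C ^ j <= C * r)%N by rewrite -{1}(prednK j0) expnS leq_mul2l ltnW ?orbT.
exists (f q), (f r); split; split => //.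
- by apply: (@def_block_le _ 0 q i 1 _ _ qC) => //; [exact: is_signM|exact: prime_gt0].
- by apply: (@def_block_le _ 0 r j 1 _ _ rC) => //; [exact: is_signM|exact: prime_gt0].
- exact: is_signM.
apply: (@def_block_le _ 0 (q * r) (i + j) 2) => //.
- by apply: is_signM => //; apply: is_signM.
- by rewrite muln_gt0 !prime_gt0.
- by rewrite expnD leq_mul.
- by rewrite expnD expnS expn1 mulnACA leq_mul.
by move: d3; rewrite /def2 divnMA natrM mulrA.
Qed.

(* On good pairs the sign is additive-to-multiplicative, so
   [s(2k) = s(k-a) s(k+a) = s(k-a) (s(k) s(a)) = s(k-a)^2 s(a)^2 = 1]. *)
Lemma sign_at_double k a : (0 < a < k)%N -> (k + k <= K)%N ->
  gamma (k - a) (k + a) < kappa -> gamma k a < kappa -> gamma (k - a) a < kappa ->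
  deficiency f sigma (N %/ C ^ (k + k)) <= kappa * C%:R ^+ 2 * (N%:R / C%:R ^+ (k + k)).
Proof.
move=> /andP[a0 ltak] kK g1 g2 g3.
have E1 : ((k - a) + (k + a) = k + k)%N by lia.
have E3 : ((k - a) + a = k)%N by lia.
have [k0 ka0 kaK] : [/\ 0 < k - a, 0 < k + a & k + a <= K]%N by clear -a0 ltak kK; split;
  lia.
have k_gt0 : (0 < k)%N := ltn_trans a0 ltak.
have leE1 : ((k - a) + (k + a) <= K)%N by rewrite E1.
have leE3 : ((k - a) + a <= K)%N by rewrite E3 (leq_trans _ kK) ?leq_addr.
have [u [v [su sv suv]]] := sign_at_pair k0 ka0 leE1 g1.
have [w [x [sw sx swx]]] := sign_at_pair k_gt0 a0 kaK g2.
have [y [z [sy sz syz]]] := sign_at_pair k0 a0 leE3 g3.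
rewrite E1 in suv; rewrite E3 in syz.
have vE : v = w * x by apply: sign_at_unique sv swx.
have wE : w = y * z by apply: sign_at_unique sw syz; rewrite (leq_trans _ kK) ?leq_addr.
have uE : u = y by apply: sign_at_unique su sy; rewrite (leq_trans _ leE1) ?leq_addr.
have xE : x = z by apply: sign_at_unique sx sz; rewrite (leq_trans _ leE3) ?leq_addl.
have [sy1 _] := sy; have [sz1 _] := sz.
have uv1 : u * v = 1.
  by rewrite uE vE wE xE -mulrA (is_sign_sqr sz1) mulr1 (is_sign_sqr sy1).
by have [_] := suv; rewrite uv1 mulr1.
Qed.

Definition good_index k := has (fun a => [&& gamma (k - a) (k + a) < kappa,
  gamma k a < kappa & gamma (k - a) a < kappa]) (index_iota 1 k).

Lemma good_indexP k : (k + k <= K)%N -> good_index k ->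
  deficiency f sigma (N %/ C ^ (k + k)) <= kappa * C%:R ^+ 2 * (N%:R / C%:R ^+ (k + k)).
Proof.
move=> kK /hasP[a]; rewrite mem_index_iota => ak /and3P[g1 g2 g3].
exact: (sign_at_double ak).
Qed.

(** For a bad k, each of the k - 1 values of a has one of the three defects at least [kappa]. Each
    of the three families embeds in the triangle of [sum_pair_defect_le], hence the factor 3. *)
Lemma sum_bad_index_le :
  \sum_(1 <= k < (K %/ 2).+1 | ~~ good_index k) (k%:R - 1) * kappa <=
    3 * (delta * ln N%:R * (3 * ln N%:R + 24)).
Proof.
have g_ge0 i j : (0 < i)%N -> (0 < j)%N -> (i + j <= K)%N -> 0 <= gamma i j.
  move=> i0 j0 ijK; apply: (pair_defect_ge0 f1 sigma1 leNX C_gt0 leKN lnC16); lia.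
have G := sum_pair_defect_le fM f1 sigma1 N_gt0 leNX C_gt0 leKN def_N.
have le2 : (K %/ 2 + K %/ 2 <= K)%N by lia.
have b1 := @sum_pairs_inj_le R K (K %/ 2) gamma (fun u => (u.1 - u.2, u.1 + u.2)%N) g_ge0.
have b2 := @sum_pairs_inj_le R K (K %/ 2) gamma (fun u => u) g_ge0.
have b3 := @sum_pairs_inj_le R K (K %/ 2) gamma (fun u => (u.1 - u.2, u.2)%N) g_ge0.
have {}b1 := le_trans (b1 _ _) G; have {}b2 := le_trans (b2 _ _) G.
have {}b3 := le_trans (b3 _ _) G.
pose S1 k := \sum_(1 <= a < k) gamma (k - a) (k + a).
pose S2 k := \sum_(1 <= a < k) gamma k a.
pose S3 k := \sum_(1 <= a < k) gamma (k - a) a.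
apply: (@le_trans _ _ (\sum_(1 <= k < (K %/ 2).+1) (S1 k + S2 k + S3 k))); last first.
  rewrite !big_split /= /S1 /S2 /S3.
  have -> (x : R) : 3 * x = x + x + x by ring.
  apply: lerD; first apply: lerD; [apply: b1|apply: b2|apply: b3] => /=.
  - by move=> k a k' a' ak ak' [e1 e2]; clear -ak ak' e1 e2; lia.
  - by move=> k a ak km; have [-> -> [-> _ _]] := half_index_bounds ak km.
  - by move=> k a k' a' _ _ [-> ->].
  - move=> k a ak km; have [_ _ [_ -> _]] := half_index_bounds ak km.
    by have /andP[a0 ak'] := ak; rewrite a0 (leq_trans a0 (ltnW ak')).
  - by move=> k a k' a' ak ak' [e1 e2]; clear -ak ak' e1 e2; lia.
  move=> k a ak km; have [-> _ [_ _ ->]] := half_index_bounds ak km.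
  by have /andP[-> _] := ak.
rewrite big_mkcond big_nat_cond [leRHS]big_nat_cond;
  apply: ler_sum => k /andP[/andP[k0 km] _].
rewrite /S1 /S2 /S3 -!big_split /=.
have nneg a : (0 < a < k)%N ->
    [/\ 0 <= gamma (k - a) (k + a), 0 <= gamma k a & 0 <= gamma (k - a) a].
  move=> ak; have [h1 h2 [h3 h4 h5]] := half_index_bounds ak (ltnSE km).
  by have /andP[a0 _] := ak; split; apply: g_ge0.
case: ifP => [/hasPn bad|_]; last first.
  rewrite big_nat_cond sumr_ge0 // => a /andP[/nneg[? ? ?] _]; lra.
apply: (@le_trans _ _ (\sum_(1 <= a < k) kappa)).
  by rewrite big_const_nat iter_addr_0 -[leRHS]mulr_natl natrB.
apply: ler_sum_nat => a ak.
have [? ? ?] := nneg a ak; have /bad : a \in index_iota 1 k by rewrite mem_index_iota.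
by rewrite !negb_and -!leNgt => /or3P[] ?; lra.
Qed.
End SignPattern.

(** * Deficiency at all scales below N *)

Lemma ler_sum_nat_cond (R : numDomainType) (m n : nat) (P : pred nat) (F G : nat -> R) :
  (forall i, (m <= i < n)%N -> P i -> F i <= G i) ->
  \sum_(m <= i < n | P i) F i <= \sum_(m <= i < n | P i) G i.
Proof.
move=> leFG; rewrite big_nat_cond [leRHS]big_nat_cond.
by apply: ler_sum => i /andP[lei Pi]; apply: leFG.
Qed.

(** Zones have ratio C^2 because the sign is identified only at even powers of C. *)
Definition in_zone (N C k n : nat) : bool :=
  (N < n * C ^ (k + k + 2))%N && (n * C ^ (k + k) <= N)%N.

Section Zones.
Variables (R : realType) (f : nat -> R) (X N C K : nat) (sigma delta kappa : R).
Hypothesis fM : forall m n, (0 < m)%N -> (0 < n)%N -> f (m * n)%N = f m * f n.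
Hypothesis f1 : forall n, (0 < n <= X)%N -> f n = 1 \/ f n = -1.
Hypothesis sigma1 : is_sign sigma.
Hypothesis N_gt0 : (0 < N)%N.
Hypothesis leNX : (N <= X)%N.
Hypothesis C_gt1 : (1 < C)%N.
Hypothesis leKN : (C ^ K <= N < C ^ K.+1)%N.
Hypothesis lnC16 : 16 <= ln (C%:R : R).
Hypothesis def_N : deficiency f sigma N <= delta * N%:R.
Hypothesis kappa_gt0 : 0 < kappa.
Hypothesis kappa_small : kappa * C%:R ^+ 2 < 2^-1.
Hypothesis delta_kappa : delta <= kappa.

Local Notation bad k := (~~ good_index f N C sigma kappa k).
Local Notation mK := (K %/ 2)%N.

Definition zone_defect (n : nat) : R :=
  kappa * C%:R ^+ 4 + 2 * \sum_(1 <= k < mK.+1 | bad k) (in_zone N C k n)%:R.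

Definition bad_count : R := \sum_(1 <= k < mK.+1 | bad k) 1.

Let C_gt0 : (0 < C)%N := ltnW C_gt1.
Let CR_ge1 : 1 <= C%:R :> R. Proof. by rewrite ler1n. Qed.
Let C0 : 0 < C%:R :> R. Proof. by rewrite ltr0n. Qed.

Lemma zone_defect_ge0 n : 0 <= zone_defect n.
Proof.
by rewrite addr_ge0 ?mulr_ge0 ?exprn_ge0 ?sumr_ge0 // ?ltW.
Qed.

(** C^4 is the loss C^2 of [sign_at] times the ratio C^2 of a zone. Zone 0 rests on the hypothesis
    at N; in a bad zone the trivial bound 2n is used. *)
Lemma deficiency_le_zone n : (0 < n <= N)%N ->
  deficiency f sigma n <= n%:R * zone_defect n.
Proof.
move=> /andP[n_gt0 lenN]; have n0 : 0 < n%:R :> R by rewrite ltr0n.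
have lenX : (n <= X)%N := leq_trans lenN leNX.
have Nn_gt0 : (0 < N %/ n)%N by rewrite divn_gt0.
have C2_gt1 : (1 < C ^ 2)%N by rewrite -(exp1n 2) ltn_exp2r.
pose k := trunc_log (C ^ 2) (N %/ n).
have /andP[lek ltk] := trunc_log_bounds C2_gt1 Nn_gt0.
have Ck : ((C ^ 2) ^ k = C ^ (k + k))%N by rewrite -expnM mul2n addnn.
have Ck1 : ((C ^ 2) ^ k.+1 = C ^ (k + k + 2))%N by rewrite -expnM mul2n doubleS -addnn
  addn2.
rewrite -/k Ck1 in ltk; rewrite -/k Ck in lek.
have {}lek : (n * C ^ (k + k) <= N)%N by rewrite mulnC -leq_divRL.
have {}ltk : (N < n * C ^ (k + k + 2))%N by rewrite mulnC -ltn_divLR.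
have N_le (e : nat) : (N < n * C ^ e)%N -> N%:R <= n%:R * C%:R ^+ e :> R.
  by move=> lt; rewrite -natrX -natrM ler_nat ltnW.
have [k0|k_gt0] := posnP k.
  apply: le_trans (deficiency_mono f1 sigma1 (_ : n <= N <= X)%N) _; first by rewrite lenN.
  apply: le_trans def_N _; rewrite k0 in ltk.
  apply: (@le_trans _ _ (n%:R * (kappa * C%:R ^+ 4))); last first.
    by rewrite ler_pM2l // /zone_defect lerDl mulr_ge0 // sumr_ge0.
  apply: (@le_trans _ _ (kappa * N%:R)); first by rewrite ler_wpM2r.
  rewrite [leRHS]mulrCA ler_pM2l //; apply: le_trans (N_le _ ltk) _.
  by rewrite ler_pM2l // ler_weXn2l.
have kK : (k + k <= K)%N.
  rewrite -ltnS -(ltn_exp2l _ _ C_gt1); case/andP: leKN => _; apply: leq_ltn_trans.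
  by apply: leq_trans lek; rewrite leq_pmull.
have km : (k <= mK)%N by rewrite leq_divRL // muln2 -addnn.
case: (boolP (good_index f N C sigma kappa k)) => [good|badk].
  apply: (@le_trans _ _ (n%:R * (kappa * C%:R ^+ 4))); last first.
    by rewrite ler_pM2l // /zone_defect lerDl mulr_ge0 // sumr_ge0.
  apply: le_trans (deficiency_mono f1 sigma1 (_ : n <= N %/ C ^ (k + k) <= X)%N) _.
    by rewrite leq_divRL ?expn_gt0 ?C_gt0 // lek (leq_trans (leq_div _ _)).
  have C2 : 0 <= C%:R ^+ 2 :> R by rewrite exprn_ge0.
  have leKN' : (C ^ K <= N)%N by case/andP: leKN.
  apply: le_trans (good_indexP f1 sigma1 N_gt0 leNX C_gt0 leKN' lnC16 def_N kappa_gt0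
    kappa_small kK good) _.
  rewrite [leRHS]mulrCA -mulrA ler_pM2l // (exprD _ 2 2) [leRHS]mulrCA ler_wpM2l //.
  by rewrite ler_pdivrMr ?exprn_gt0 // -mulrA -exprD addnC N_le.
apply: le_trans (deficiency_le f1 sigma1 lenX) _.
rewrite mulrC ler_pM2l // /zone_defect; apply: ler_wpDl;
  first by rewrite mulr_ge0 ?exprn_ge0 ?ltW.
rewrite ler_peMr //= big_mkcond (bigD1_seq k) ?iota_uniq ?mem_index_iota ?k_gt0 ?ltnS //=.
by rewrite badk /in_zone lek ltk lerDl sumr_ge0 // => j _; case: ifP.
Qed.

(** Rounding x/q costs a factor 2 at the lower end, so the primes lie in (a, b] with b <= 4 C^2 a,
    of bounded Mertens mass; k > 0 and x >= N keep a positive. *)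
Lemma zone_mass_le x k : (N <= x)%N -> (0 < k)%N -> 
  \sum_(1 <= q < x.+1 | prime q) (ln q%:R / q%:R * (in_zone N C k (x %/ q))%:R) <=
    ln (4 * C%:R ^+ 2) + 15 :> R.
Proof.
move=> leNx k_gt0; pose a := (x * C ^ (k + k) %/ (2 * N))%N;
  pose b := (x * C ^ (k + k + 2) %/ N)%N.
have N2 : (0 < 2 * N)%N by rewrite muln_gt0.
have CC : (C ^ (k + k + 2) = C ^ (k + k) * C ^ 2)%N by rewrite expnD.
have Ckk : (2 <= C ^ (k + k))%N.
  by apply: leq_trans C_gt1 _; rewrite -{1}[C]expn1 leq_pexp2l // addn_gt0 k_gt0.
have a_gt0 : (0 < a)%N by rewrite divn_gt0 // mulnC leq_mul.
have ab : (a <= b)%N.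
  apply: (@leq_trans (x * C ^ (k + k) %/ N)); first by apply: leq_div2l => //;
    apply: leq_pmull.
  by apply: leq_div2r; rewrite leq_mul2l leq_pexp2l ?orbT // leq_addr.
have abC : (b <= 4 * C ^ 2 * a)%N.
  have h1 : (b * N <= x * C ^ (k + k) * C ^ 2)%N by rewrite -mulnA -CC leq_divM.
  have h2 : (x * C ^ (k + k) < a.+1 * (2 * N))%N by rewrite ltn_ceil.
  rewrite -(leq_pmul2r N_gt0); apply: leq_trans h1 _.
  apply: (@leq_trans (a.+1 * (2 * N) * C ^ 2)); first by rewrite leq_mul2r ltnW ?orbT.
  have h3 : (a.+1 <= 2 * a)%N by clear -a_gt0; lia.
  rewrite (_ : 4 * C ^ 2 * a * N = (2 * a) * (2 * N) * C ^ 2)%N; last by ring.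
  by rewrite leq_mul2r leq_mul2r h3 !orbT.
have a_int : (0 < a <= b)%N by rewrite a_gt0.
have /andP[_ M] := mertens_interval R a_int.
have lnb : ln b%:R - ln a%:R <= ln (4 * C%:R ^+ 2) :> R.
  have a0 : 0 < a%:R :> R by rewrite ltr0n.
  rewrite lerBlDr -lnM ?posrE ?mulr_gt0 ?exprn_gt0 // ler_ln ?posrE ?mulr_gt0 ?exprn_gt0 //.
    by rewrite -natrX -!natrM ler_nat.
  by rewrite ltr0n (leq_trans a_gt0).
apply: (@le_trans _ _ (\sum_(a.+1 <= q < b.+1 | prime q) ln q%:R / q%:R)); last by lra.
have -> : \sum_(1 <= q < x.+1 | prime q) (ln q%:R / q%:R * (in_zone N C k (x %/ q))%:R) =
    \sum_(q <- [seq q <- index_iota 1 x.+1 | prime q && in_zone N C k (x %/ q)]) (ln q%:R /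
      q%:R) :> R.
  rewrite big_filter big_mkcondr; apply: eq_bigr => q _.
  by case: ifP => _; rewrite ?mulr1 ?mulr0.
rewrite -[leRHS]big_filter; apply: ler_sum_subset; rewrite ?filter_uniq ?iota_uniq //;
  last first.
  by move=> q _; rewrite divr_ge0 ?ln_nat_ge0.
move=> q; rewrite !mem_filter !mem_index_iota => /andP[/andP[qp /andP[z1 z2]] /andP[q_gt0
  leqx]].
rewrite qp /= !ltnS; set n := (x %/ q)%N in z1 z2.
have n_gt0 : (0 < n)%N by case: posnP z1 => // ->.
have nq : (n * q <= x)%N by apply: leq_divM.
have xq : (x < n.+1 * q)%N by rewrite ltn_ceil.
apply/andP; split.
  rewrite ltn_divLR //; apply: (@leq_trans (n.+1 * q * C ^ (k + k))%N).
    by rewrite ltn_mul2r xq expn_gt0 C_gt0.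
  have h3 : (n.+1 <= 2 * n)%N by clear -n_gt0; lia.
  apply: (@leq_trans (2 * n * q * C ^ (k + k))%N); first by rewrite !leq_mul2r h3 !orbT.
  rewrite (_ : 2 * n * q * C ^ (k + k) = 2 * (n * C ^ (k + k)) * q)%N; last by ring.
  by rewrite [leqRHS]mulnC leq_mul2r leq_mul2l z2 !orbT.
rewrite leq_divRL //; apply: (@leq_trans (q * (n * C ^ (k + k + 2)))%N).
  by rewrite leq_mul2l (ltnW z1) orbT.
by rewrite mulnA leq_mul2r mulnC nq orbT.
Qed.

(** Used with y = ln x: the full Mertens mass times kappa C^4, plus a bounded mass for each bad
    zone. *)
Definition zone_bound (y : R) : R :=
  kappa * C%:R ^+ 4 * (y + 12) + 2 * (bad_count * (ln (4 * C%:R ^+ 2) + 15)).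

Lemma sum_zone_defect_le x : (N <= x)%N ->
  \sum_(1 <= q < x.+1 | prime q) ln q%:R / q%:R * zone_defect (x %/ q) <= zone_bound (ln
    x%:R).
Proof.
move=> leNx; have x_gt0 : (0 < x)%N := leq_trans N_gt0 leNx.
have /andP[_ M] := mertens_bounds R x_gt0.
rewrite /zone_defect; under eq_bigr do rewrite mulrDr.
rewrite big_split /= -mulr_suml lerD //.
  by rewrite [leLHS]mulrC ler_wpM2l ?M ?mulr_ge0 ?exprn_ge0 ?ltW.
rewrite /bad_count mulr_suml.
under eq_bigr do rewrite mulrCA mulr_sumr.
rewrite -[leLHS]mulr_sumr ler_wpM2l // exchange_big_nat /=.
rewrite big_nat_cond [leRHS]big_nat_cond; apply: ler_sum => k /andP[/andP[k0 km] _].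
by rewrite mul1r zone_mass_le.
Qed.

(** If f(q) = -1, the deficiency for sigma f(q) at n = floor(N/q) is 2n minus the one for sigma,
    hence nearly 2n outside the bad zones; [sum_ln_deficiency_le] at N makes such q rare. *)
Lemma sum_negative_le :
  \sum_(1 <= q < N.+1 | prime q) ln q%:R / q%:R * (1 - f q) <=
    2 * delta * ln N%:R + 2 * zone_bound (ln N%:R).
Proof.
have N0 : 0 < N%:R :> R by rewrite ltr0n.
have S1 := sum_ln_deficiency_le fM f1 sigma1 leNX.
have S2 := sum_zone_defect_le (leqnn N).
apply: (@le_trans _ _ (2 / N%:R * (\sum_(1 <= q < N.+1 | prime q)
    ln q%:R * deficiency f (sigma * f q) (N %/ q)) +
  2 * \sum_(1 <= q < N.+1 | prime q) ln q%:R / q%:R * zone_defect (N %/ q))); last first.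
  apply: lerD; last by rewrite ler_pM2l.
  rewrite -mulrA -mulrA ler_pM2l // mulrC ler_pdivrMr //.
  apply: le_trans S1 _; rewrite mulrAC [leRHS]mulrC ler_wpM2l ?ln_nat_ge0 //.
rewrite !mulr_sumr -big_split; apply: ler_sum_nat_cond => q /andP[q_gt0 leqN] qp /=.
have q0 : 0 < q%:R :> R by rewrite ltr0n.
have n_gt0 : (0 < N %/ q <= N)%N by rewrite divn_gt0 // -ltnS leqN leq_div.
have leqX : (0 < q <= X)%N by rewrite q_gt0 (leq_trans _ leNX).
have sq : is_sign (sigma * f q) by apply: is_signM => //; apply: f1.
have lenX : (N %/ q <= X)%N by rewrite (leq_trans (leq_div _ _)).
have z0 := zone_defect_ge0 (N %/ q).
have w0 : 0 <= ln q%:R / q%:R :> R by rewrite divr_ge0 ?ln_nat_ge0.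
have [->|fq] := f1 leqX.
  rewrite subrr mulr0 mulr1 addr_ge0 ?mulr_ge0 ?divr_ge0 ?ln_nat_ge0 //.
  exact: (deficiency_ge0 f1).
rewrite fq mulrN1 deficiencyN opprK.
have D := deficiency_le_zone n_gt0.
have n2 : N%:R <= 2 * (N %/ q)%:R * q%:R :> R.
  rewrite -!natrM ler_nat; have := ltn_ceil N q_gt0; case/andP: n_gt0 => n0 _ h.
  by apply: leq_trans (ltnW h) _; rewrite leq_mul2r; apply/orP; right; clear -n0; lia.
have nN : (N %/ q)%:R * q%:R <= N%:R :> R by rewrite -natrM ler_nat leq_divM.
move: (deficiency f sigma _) (zone_defect _) D z0 => d e D z0.
rewrite -subr_ge0.
have -> : 2 / N%:R * (ln q%:R * (2 * (N %/ q)%:R - d)) + 2 * (ln q%:R / q%:R * e) -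
    ln q%:R / q%:R * (1 + 1) =
  2 * (ln q%:R / q%:R) * ((2 * (N %/ q)%:R - d) * q%:R / N%:R + e - 1).
  by field; rewrite !gt_eqF.
apply: mulr_ge0; first by rewrite mulr_ge0.
rewrite subr_ge0 -lerBlDr ler_pdivlMr //.
move: (N %/ q)%N n2 nN D => n n2 nN D; nra.
Qed.

(** The first T + 1 indices are counted trivially; any later bad k has weight k - 1 >= T in
    [sum_bad_index_le]. *)
Lemma bad_count_le (T : nat) : (0 < T)%N ->
  bad_count <= T%:R + 1 + 3 * (delta * ln N%:R * (3 * ln N%:R + 24)) / (kappa * T%:R).
Proof.
move=> T_gt0; have T0 : 0 < T%:R :> R by rewrite ltr0n.
have leKN' : (C ^ K <= N)%N by case/andP: leKN.
have S := sum_bad_index_le fM f1 sigma1 N_gt0 leNX C_gt0 leKN' lnC16 def_N kappa_gt0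
  kappa_small.
rewrite -lerBlDl ler_pdivlMr ?mulr_gt0 //; apply: le_trans S.
rewrite mulrBl lerBlDr /bad_count.
have -> : (T%:R + 1 : R) = \sum_(1 <= k < T.+2) 1.
  by rewrite big_const_nat iter_addr_0 subn1 /= natr1.
rewrite !mulr_suml.
apply: (@le_trans _ _ (\sum_(1 <= k < mK.+1 | bad k) ((k%:R - 1) * kappa) +
  \sum_(1 <= k < mK.+1 | bad k && (k < T.+2)%N) kappa * T%:R)).
  rewrite [X in _ + X]big_mkcondr -big_split;
    apply: ler_sum_nat_cond => k /andP[k_gt0 _] _ /=.
  have k1 : 0 <= k%:R - 1 :> R by rewrite subr_ge0 ler1n.
  rewrite mul1r; case: ltnP => [_|ltTk]; first by rewrite lerDr mulr_ge0 // ltW.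
  rewrite addr0 mulrC ler_wpM2r ?(ltW kappa_gt0) // lerBrDr natr1 ler_nat.
  exact: ltnW.
rewrite lerD2l [leRHS](eq_bigr (fun=> kappa * T%:R)) => [|k _]; last by rewrite mul1r.
rewrite -[leLHS]big_filter; apply: ler_sum_subset; rewrite ?filter_uniq ?iota_uniq //;
  last first.
  by move=> k _; rewrite mulr_ge0 // ltW.
by move=> k; rewrite mem_filter !mem_index_iota => /andP[/andP[_ ->] /andP[->]].
Qed.
End Zones.

(** * From N to X: the twist by 1 at large primes *)

Definition smooth_twist (R : realType) (f : nat -> R) (N n : nat) : R :=
  f (n`_[pred q : nat | q <= N])%N.

Section Far.
Variables (R : realType) (f : nat -> R) (X N C K : nat) (sigma delta kappa v : R).
Hypothesis fM : forall m n, (0 < m)%N -> (0 < n)%N -> f (m * n)%N = f m * f n.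
Hypothesis f1 : forall n, (0 < n <= X)%N -> f n = 1 \/ f n = -1.
Hypothesis sigma1 : is_sign sigma.
Hypothesis N_gt1 : (1 < N)%N.
Hypothesis leNX : (N <= X)%N.
Hypothesis C_gt1 : (1 < C)%N.
Hypothesis leKN : (C ^ K <= N < C ^ K.+1)%N.
Hypothesis lnC16 : 16 <= ln (C%:R : R).
Hypothesis def_N : deficiency f sigma N <= delta * N%:R.
Hypothesis kappa_gt0 : 0 < kappa.
Hypothesis kappa_small : kappa * C%:R ^+ 2 < 2^-1.
Hypothesis delta_kappa : delta <= kappa.

Local Notation g := (smooth_twist f N).
Local Notation pi := [pred q : nat | (q <= N)%N].
Local Notation L := (ln (N%:R : R)).
Local Notation ZB := (zone_bound f N C K sigma kappa).

Let N_gt0 : (0 < N)%N := ltnW N_gt1.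

Lemma smooth_twistM m n : (0 < m)%N -> (0 < n)%N -> g (m * n)%N = g m * g n.
Proof. by move=> m0 n0; rewrite /smooth_twist partnM // fM ?part_gt0. Qed.

Lemma smooth_twist_sign n : (0 < n <= X)%N -> g n = 1 \/ g n = -1.
Proof.
move=> /andP[n0 nX]; apply: f1; rewrite part_gt0 /= (leq_trans _ nX) //.
by rewrite dvdn_leq // dvdn_part.
Qed.

Lemma smooth_twist_id n : (0 < n)%N -> (forall q, prime q -> (q %| n)%N -> (q <= N)%N) ->
  g n = f n.
Proof.
move=> n0 lt_q; rewrite /smooth_twist part_pnat_id // /pnat n0.
by apply/allP => q; rewrite mem_primes => /and3P[qp _ /(lt_q _ qp)].
Qed.

Lemma smooth_twist_small n : (0 < n <= N)%N -> g n = f n.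
Proof.
move=> /andP[n0 nN]; apply: smooth_twist_id => // q _ /(dvdn_leq n0) qn.
exact: leq_trans nN.
Qed.

Lemma smooth_twist_large q : prime q -> (N < q)%N -> g q = 1.
Proof.
move=> qp ltNq; rewrite /smooth_twist part_p'nat; last by rewrite pnatE // !inE -ltnNge.
have := fM (ltn0Sn 0) (ltn0Sn 0); rewrite muln1.
have /f1[//|E1] : (0 < 1 <= X)%N by rewrite (leq_trans N_gt0 leNX).
by rewrite E1 mulrNN mulr1.
Qed.

Lemma deficiency_smooth n : (n <= N)%N -> deficiency g sigma n = deficiency f sigma n.
Proof.
move=> nN; rewrite /deficiency big_nat_cond [RHS]big_nat_cond.
apply: eq_bigr => m /andP[/andP[m0 mn] _]; rewrite smooth_twist_small // m0.
exact: leq_trans (ltnSE mn) nN.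
Qed.

(** Strong induction through [sum_ln_deficiency_ge]. Primes q <= x/N keep x/q >= N and use the
    induction hypothesis, with mass at most ln x - L + 12; for larger q the scale x/q is at most N
    and [zone_defect] applies. Passing from sigma g(q) to sigma costs 1 - f(q) for q <= N and
    nothing for q > N. The hypothesis on v says that v (L - 12) covers these errors. *)
Lemma deficiency_smooth_le x : 0 <= v ->
  6 + (2 * delta * L + 2 * ZB L) + ZB (2 * L) <= v * (L - 12) ->
  (N <= x <= X)%N -> ln x%:R <= 2 * L -> deficiency g sigma x <= v * x%:R.
Proof.
move=> v_ge0 v_large; have [g1 gM] := (smooth_twist_sign, smooth_twistM).
have W := sum_negative_le fM f1 sigma1 N_gt0 leNX C_gt1 leKN lnC16 def_N kappa_gt0
  kappa_small delta_kappa.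
elim/ltn_ind: x => x IH /andP[leNx lexX] lnx.
have x_gt0 : (0 < x)%N := leq_trans N_gt0 leNx.
have x0 : 0 < x%:R :> R by rewrite ltr0n.
have lnx0 : 0 < ln x%:R :> R by rewrite ln_gt0 // ltr1n (leq_trans N_gt1).
have Z := sum_zone_defect_le f K sigma N_gt0 C_gt1 kappa_gt0 leNx.
rewrite -(ler_pM2l lnx0).
apply: le_trans (sum_ln_deficiency_ge gM g1 sigma1 lexX) _.
have step q : (1 <= q < x.+1)%N -> prime q ->
    ln q%:R * deficiency g (sigma * g q) (x %/ q) <=
    x%:R * (v * (if (q <= x %/ N)%N then ln q%:R / q%:R else 0) +
            ln q%:R / q%:R * zone_defect f N C K sigma kappa (x %/ q) +
            (if (q <= N)%N then ln q%:R / q%:R * (1 - f q) else 0)).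
  move=> /andP[q_gt0 ltqx] qp; have q0 : 0 < q%:R :> R by rewrite ltr0n.
  have n_gt0 : (0 < x %/ q)%N by rewrite divn_gt0.
  have nX : (x %/ q <= X)%N by rewrite (leq_trans (leq_div _ _)).
  have nq : (x %/ q)%:R <= x%:R / q%:R :> R by rewrite ler_pdivlMr // -natrM ler_nat
    leq_divM.
  have lnq := ln_nat_ge0 R q.
  have z0 := zone_defect_ge0 f N C K sigma kappa_gt0 (x %/ q)%N.
  have D1 : deficiency g sigma (x %/ q) <= (x %/ q)%:R *
      (v * (if (q <= x %/ N)%N then 1 else 0) + zone_defect f N C K sigma kappa (x %/ q)).
    case: ifP => [leq|/negbT].
      have nx : (x %/ q < x)%N by rewrite ltn_Pdiv // prime_gt1.
      have leNn : (N <= x %/ q <= X)%N by rewrite nX andbT leq_divRL // mulnC -leq_divRL.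
      apply: le_trans (IH _ nx leNn _) _.
        by apply: le_trans lnx; rewrite ler_ln_nat // ltnW.
      by rewrite mulr1 mulrC ler_wpM2l // lerDl.
    rewrite -ltnNge ltn_divLR // => ltxq.
    have nN : (x %/ q <= N)%N by rewrite ltnW // ltn_divLR // mulnC.
    rewrite mulr0 add0r deficiency_smooth //.
    have n_int : (0 < x %/ q <= N)%N by rewrite n_gt0.
    exact: (deficiency_le_zone f1 sigma1 N_gt0 leNX C_gt1 leKN lnC16 def_N
              kappa_gt0 kappa_small delta_kappa n_int).
  have D2 : deficiency g (sigma * g q) (x %/ q) <=
      deficiency g sigma (x %/ q) + (x %/ q)%:R * (1 - g q).
    have /g1[->|->] : (0 < q <= X)%N by rewrite q_gt0 (leq_trans (ltnSE ltqx) lexX).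
      by rewrite mulr1 subrr mulr0 addr0.
    rewrite mulrN1 deficiencyN; have := deficiency_ge0 g1 sigma1 nX.
    by move: (deficiency _ _ _) => d; lra.
  have D3 : 1 - g q = if (q <= N)%N then 1 - f q else 0.
    case: leqP => [leqN|ltNq]; first by rewrite smooth_twist_small ?q_gt0.
    by rewrite smooth_twist_large // subrr.
  have h0 : 0 <= if (q <= N)%N then 1 - f q else 0.
    case: ifP => // leqN.
    have /f1[->|->] : (0 < q <= X)%N by rewrite q_gt0 (leq_trans leqN leNX).
      by rewrite subrr.
    by rewrite opprK.
  rewrite D3 in D2; move: D1 D2 h0 z0; set e := zone_defect f N C K sigma kappa (x %/ q).
  set d := deficiency g (sigma * g q) _; set d1 := deficiency g sigma _ => D1 D2 h0 z0.
  apply: (@le_trans _ _ (ln q%:R * (x%:R / q%:R * (v * (if (q <= x %/ N)%N then 1 else 0) +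
    e + if (q <= N)%N then 1 - f q else 0)))).
    rewrite ler_wpM2l //; apply: (le_trans D2).
    apply: (@le_trans _ _ ((x %/ q)%:R * (v * (if (q <= x %/ N)%N then 1 else 0) + e + if
      (q <= N)%N then 1 - f q else 0))).
      by rewrite mulrDr lerD2r.
    apply: ler_wpM2r => //; apply: addr_ge0 => //; apply: addr_ge0 => //.
    by apply: mulr_ge0 => //; case: ifP.
  rewrite le_eqVlt; apply/orP; left; apply/eqP.
  by case: ifP => _; case: ifP => _; field; rewrite gt_eqF.
apply: (@le_trans _ _ (x%:R * (v * mertens_sum R (x %/ N) + ZB (ln x%:R) +
    (2 * delta * L + 2 * ZB L)) + 6 * x%:R)).
  rewrite lerD2r; apply: le_trans (ler_sum_nat_cond step) _.
  rewrite -mulr_sumr !big_split /= ler_pM2l // -mulr_sumr.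
  have ext (F : nat -> R) (a : nat) : (a <= x)%N ->
      \sum_(1 <= q < x.+1 | prime q) (if (q <= a)%N then F q else 0) =
      \sum_(1 <= q < a.+1 | prime q) F q.
    move=> leax; rewrite (@big_cat_nat _ _ _ a.+1) //= [X in _ + X](_ : _ = 0).
      rewrite addr0 big_nat_cond [RHS]big_nat_cond.
      by apply: eq_bigr => q /andP[/andP[_ ltqa] _]; rewrite -ltnS ltqa.
    by rewrite big_nat_cond big1 // => q /andP[/andP[ltaq _] _]; rewrite leqNgt ltaq.
  rewrite !ext ?leq_div //.
  by apply: lerD => //; apply: lerD.
have xN_gt0 : (0 < x %/ N)%N by rewrite divn_gt0.
have /andP[_ M] := mertens_bounds R xN_gt0.
have lnxN : ln (x %/ N)%:R <= ln x%:R - L :> R.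
  by rewrite lerBrDr -lnM ?posrE ?ltr0n // -natrM; apply: ler_ln_nat; apply: leq_divM.
have ZBm : ZB (ln x%:R) <= ZB (2 * L).
  rewrite /zone_bound lerD2r; apply: ler_wpM2l; last by rewrite lerD2r.
  by rewrite mulr_ge0 ?exprn_ge0 // (ltW kappa_gt0).
have vM : v * mertens_sum R (x %/ N) <= v * (ln x%:R - L + 12).
  by apply: ler_wpM2l => //; apply: (le_trans M); rewrite lerD2r; exact: lnxN.
rewrite [leRHS](_ : _ = x%:R * (v * ln x%:R)); last by ring.
rewrite [6 * _]mulrC -mulrDr ler_pM2l //.
move: ZBm vM v_large; move: (ZB (ln x%:R)) (ZB (2 * L)) (ZB L) => z1 z2 z3 ZBm vM v_large.
lra.
Qed.

(** f and its twist differ only at n with a prime factor q > N; each such n costs at most 2, and q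
    has at most X/q multiples. *)
Lemma deficiency_twist_le : deficiency f sigma X <=
  deficiency g sigma X + 2 * X%:R * \sum_(N.+1 <= q < X.+1 | prime q) q%:R^-1.
Proof.
have X_gt0 : (0 < X)%N := leq_trans N_gt0 leNX.
apply: (@le_trans _ _ (deficiency g sigma X +
    2 * \sum_(1 <= n < X.+1) \sum_(N.+1 <= q < X.+1 | prime q && (q %| n)%N) 1)).
  rewrite -lerBlDl /deficiency -sumrB mulr_sumr; apply: ler_sum_nat => n /andP[n0 nX].
  have sf := @deficiency_term _ f X f1 sigma n sigma1;
    have sg := @deficiency_term _ g X smooth_twist_sign sigma n sigma1.
  rewrite n0 -ltnS nX in sf sg; have /andP[_ sf2] := sf isT; have /andP[sg0 _] := sg isT.
  have [eqfg|] := pselect (g n = f n).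
    by rewrite eqfg subrr mulr_ge0 // sumr_ge0.
  move=> neq; have [q [qp qn ltNq]] : exists q, [/\ prime q, (q %| n)%N & (N < q)%N].
    apply: contrapT => nq; apply: neq; apply: smooth_twist_id => // q qp qn.
    by rewrite leqNgt; apply/negP => ltNq; apply: nq; exists q.
  apply: (@le_trans _ _ 2); first by lra.
  rewrite ler_peMr // big_mkcond (bigD1_seq q) ?iota_uniq ?mem_index_iota ?ltNq //=;
    last first.
    by apply: leq_ltn_trans nX; apply: dvdn_leq.
  by rewrite qp qn lerDl sumr_ge0 // => i _; case: ifP.
rewrite lerD2l -mulrA ler_pM2l // (exchange_big_dep prime) /= => [|n q _ /andP[]//].
rewrite mulr_sumr; apply: ler_sum => q qp; rewrite (eq_bigl (fun n => q %| n)%N).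
  rewrite sum_multiples ?prime_gt0 // big_const_nat iter_addr_0 subn1 /=.
  by rewrite ler_pdivlMr ?ltr0n ?prime_gt0 // -natrM ler_nat leq_divM.
by move=> n; rewrite qp.
Qed.

Lemma deficiency_far : 0 <= v ->
  6 + (2 * delta * L + 2 * ZB L) + ZB (2 * L) <= v * (L - 12) -> ln X%:R <= 2 * L ->
  deficiency f sigma X <= (v + 2 * (ln (ln X%:R) - ln L + 15 / L)) * X%:R.
Proof.
move=> v_ge0 v_large lnX; apply: (le_trans deficiency_twist_le).
have rec := mertens_reciprocal R (_ : 1 < N <= X)%N.
rewrite N_gt1 in rec; move: (rec leNX) => {}rec.
have leNXX : (N <= X <= X)%N by rewrite leNX leqnn.
have D := deficiency_smooth_le v_ge0 v_large leNXX lnX.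
rewrite [leRHS](_ : _ = v * X%:R + 2 * X%:R * (ln (ln X%:R) - ln L + 15 / L)); last by ring.
by apply: lerD => //; rewrite ler_wpM2l ?mulr_ge0.
Qed.
End Far.

(** * Choice of the constants *)

Lemma deficiency_propagation (R : realType) (v0 : R) : 0 < v0 ->
  exists2 delta : R, 0 < delta & exists L0 : R, forall (f : nat -> R) (X N : nat) (sigma :
    R),
    (forall m n, (0 < m)%N -> (0 < n)%N -> f (m * n)%N = f m * f n) ->
    (forall n, (0 < n <= X)%N -> f n = 1 \/ f n = -1) -> is_sign sigma ->
    (N <= X)%N -> L0 <= ln (N%:R : R) -> ln (X%:R : R) <= 2 * ln N%:R ->
    deficiency f sigma N <= delta * N%:R ->
    deficiency f sigma X <= (v0 + 2 * (ln (ln X%:R) - ln (ln N%:R))) * X%:R.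
Proof.
move=> v0_gt0; pose v := v0 / 2; have v_gt0 : 0 < v by rewrite divr_gt0.
pose C := (Num.truncn (expR 16 : R)).+1.
have ltC : expR 16 < C%:R :> R by rewrite truncnS_gt.
have lnC16 : 16 <= ln (C%:R : R).
  rewrite -[leLHS]expRK ler_ln ?posrE ?expR_gt0 ?ltr0n //; exact: ltW.
have C_gt1 : (1 < C)%N.
  by rewrite -(ltr_nat R) (lt_trans _ ltC) // expR_gt1.
have C1 : 1 <= C%:R :> R by rewrite ler1n ltnW.
have C0 : 0 < C%:R :> R by rewrite (lt_le_trans ltr01).
(* [k4] is kappa C^4, the base value of [zone_defect]: v/100 serves the error budget, 1/4 the
   condition [kappa_small]. *)
pose k4 := Num.min (v / 100) (4^-1).
have v100 : 0 < v / 100 by rewrite divr_gt0 // ltr0n.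
have k4_gt0 : 0 < k4 by rewrite lt_min v100 invr_gt0 ltr0n.
have k4v : k4 <= v / 100 by rewrite /k4 ge_min lexx.
have k44 : k4 <= 4^-1 by rewrite /k4 ge_min lexx orbT.
pose kappa := k4 / C%:R ^+ 4.
have kappa_gt0 : 0 < kappa by rewrite divr_gt0 ?exprn_gt0.
have kC4 : kappa * C%:R ^+ 4 = k4 by rewrite divfK // gt_eqF ?exprn_gt0.
have kappa_small : kappa * C%:R ^+ 2 < 2^-1.
  apply: (@le_lt_trans _ _ (kappa * C%:R ^+ 4)); last by rewrite kC4; move: k44; lra.
  by rewrite ler_pM2l // ler_weXn2l.
pose mu : R := ln (4 * C%:R ^+ 2) + 15.
have mu_gt0 : 0 < mu.
  rewrite ltr_wpDl // ln_ge0 // -[1]mulr1 ler_pM ?exprn_ege1 //; lra.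
(* A stands for 600; what is used is A > 0 and 6/A = 1/100. *)
have [A [A_gt0 A6]] : exists A : R, 0 < A /\ 6 / A = 100^-1.
  by exists 600; split; [rewrite ltr0n|lra].
(* With T about eta L, the bad indices up to T cost 6 mu eta L = v L / 100; [d3] is chosen so that
   the later ones cost no more. *)
pose eta := v / (A * mu); have eta_gt0 : 0 < eta by rewrite divr_gt0 ?mulr_gt0.
pose d3 := v * kappa * eta / (18 * A * mu);
  have d3_gt0 : 0 < d3 by rewrite divr_gt0 // mulr_gt0 // mulr_gt0.
pose delta := Num.min kappa (Num.min (v / 100) d3).
have delta_gt0 : 0 < delta by rewrite /delta lt_min kappa_gt0 lt_min v100 d3_gt0.
have dk : delta <= kappa by rewrite /delta ge_min lexx.
have dv : delta <= v / 100 by rewrite /delta !ge_min lexx orbT.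
have dd : delta <= d3 by rewrite /delta !ge_min lexx !orbT.
exists delta => //; pose L1 := (12 * v + 6 + 12 * mu) / (v * (88 / 100)).
pose L0 := Num.max 12 (Num.max L1 (30 / v)).
exists L0 => f X N sigma fM f1 s1 leNX leL0 lnX def_N.
set L := ln N%:R in leL0 lnX *.
have [L12 L1L L30] : [/\ 12 <= L, L1 <= L & 30 / v <= L].
  by move: leL0; rewrite !ge_max => /andP[-> /andP[-> ->]].
have L_gt0 : 0 < L by rewrite (lt_le_trans _ L12).
have N_gt1 : (1 < N)%N.
  case: N @L {leNX def_N leL0 lnX L12 L1L L30} L_gt0 => [|[|//]] /=.
    by rewrite ln0 ?ltxx.
  by rewrite ln1 ltxx.
have N_gt0 := ltnW N_gt1.
have leKN := trunc_log_bounds C_gt1 N_gt0; set K := trunc_log C N in leKN.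
pose T := (Num.truncn (eta * L)).+1.
have T_gt : eta * L < T%:R by rewrite truncnS_gt.
have T_le : T%:R <= eta * L + 1.
  by rewrite /T -natr1 lerD2r truncn_le; apply: mulr_ge0; apply: ltW.
have bc := bad_count_le fM f1 s1 N_gt0 leNX C_gt1 leKN lnC16 def_N kappa_gt0 kappa_small
  (ltn0Sn _ : 0 < T)%N.
rewrite -/L in bc; move: bc; set B := bad_count _ _ _ _ _ _ => bc.
have T0 : 0 < T%:R :> R by rewrite ltr0n.
have eL : 0 < eta * L by rewrite mulr_gt0.
have bc2 : 3 * (delta * L * (3 * L + 24)) / (kappa * T%:R) <= 18 * delta * L / (kappa *
  eta).
  rewrite ler_pdivrMr; last by rewrite mulr_gt0.
  rewrite [leRHS]mulrAC ler_pdivlMr; last by rewrite mulr_gt0.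
  apply: (@le_trans _ _ (18 * delta * L * kappa * (eta * L))); last first.
    by rewrite -mulrA ler_pM2l; [rewrite ler_pM2l // ltW|rewrite mulr_gt0 // mulr_gt0].
  have h : 3 * L + 24 <= 6 * L by move: L12; lra.
  have -> : 3 * (delta * L * (3 * L + 24)) * (kappa * eta) =
     (3 * delta * L * kappa * eta) * (3 * L + 24) by ring.
  have -> : 18 * delta * L * kappa * (eta * L) = (3 * delta * L * kappa * eta) * (6 * L) by
    ring.
  by rewrite ler_pM2l // mulr_gt0 // mulr_gt0 // mulr_gt0 // mulr_gt0.
have muB : 6 * mu * B <= v * L * (2 / 100) + 12 * mu.
  apply: (@le_trans _ _ (6 * mu * (eta * L + 2 + 18 * delta * L / (kappa * eta)))).
    by rewrite ler_pM2l ?mulr_gt0 //; apply: (le_trans bc); move: bc2 T_le; lra.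
  have e1 : 6 * mu * (eta * L) = v * L / 100.
    by rewrite -A6 /eta; field; rewrite !gt_eqF.
  have e2 : 6 * mu * (18 * delta * L / (kappa * eta)) <= v * L / 100.
    apply: (@le_trans _ _ (6 * mu * (18 * d3 * L / (kappa * eta)))).
      apply: ler_wpM2l; first by rewrite mulr_ge0 // ltW.
      apply: ler_wpM2r; first by rewrite invr_ge0 mulr_ge0 // ltW.
      by apply: ler_wpM2r; [exact: ltW|apply: ler_wpM2l].
    rewrite le_eqVlt; apply/orP; left; apply/eqP.
    by rewrite -A6 /d3; field; rewrite !gt_eqF.
  have -> : 6 * mu * (eta * L + 2 + 18 * delta * L / (kappa * eta)) =
    6 * mu * (eta * L) + 12 * mu + 6 * mu * (18 * delta * L / (kappa * eta)) by ring.
  by rewrite e1; move: e2; set e3 := 6 * mu * _; lra.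
(* The budget in hundredths of v L: 8 for kappa C^4, 2 for delta, 2 for the bad zones; the other 88
   absorb the terms independent of L, since L >= L1. *)
have large : 6 + (2 * delta * L + 2 * zone_bound f N C K sigma kappa L) +
    zone_bound f N C K sigma kappa (2 * L) <= v * (L - 12).
  rewrite /zone_bound kC4 -/B -/mu.
  have h1 : k4 * (4 * L + 36) <= v * L * (8 / 100).
    apply: (@le_trans _ _ ((v / 100) * (8 * L))); last by lra.
    by apply: ler_pM; rewrite ?(ltW k4_gt0) //; move: L12; lra.
  have h2 : 2 * delta * L <= v * L * (2 / 100).
    rewrite (_ : v * L * (2 / 100) = 2 * (v / 100) * L); last by field.
    by rewrite ler_pM2r // ler_pM2l.
  have h3 : 12 * v + 6 + 12 * mu <= v * L * (88 / 100).
    have c_gt0 : 0 < v * (88 / 100) by rewrite mulr_gt0 // divr_gt0 ?ltr0n.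
    by rewrite [v * L]mulrC -mulrA -ler_pdivrMr.
  move: muB h1 h2 h3; rewrite (_ : 6 * mu * B = 6 * (B * mu)); last by ring.
  move: (B * mu) => x; lra.
have := deficiency_far fM f1 s1 N_gt1 leNX C_gt1 leKN lnC16 def_N kappa_gt0 kappa_small dk
  (ltW v_gt0) large lnX.
rewrite -/L => far; apply: (le_trans far); rewrite ler_wpM2r //.
have : 15 / L <= v / 2.
  rewrite ler_pdivrMr //; move: L30; rewrite ler_pdivrMr //; lra.
rewrite /v; lra.
Qed.

(** * Burgess' bound for initial segments *)

Lemma powR_eventually_ge (R : realType) (theta M : R) : 0 < theta ->
  exists p0 : nat, forall p : nat, (p0 <= p)%N -> M <= p%:R `^ theta.
Proof.
move=> th_gt0; pose M1 := Num.max M 1; have M1_ge : M <= M1 by rewrite le_max lexx.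
have M10 : 0 <= M1 by rewrite le_max ler01 orbT.
exists (Num.truncn (M1 `^ theta^-1)).+1 => p lep; apply: (le_trans M1_ge).
have -> : M1 = (M1 `^ theta^-1) `^ theta by rewrite -powRrM mulVf ?gt_eqF // powRr1.
rewrite ge0_ler_powR ?ltW ?nnegrE ?powR_ge0 //.
by apply: lt_le_trans (truncnS_gt _) _; rewrite ler_nat.
Qed.

Lemma nat_sqrt_exists (p : nat) : exists l, (l ^ 2 <= p < l.+1 ^ 2)%N.
Proof.
elim: p => [|p [l /andP[h1 h2]]]; first by exists 0%N.
have [lt|ge] := ltnP p.+1 (l.+1 ^ 2)%N.
  by exists l; rewrite lt andbT (leq_trans h1).
exists l.+1; rewrite ge /=; apply: leq_ltn_trans h2 _.
by rewrite ltn_exp2r.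
Qed.

Lemma nat_root_exists (l r : nat) : (0 < r)%N -> (0 < l)%N ->
  exists B, [/\ 0 < B, l <= B ^ r & B.-1 ^ r < l]%N.
Proof.
move=> r_gt0 l_gt0; have ex : exists B, (l <= B ^ r)%N.
  by exists l; rewrite -{1}[l]expn1 leq_pexp2l.
case: (ex_minnP ex) => B leB minB.
have B_gt0 : (0 < B)%N by case: B leB {minB} => // ; rewrite exp0n // leqNgt l_gt0.
exists B; split=> //; rewrite ltnNge; apply/negP => /minB.
by rewrite leqNgt prednK ?leqnn.
Qed.

Definition prime_range (A1 A : nat) : {set 'I_A.+1} :=
  [set a : 'I_A.+1 | prime a & (A1 < a)%N].

Lemma card_prime_range (A1 A : nat) :
  #|prime_range A1 A| = (\sum_(A1.+1 <= q < A.+1 | prime q) 1)%N.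
Proof.
rewrite (@big_nat_widenl _ _ _ A1.+1 0) // big_mkord -sum1_card.
by apply: eq_bigl => a; rewrite inE.
Qed.

(** For x above a multiple of sqrt p the multiplier a = 1 is enough: the O(sqrt p) exceptional
    points are few among the n <= x. *)
Lemma burgess_long (p : nat) (p_pr : prime p) (p_odd : odd p) (r l B d x : nat) :
  (0 < d)%N -> (0 < B < p)%N -> (l ^ 2 <= p < l.+1 ^ 2)%N -> (8 * r + 6 <= l)%N -> (l <= B
    ^ r)%N ->
  (2 * d * B <= x <= p)%N ->
  (d ^ 2 * (d ^ (2 * r) * (r ^ (2 * r) + 16 * r + 8) * p) <= l * x)%N ->
  d%:Z * `|qchar_sum p x| <= (3 * x)%:Z.
Proof.
move=> d_gt0 Bp lp lr lB /andP[dBx xp] K_le.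
apply: (@burgess_energy p p_pr p_odd r l B d 1 x [set ord_max : 'I_2]) => //.
- exact: prime_gt1.
- by rewrite muln1.
- by rewrite cards1.
- by move=> a; rewrite inE => /eqP ->.
rewrite cards1 mul1n -(mulnn x) [leqRHS]mulnA leq_mul //.
exact: (energy_one p_pr xp).
Qed.

(** With the primes of (A1, A] as multipliers, [energy] is at most |AA| (A1 x + A x + A A1) / A1;
    the lower bound A1 / ln A for |AA| makes it small against (|AA| x)^2. *)
Lemma burgess_mid (R : realType) (p : nat) (p_pr : prime p) (p_odd : odd p)
    (r l B d A1 A x : nat) :
  (0 < d)%N -> (0 < B < p)%N -> (l ^ 2 <= p < l.+1 ^ 2)%N -> (8 * r + 6 <= l)%N -> (l <= B
    ^ r)%N ->
  (2 * d * A * B <= x)%N -> (A * x < p)%N -> (0 < A1 <= A)%N -> (0 < x)%N ->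
  16 <= ln A%:R - ln A1%:R :> R ->
  (d ^ 2 * (d ^ (2 * r) * (r ^ (2 * r) + 16 * r + 8) * p))%N%:R * (A1 * x + A * x + A *
    A1)%N%:R * ln A%:R
    <= (l * A1 ^ 2 * x ^ 2)%N%:R :> R ->
  d%:Z * `|qchar_sum p x| <= (3 * x)%:Z.
Proof.
move=> d_gt0 Bp lp lr lB dAB Axp A1A x_gt0 ln16 K_le.
have /andP[A1_gt0 leA] := A1A.
have A_gt0 := leq_trans A1_gt0 leA.
have AAP a : a \in prime_range A1 A -> prime a && (A1.+1 <= a)%N by rewrite inE.
have cA : (#|prime_range A1 A| <= A)%N.
  have E0 : #|[set~ (ord0 : 'I_A.+1)]%SET| = A by rewrite cardsC1 card_ord.
  rewrite -[leqRHS]E0; apply: subset_leq_card.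
  by apply/fintype.subsetP => a /AAP/andP[/prime_gt0 a_gt0 _];
    rewrite !inE -val_eqE /= -lt0n.
have E_le := energy_primes p_pr Axp (ltn0Sn A1) AAP.
have c_ge := @card_primes_interval R A1 A A1A ln16; rewrite -card_prime_range in c_ge.
apply: (@burgess_energy p p_pr p_odd r l B d A x (prime_range A1 A)) => //.
- by apply: leq_ltn_trans Axp; rewrite leq_pmulr.
- rewrite lt0n; apply: contraL c_ge => /eqP ->.
  by rewrite mul0r -ltNge ltr0n.
- by move=> a /AAP/andP[/prime_gt0].
move: E_le c_ge cA K_le; set E := energy _ _ _; set c := #|_|; set Kc := (d ^ 2 * _)%N.
move=> E_le c_ge cA K_le.
have lnA0 : 0 < ln A%:R :> R.
  by have := ln_nat_ge0 R A1; move: ln16; lra.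
have A10 : 0 < A1%:R :> R by rewrite ltr0n.
have EA : (E * A1 <= c * (A1 * x + A * x + A * A1))%N.
  apply: leq_trans (leq_mul E_le (leqnn A1)) _.
  have h1 : (x %/ A1.+1 * A1 <= x)%N.
    by apply: leq_trans (leq_divM x A1.+1); rewrite leq_mul2l leqnSn orbT.
  have h2 : (c * c * (x + A1) <= c * A * (x + A1))%N by rewrite leq_mul2r leq_mul2l cA
    !orbT.
  have h3 : (c * c * (x %/ A1.+1 * A1 + A1) <= c * c * (x + A1))%N.
    by rewrite leq_mul2l leq_add2r h1 orbT.
  rewrite -/c expnS expn1.
  rewrite (_ : (c * x + c * c * (x %/ A1.+1).+1) * A1 = c * x * A1 + c * c * (x %/ A1.+1 *
    A1 + A1))%N.
    apply: leq_trans (leq_add (leqnn _) (leq_trans h3 h2)) _.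
    by rewrite eq_leq //; ring.
  by rewrite -addn1; ring.
rewrite -(ler_nat R) natrM -(ler_pM2r A10) -(ler_pM2r lnA0).
have c0 : 0 <= c%:R :> R by [].
apply: (@le_trans _ _ (Kc%:R * (c * (A1 * x + A * x + A * A1))%N%:R * ln A%:R)).
  by rewrite ler_pM2r // -mulrA ler_wpM2l // -natrM ler_nat.
apply: (@le_trans _ _ (c%:R * (l * A1 ^ 2 * x ^ 2)%N%:R)).
  by rewrite natrM mulrCA -mulrA ler_wpM2l.
have -> : c%:R * (l * A1 ^ 2 * x ^ 2)%N%:R = (l * x ^ 2 * c * A1)%N%:R * A1%:R :> R.
  by rewrite -!natrM; congr (_%:R); ring.
have -> : (l * (c * x) ^ 2)%N%:R * A1%:R * ln A%:R = (l * x ^ 2 * c * A1)%N%:R * (c%:R * ln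
  A%:R) :> R.
  by rewrite mulrA -!natrM; congr (_%:R * _); ring.
by rewrite ler_wpM2l.
Qed.

Lemma ln_powR_eventually (R : realType) (eps M : R) : 0 < eps -> 0 <= M ->
  exists p0 : nat, forall p : nat, (p0 <= p)%N -> M * ln p%:R <= p%:R `^ eps.
Proof.
move=> eps_gt0 M_ge0; have e2 : 0 < eps / 2 by rewrite divr_gt0.
have [p0 p0P] := powR_eventually_ge (M * (2 / eps)) e2.
exists p0.+1 => p lep; have p_gt0 : 0 < p%:R :> R by rewrite ltr0n (leq_ltn_trans _ lep).
have {p0P} := p0P p (ltnW lep).
have -> : eps = eps / 2 + eps / 2 by lra.
rewrite (@powRD _ p%:R); last by rewrite (gt_eqF p_gt0) implybT.
rewrite -splitr.
have lnE : ln p%:R = (2 / eps) * ln (p%:R `^ (eps / 2)) :> R.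
  by rewrite ln_powR; field; rewrite gt_eqF.
have pw0 : 0 < p%:R `^ (eps / 2) :> R by rewrite powR_gt0.
have lnle := ltW (ln_sublinear pw0).
move=> Mle; rewrite lnE mulrA.
apply: (@le_trans _ _ (M * (2 / eps) * p%:R `^ (eps / 2))).
  by rewrite ler_wpM2l // mulr_ge0 // divr_ge0 // ltW.
by rewrite ler_wpM2r // ltW.
Qed.

Lemma burgess_asymptotic (R : realType) (c eps : R) : 0 < c -> 0 < eps ->
  exists p0 : nat, forall p : nat, prime p -> odd p -> (p0 <= p)%N ->
    forall x : nat, p%:R `^ (4^-1 + eps) <= x%:R :> R -> (x <= p)%N ->
    `|(qchar_sum p x)%:~R| <= c * x%:R :> R.
Proof.
move=> c_gt0 eps_gt0.
(* d > 3/c converts d |S| <= 3x into |S| <= cx; r > 1/(2 eps) keeps B, of size about p^(1/(2r)),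
   below 2 p^eps. *)
pose d := (Num.truncn (3 / c)).+1; have d_gt : 3 / c < d%:R by rewrite truncnS_gt.
have d_gt0 : (0 < d)%N by [].
pose r := (Num.truncn (2 * eps)^-1).+1;
  have r_gt : (2 * eps)^-1 < r%:R by rewrite truncnS_gt.
have r_gt0 : (0 < r)%N by [].
have er : 2^-1 <= eps * r%:R.
  have -> : 2^-1 = eps * (2 * eps)^-1 by field; rewrite gt_eqF.
  by rewrite ler_pM2l // ltW.
pose C0 := (Num.truncn (expR 16 : R)).+1.
have lnC16 : 16 <= ln (C0%:R : R).
  rewrite -[leLHS]expRK ler_ln ?posrE ?expR_gt0 ?ltr0n //; exact/ltW/truncnS_gt.
have C0_gt0 : (0 < C0)%N by [].
pose K0 := (d ^ 2 * (d ^ (2 * r) * (r ^ (2 * r) + 16 * r + 8)))%N.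
have K0_gt0 : (0 < K0)%N.
  by rewrite !muln_gt0 !expn_gt0 d_gt0 /= addn_gt0 orbT.
clearbody d r C0.
pose K2 := (K0 * (2 + 2 * C0) * (8 * C0 * d))%N.
have [p1 p1P] := @ln_powR_eventually R eps (4 * K2%:R) eps_gt0 (mulr_ge0 (ler0n _ 4) (ler0n
  _ K2)).
have q4 : 0 < 4^-1 :> R by rewrite invr_gt0 ltr0n.
have [p2 p2P] := @powR_eventually_ge R 4^-1 (4 * d * C0)%N%:R q4.
(* The last entry gives B^r >= l >= (8 K0^2)^r, hence B >= 8 K0^2, which later yields A x < p. *)
pose M := maxn 2 (maxn (8 * r + 6) ((8 * K0 ^ 2) ^ r)).
exists (maxn p1 (maxn p2 (M ^ 2))) => p p_pr p_odd;
  rewrite !geq_max => /and3P[lep1 lep2 leM].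
move=> x x_ge x_le.
have p_gt0 : (0 < p)%N := prime_gt0 p_pr.
have p0 : 0 < p%:R :> R by rewrite ltr0n.
have {p1P} bln := p1P p lep1; have {p2P} a_ge := p2P p lep2.
have [l lp] := nat_sqrt_exists p; have /andP[lp1 lp2] := lp.
have leMl : (M <= l)%N.
  by rewrite -ltnS -(@ltn_exp2r _ _ 2) //; apply: leq_ltn_trans lp2.
move: leMl; rewrite /M !geq_max => /and3P[l2 l8 lK].
have l_gt0 : (0 < l)%N := ltnW l2.
have ltlp : (l < p)%N by apply: leq_trans lp1;
  rewrite expnS expn1 -[ltnLHS]muln1 ltn_pmul2l.
have [B [B_gt0 lB Bl]] := nat_root_exists r_gt0 l_gt0.
pose a : R := p%:R `^ 4^-1; pose b : R := p%:R `^ eps.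
have a0 : 0 < a by rewrite powR_gt0.
have b0 : 0 < b by rewrite powR_gt0.
have a4 : a ^+ 4 = p%:R by rewrite -powR_mulrn ?ltW // -powRrM mulVf ?pnatr_eq0 // powRr1.
have xab : a * b <= x%:R.
  by rewrite -powRD // (gt_eqF p0) implybT.
have la : l%:R <= a ^+ 2.
  rewrite -(@ler_pXn2r _ 2) ?nnegrE ?exprn_ge0 ?(ltW a0) // -exprM a4 -natrX ler_nat //.
have al : a ^+ 2 <= 2 * l%:R.
  apply: (@le_trans _ _ l.+1%:R).
    rewrite -(@ler_pXn2r _ 2) ?nnegrE ?exprn_ge0 ?(ltW a0) // -exprM a4 -natrX ler_nat.
    exact: ltnW.
  by rewrite -natrM ler_nat; clear -l_gt0; lia.
have B2 : (2 <= B)%N.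
  rewrite ltnNge; apply: contraL lB => B1; have -> : B = 1%N by apply/eqP;
    rewrite eqn_leq B1.
  by rewrite exp1n -ltnNge.
have Bb : B%:R <= 2 * b.
  have B2' : (B <= 2 * B.-1)%N by clear -B2; lia.
  rewrite -(@ler_pXn2r _ r) ?nnegrE ?mulr_ge0 ?(ltW b0) //.
  apply: (@le_trans _ _ (2 ^ r * l)%N%:R).
    rewrite -natrX ler_nat; apply: (@leq_trans ((2 * B.-1) ^ r)%N);
      first by rewrite leq_exp2r.
    by rewrite expnMn leq_mul2l ltnW ?orbT.
  rewrite natrM natrX exprMn ler_wpM2l ?exprn_ge0 //; apply: (le_trans la).
  rewrite /a /b -!powR_mulrn ?powR_ge0 // -!powRrM ler_powR ?ler1n //.
  by apply: le_trans er; lra.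
have Blel : (B <= l)%N.
  rewrite -(prednK B_gt0); apply: leq_ltn_trans Bl.
  by rewrite -[leqLHS]expn1 leq_pexp2l //; clear -B2; lia.
have Bp : (0 < B < p)%N by rewrite B_gt0 (leq_ltn_trans Blel).
have xdB : (2 * d * B * C0 <= x)%N.
  rewrite -(ler_nat R); apply: le_trans xab.
  apply: (@le_trans _ _ ((4 * d * C0)%N%:R * b)); last by rewrite ler_pM2r.
  rewrite (_ : (2 * d * B * C0) = (2 * d * C0) * B)%N; last by ring.
  rewrite (_ : (4 * d * C0) = (2 * d * C0) * 2)%N; last by ring.
  by rewrite natrM [X in _ <= X * b]natrM -mulrA ler_wpM2l.
have x_gt0 : (0 < x)%N by apply: leq_trans xdB; rewrite !muln_gt0 d_gt0 B_gt0 C0_gt0.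
suff S_le : d%:Z * `|qchar_sum p x| <= (3 * x)%:Z.
  have : (d%:R : R) * `|(qchar_sum p x)%:~R| <= 3 * x%:R.
    by move: S_le; rewrite -(ler_int R) intrM intr_norm -!pmulrn natrM.
  have d0 : 0 < d%:R :> R by rewrite ltr0n.
  rewrite mulrC -ler_pdivlMr // => le1; apply: (le_trans le1); rewrite mulrAC ler_wpM2r //.
  by rewrite ler_pdivrMr // mulrC -ler_pdivrMr // ltW.
have K0E : (d ^ 2 * (d ^ (2 * r) * (r ^ (2 * r) + 16 * r + 8) * p) = K0 * p)%N.
  by rewrite /K0 !mulnA.
have [long|short] := leqP (K0 * p) (l * x).
  apply: (@burgess_long p p_pr p_odd r l B d x) => //; last by rewrite K0E.
  by rewrite x_le andbT (leq_trans _ xdB) // leq_pmulr.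
(* A is the longest range that the shift error 2dAB <= x permits; A1 leaves the logarithmic length
   16 required for primes. *)
pose A := (x %/ (2 * d * B))%N; pose A1 := (A %/ C0)%N.
have dB_gt0 : (0 < 2 * d * B)%N by rewrite !muln_gt0 d_gt0 B_gt0.
have C0A : (C0 <= A)%N by rewrite leq_divRL // mulnC.
have A_gt0 : (0 < A)%N := leq_trans C0_gt0 C0A.
have A1_gt0 : (0 < A1)%N by rewrite divn_gt0.
have A1A : (A1 <= A)%N by apply: leq_div.
have AdB : (A * (2 * d * B) <= x)%N by apply: leq_divM.
have xdBA : (x <= 2 * A * (2 * d * B))%N.
  apply: leq_trans (ltnW (ltn_ceil x dB_gt0)) _; rewrite leq_mul2r -/A; apply/orP; right.
  by clear -A_gt0; lia.
have AC : (A <= 2 * A1 * C0)%N.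
  apply: leq_trans (ltnW (ltn_ceil A C0_gt0)) _; rewrite leq_mul2r -/A1; apply/orP; right.
  by clear -A1_gt0; lia.
have Ax : (A <= x)%N by apply: leq_trans AdB; rewrite leq_pmulr.
have x4 : (x < 4 * K0 * l)%N.
  rewrite -(ltn_pmul2l l_gt0); apply: (leq_trans short).
  rewrite (_ : l * (4 * K0 * l) = K0 * (4 * l ^ 2))%N; last by ring.
  rewrite leq_pmul2l //; apply: leq_trans (ltnW lp2) _.
  rewrite (_ : 4 * l ^ 2 = (2 * l) ^ 2)%N; last by ring.
  by rewrite leq_exp2r //; clear -l_gt0; lia.
have BK : (8 * K0 ^ 2 <= B)%N.
  by rewrite -(leq_exp2r _ _ r_gt0); apply: leq_trans lB.
have Axp : (A * x < p)%N.
  rewrite -(ltn_pmul2r dB_gt0); apply: (@leq_ltn_trans (x ^ 2)).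
    by rewrite mulnAC expnS expn1 leq_mul2r AdB orbT.
  apply: (@leq_trans ((4 * K0 * l) ^ 2)%N); first by rewrite ltn_exp2r.
  rewrite (_ : (4 * K0 * l) ^ 2 = l ^ 2 * (2 * (8 * K0 ^ 2)))%N; last by ring.
  apply: leq_mul => //; rewrite -mulnA leq_pmul2l //.
  by apply: leq_trans BK _; rewrite leq_pmull.
apply: (@burgess_mid R p p_pr p_odd r l B d A1 A x) => //.
- by rewrite (_ : 2 * d * A * B = A * (2 * d * B))%N //; ring.
- by rewrite A1_gt0.
- rewrite lerBrDr; apply: (@le_trans _ _ (ln C0%:R + ln A1%:R)); first by rewrite lerD2r.
  rewrite -lnM ?posrE ?ltr0n // -natrM; apply: ler_ln_nat.
  by rewrite mulnC leq_divM.
rewrite K0E.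
have A1x : (A1 * x + A * x + A * A1 <= A1 * x * (2 + 2 * C0))%N.
  have h1 : (A * x <= 2 * A1 * C0 * x)%N by rewrite leq_mul2r AC orbT.
  have h2 : (A * A1 <= x * A1)%N by rewrite leq_mul2r Ax orbT.
  by clear -h1 h2; lia.
have lnAp : ln A%:R <= ln p%:R :> R by apply: ler_ln_nat; apply: leq_trans Ax x_le.
have xA1 : (x <= A1 * (8 * C0 * d) * B)%N.
  apply: (leq_trans xdBA);
    rewrite (_ : A1 * (8 * C0 * d) * B = 2 * (2 * A1 * C0) * (2 * d * B))%N; last by ring.
  by rewrite leq_mul2r leq_mul2l AC !orbT.
(* Up to constants p B ln p <= sqrt p x^2: with x >= p^(1/4 + eps) and B <= 2 p^eps a factor p^eps
   is left, which absorbs 4 K2 ln p. *)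
have main : (K2 * p)%N%:R * B%:R * ln p%:R <= (l * x ^ 2)%N%:R :> R.
  apply: (@le_trans _ _ (K2%:R * a ^+ 4 * (2 * b) * ln p%:R)).
    by rewrite natrM a4 ler_wpM2r ?ln_nat_ge0 // ler_wpM2l.
  apply: (@le_trans _ _ (l%:R * (a * b) ^+ 2)); last first.
    by rewrite natrM natrX ler_wpM2l // lerXn2r ?nnegrE ?mulr_ge0 ?(ltW a0) ?(ltW b0).
  apply: (@le_trans _ _ (a ^+ 2 / 2 * (a * b) ^+ 2)); last first.
    by rewrite ler_wpM2r ?sqr_ge0 // ler_pdivrMr // mulrC.
  rewrite (_ : K2%:R * a ^+ 4 * (2 * b) * ln p%:R = a ^+ 4 * b / 2 * (4 * K2%:R * ln
    p%:R)); last by field.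
  rewrite (_ : a ^+ 2 / 2 * (a * b) ^+ 2 = a ^+ 4 * b / 2 * b); last by field.
  by rewrite ler_wpM2l // !mulr_ge0 ?exprn_ge0 ?(ltW a0) ?(ltW b0).
have e0 : 0 < (8 * C0 * d * B)%N%:R :> R by rewrite ltr0n !muln_gt0 C0_gt0 d_gt0 B_gt0.
rewrite -(ler_pM2r e0).
apply: (@le_trans _ _ ((K0 * p)%N%:R * (A1 * x * (2 + 2 * C0))%N%:R * ln p%:R * (8 * C0 * d
  * B)%N%:R)).
  rewrite ler_pM2r //; apply: ler_pM; rewrite ?mulr_ge0 ?ln_nat_ge0 //.
  by rewrite ler_wpM2l // ler_nat.
apply: (@le_trans _ _ ((A1 * x)%N%:R * (l * x ^ 2)%N%:R)).
  apply: le_trans (ler_wpM2l (ler0n _ _) main).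
  by rewrite /K2 le_eqVlt; apply/orP; left; apply/eqP; rewrite !(natrM, natrD, natrX); ring.
rewrite -!natrM ler_nat (_ : A1 * x * (l * x ^ 2) = l * A1 * x ^ 2 * x)%N; last by ring.
rewrite (_ : l * A1 ^ 2 * x ^ 2 * (8 * C0 * d * B) = l * A1 * x ^ 2 * (A1 * (8 * C0 * d) *
  B))%N; last by ring.
by rewrite leq_mul2l xA1 orbT.
Qed.

(** * Conclusion *)

Lemma deficiency_qchar (R : realType) (p : nat) (tau : R) (n : nat) :
  deficiency (fun m => (qchar (m%:R : 'F_p))%:~R) tau n = n%:R - tau * (qchar_sum p n)%:~R.
Proof.
rewrite /deficiency sumrB big_const_nat iter_addr_0 subn1 /= -mulr_sumr; congr (_ - _ * _).
by rewrite /qchar_sum rmorph_sum big_add1 /= big_mkord.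
Qed.

Lemma ln_eventually_ge (R : realType) (M : R) :
  exists p0 : nat, forall p : nat, (p0 <= p)%N -> M <= ln p%:R.
Proof.
exists (Num.truncn (expR M)).+1 => p lep.
have ltp : expR M < p%:R by apply: lt_le_trans (truncnS_gt _) _; rewrite ler_nat.
by rewrite -[leLHS]expRK ler_ln ?posrE ?expR_gt0 ?(lt_trans (expR_gt0 M)) // ltW.
Qed.

Lemma two_ln_lt1_le2 (R : realType) (u : R) : 2 * ln u < 1 -> u <= 2.
Proof.
move=> lnu; rewrite leNgt; apply/negP => u2.
have h := @ln_sub_le R 1 2 ltr01 (ltr0n _ 2); rewrite ln1 in h.
have : ln 2 < ln u by rewrite ltr_ln ?posrE // (lt_trans _ u2).
by lra.
Qed.

Theorem theorem2p1 (R : realType) (eps : R) (heps : 0 < eps) :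
  exists2 delta : R, 0 < delta &
    exists p0 : nat, forall p : nat, prime p -> odd p -> (p0 <= p)%N ->
      forall N : nat,
        p%:R `^ (1 / (4 * Num.sqrt (expR 1)) + eps) <= N%:R :> R ->
        (N <= p)%N ->
        `|(legendre_sum p (N%:R : R))%:~R| <= (1 - delta) * N%:R :> R.
Proof.
set s := Num.sqrt (expR 1 : R); set g0 : R := 1 / (4 * s).
have s1 : 1 < s by rewrite -[ltLHS]sqrtr1 ltr_sqrt ?expR_gt0 // expR_gt1.
have s0 : 0 < s := lt_trans ltr01 s1.
have g0_gt0 : 0 < g0 by rewrite divr_gt0 // mulr_gt0.
(* u will bound log X / log N for X near p^(1/4 + eps/4); the numerator keeps another eps/4 for
   rounding. It is below s because s (g0 + eps) = 1/4 + s eps and s > 1. *)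
pose u : R := (4^-1 + eps / 2) / (g0 + eps).
have ge0 : 0 < g0 + eps by rewrite addr_gt0.
have u_gt0 : 0 < u by rewrite divr_gt0 // addr_gt0 ?invr_gt0 ?divr_gt0.
have us : u < s.
  rewrite ltr_pdivrMr // mulrDr /g0; have -> : s * (1 / (4 * s)) = 4^-1 by field;
    rewrite gt_eqF.
  by rewrite ltrD2l; nra.
have lnu : 2 * ln u < 1.
  have e1 : ln (s ^+ 2) = 1 by rewrite sqr_sqrtr ?expRK // expR_ge0.
  by rewrite -[ltRHS]e1 lnXn // mulr_natl ltrMn2r //= ltr_ln ?posrE.
have u2 := two_ln_lt1_le2 lnu.
pose eta := 1 - 2 * ln u; have eta_gt0 : 0 < eta by rewrite subr_gt0.
(* The final comparison is 1 - c <= eta/4 + 2 ln u = 1 - 3 eta/4, impossible for c <= eta/4. The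
   bound 1/2 serves the range where Burgess applies to N itself. *)
pose c := Num.min (eta / 4) 2^-1.
have c_gt0 : 0 < c by rewrite lt_min divr_gt0 // invr_gt0 ltr0n.
have [c_eta c_half] : c <= eta / 4 /\ c <= 2^-1 by rewrite /c !ge_min !lexx orbT.
have e4 : 0 < eps / 4 by rewrite divr_gt0.
have [p1 burgess] := burgess_asymptotic c_gt0 e4.
have eta4 : 0 < eta / 4 by rewrite divr_gt0.
have [delta delta_gt0 [L0 prop]] := deficiency_propagation eta4.
have [p2 p2P] := ln_eventually_ge (L0 / (g0 + eps)).
have [p3 p3P] := ln_eventually_ge (ln 2 / (eps / 4)).
exists (Num.min delta 2^-1); first by rewrite lt_min delta_gt0 invr_gt0 ltr0n.
exists (maxn p1 (maxn p2 p3)) => p p_pr p_odd; rewrite !geq_max => /and3P[lep1 lep2 lep3].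
move=> N N_ge N_le; rewrite legendre_sumE //.
have p_gt0 : (0 < p)%N := prime_gt0 p_pr.
have p0 : 0 < p%:R :> R by rewrite ltr0n.
have p1' : 1 < p%:R :> R by rewrite ltr1n prime_gt1.
have p3' : 3 <= p%:R :> R by rewrite ler_nat odd_prime_gt2.
have lnp : 0 < ln p%:R :> R by rewrite ln_gt0.
have N0 : 0 < N%:R :> R by apply: lt_le_trans N_ge; rewrite powR_gt0.
have [big|small] := leP (p%:R `^ (4^-1 + eps / 4)) (N%:R : R).
  apply: le_trans (burgess p p_pr p_odd lep1 N big N_le) _; rewrite ler_wpM2r //.
  have : Num.min delta 2^-1 <= 2^-1 by rewrite ge_min lexx orbT.
  by move: c_half; lra.
have lnN : (g0 + eps) * ln p%:R <= ln N%:R.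
  by rewrite -ln_powR ler_ln ?posrE ?powR_gt0.
(* N is below p^(1/4 + eps/4), so g0 + eps < 1/4 + eps/4. Then X is at most about sqrt p, in
   particular below p, so that chi takes only the values 1 and -1 on [1, X]. *)
have eps_small : eps < 3^-1.
  have : ln N%:R < (4^-1 + eps / 4) * ln p%:R by rewrite -ln_powR ltr_ln ?posrE ?powR_gt0.
  move=> /(le_lt_trans lnN); rewrite ltr_pM2r //; move: g0_gt0; lra.
pose y := p%:R `^ (4^-1 + eps / 4) : R; pose X := (Num.truncn y).+1.
have y0 : 0 < y by rewrite powR_gt0.
have yX : y < X%:R by rewrite truncnS_gt.
have Xy : X%:R <= y + 1 by rewrite /X -natr1 lerD2r truncn_le ltW.
have y1 : 1 <= y by rewrite -(powRr0 p%:R) ler_powR ?(ltW p1') // addr_ge0 ?invr_ge0 // ltW.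
have X_lt : (X < p)%N.
  rewrite -(ltr_nat R); apply: le_lt_trans Xy _.
  have ys : y <= p%:R `^ 2^-1 by rewrite /y ler_powR ?(ltW p1') //; move: eps_small; lra.
  apply: le_lt_trans (_ : p%:R `^ 2^-1 + 1 < _); first by rewrite lerD2r.
  have : (p%:R `^ 2^-1) ^+ 2 = p%:R :> R.
    by rewrite -powR_mulrn ?powR_ge0 // -powRrM mulVf ?pnatr_eq0 // powRr1 // ltW.
  have : 0 <= p%:R `^ 2^-1 :> R by rewrite powR_ge0.
  by move: p3'; move: (p%:R) (p%:R `^ 2^-1) => P w; nra.
have NX : (N <= X)%N by rewrite -(ler_nat R) (le_trans (ltW small)) // ltW.
have lnX : ln X%:R <= u * ln N%:R.
  apply: (@le_trans _ _ (ln (2 * y))).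
    by rewrite ler_ln ?posrE ?mulr_gt0 ?ltr0n //; move: Xy y1; lra.
  rewrite lnM ?posrE // ln_powR.
  have h2 : ln 2 <= eps / 4 * ln p%:R by rewrite mulrC -ler_pdivrMr // p3P.
  apply: (@le_trans _ _ ((4^-1 + eps / 2) * ln p%:R)); first by move: h2; lra.
  rewrite /u -[leRHS]mulrA [_^-1 * _]mulrC.
  have -> : (4^-1 + eps / 2) * ln p%:R = (4^-1 + eps / 2) * ((g0 + eps) * ln p%:R / (g0 +
    eps)).
    by rewrite mulrAC divff ?mul1r // gt_eqF.
  by rewrite ler_pM2l ?addr_gt0 ?invr_gt0 ?divr_gt0 // ler_pM2r ?invr_gt0.
have lnN0 : 0 < ln N%:R :> R by apply: lt_le_trans lnN; rewrite mulr_gt0.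
have lnX0 : 0 < ln X%:R :> R.
  by apply: lt_le_trans lnN0 _; apply: ler_ln_nat.
rewrite leNgt; apply/negP => S_big.
pose f m : R := (qchar (m%:R : 'F_p))%:~R.
have fM m n : (0 < m)%N -> (0 < n)%N -> f (m * n)%N = f m * f n.
  by move=> _ _; rewrite /f natrM qcharM // intrM.
have f1 n : (0 < n <= X)%N -> f n = 1 \/ f n = -1.
  move=> /andP[n0 nX]; rewrite /f /qchar -(dvdn_pcharf (pchar_Fp p_pr)) gtnNdvd //.
    by case: ifP => _; [left|right].
  exact: leq_ltn_trans X_lt.
have [sigma [sg sgS]] : exists sigma : R, is_sign sigma /\
    sigma * (qchar_sum p N)%:~R = `|(qchar_sum p N)%:~R|.
  have [S0|S0] := leP 0 ((qchar_sum p N)%:~R : R).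
    by exists 1; split; [left|rewrite mul1r ger0_norm].
  by exists (-1); split; [right|rewrite mulN1r ltr0_norm].
have def_N : deficiency f sigma N <= delta * N%:R.
  rewrite deficiency_qchar sgS lerBlDr -lerBlDl ltW //; apply: le_lt_trans S_big.
  rewrite mulrBl mul1r lerD2l lerN2 ler_wpM2r // ge_min lexx //.
have far := prop f X N sigma fM f1 sg NX.
have L0N : L0 <= ln N%:R.
  by apply: le_trans lnN; rewrite mulrC -ler_pdivrMr // p2P.
have lnX2 : ln (X%:R : R) <= 2 * ln N%:R by apply: (le_trans lnX); rewrite ler_wpM2r // ltW.
have := far L0N lnX2 def_N; rewrite deficiency_qchar => le_far.
have S_X := burgess p p_pr p_odd lep1 X (ltW yX) (ltnW X_lt).
have sS : sigma * (qchar_sum p X)%:~R <= c * X%:R.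
  apply: le_trans S_X; case: sg => ->; rewrite ?mul1r ?mulN1r ?ler_norm //.
  by rewrite -normrN ler_norm.
have lnln : ln (ln X%:R) - ln (ln N%:R) <= ln u.
  rewrite -ln_div ?posrE // ler_ln ?posrE ?(divr_gt0 lnX0 lnN0) //.
  by rewrite ler_pdivrMr.
have X0 : 0 < X%:R :> R by rewrite ltr0n.
have : (1 - c) * X%:R <= (eta / 4 + 2 * (ln (ln X%:R) - ln (ln N%:R))) * X%:R.
  by apply: le_trans le_far; rewrite mulrBl mul1r lerD2l lerN2.
rewrite ler_pM2r // => le_c.
by move: lnln c_eta eta_gt0 le_c; rewrite /eta; lra.
Qed.
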